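(* Suppose that $$\int_1^\infty g^{-1/m}(\zeta)\,\zeta^{1/m-1}\,d\zeta<\infty \qquad\text{and}\qquad \int_{\Omega\setminus S}\gamma\left(\frac{1}{f(x)}\right)dx<\infty .$$ Let $k$ be a real number such that $$\limsup_{r\to+0}\frac{\operatorname{mes}(S_r\setminus S)}{r^{n-k}}<\infty$$ and, moreover, $$\limsup_{r\to+0} r^{\,n-k-m}\,G^{-1}\left(C\,r\,\operatorname{ess\,inf}_{S_r\setminus S} f^{1/m}\right)<\infty$$ and $$\liminf_{r\to+0} r^m\,\mu\left(C r^{m-n+k}\right)\operatorname{ess\,inf}_{S_r\setminus S} f>0$$ for all real numbers $C>0$, where $G^{-1}$ is the inverse function to $$G(t)=\int_t^\infty g^{-1/m}(\zeta)\,\zeta^{1/m-1}\,d\zeta .$$ Then the singular set $S$ is removable for any weak solution $u$ of the inequality $$\sum_{|\alpha|=m}\partial^\alpha a_\alpha(x,u)\ge f(x)\,g(|u|)\quad\text{in }\Omega\setminus S .$$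
   Context: Setting. $m,n\ge1$ are integers, $\Omega\subset\mathbb R^n$ is a bounded domain, $S$ is a compact subset of $\Omega$. For each multi-index $\alpha$ with $|\alpha|=m$, $a_\alpha:\Omega\times\mathbb R\to\mathbb R$ is a Caratheodory function, and there is a constant $A>0$ with $|a_\alpha(x,\zeta)|\le A|\zeta|$ for almost all $x\in\Omega$ and all $\zeta\in\mathbb R$. $f:\Omega\to[0,\infty)$ is measurable. $g:[0,\infty)\to[0,\infty)$ is twice continuously differentiable, $g(0)=0$, and $g(\zeta)>0$, $g'(\zeta)>0$, $g''(\zeta)>0$ for all $\zeta\in(0,\infty)$. Notation. For $\omega\subset\mathbb R^n$ and $r>0$, $\omega_r$ is the set of points of $\mathbb R^n$ whose distance to $\omega$ is less than $r$. $\operatorname{mes}$ is Lebesgue measure on $\mathbb R^n$. Weak solution. $u$ is a weak solution of $\sum_{|\alpha|=m}\partial^\alpha a_\alpha(x,u)\ge f(x)g(|u|)$ in $\Omega\setminus S$ if $u\in L_1(\Omega\setminus S_r)$ and $f(x)g(|u|)\in L_1(\Omega\setminus S_r)$ for any $r>0$, and $$\int_\Omega\sum_{|\alpha|=m}(-1)^m a_\alpha(x,u)\,\partial^\alpha\varphi\,dx\ge\int_\Omega f(x)g(|u|)\varphi\,dx\qquad( * )$$ for any non-negative $\varphi\in C_0^\infty(\Omega\setminus S)$. Removability. The singular set $S$ is removable (for $u$) if $u\in L_1(\Omega)$, $f(x)g(|u|)\in L_1(\Omega)$, and $( * )$ holds for all non-negative $\varphi\in C_0^\infty(\Omega)$;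 here $u$ is extended by zero to $S$. The functions $\gamma$ and $\mu$. The Legendre transformation of $g$ is $g^*(\xi)=\int_{g'(0)}^{\xi}(g')^{-1}(\zeta)\,d\zeta$ for $\xi>g'(0)$ and $g^*(\xi)=0$ for $\xi\le g'(0)$, where $(g')^{-1}$ is the inverse function to $g'$. For $\xi>0$, $\gamma(\xi)=g^*(\xi)/\xi$ and $\mu(\xi)=\inf_{t\ge\xi}g(t)/t$. Conventions: $\gamma(1/f(x))=+\infty$ where $f(x)=0$, and $G^{-1}(0)=+\infty$. *)

(* Defs.v *)
From HB Require Import structures.
From mathcomp Require Import all_boot all_order all_algebra.
From mathcomp Require Import all_classical all_reals all_analysis.
From mathcomp Require Import ess_sup_inf.

Set Implicit Arguments.
Unset Strict Implicit.
Unset Printing Implicit Defensive.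
Import Order.TTheory GRing.Theory Num.Theory.
Import numFieldNormedType.Exports.

Local Open Scope classical_set_scope.
Local Open Scope ring_scope.

(** * Lebesgue measure on R^n *)

Section lebesgue_rV.
Context {R : realType} (n : nat).

Definition box (B : 'rV[R]_n * 'rV[R]_n) : set 'rV[R]_n :=
  [set x | forall i, B.1 ord0 i <= x ord0 i <= B.2 ord0 i].

Definition box_volume (B : 'rV[R]_n * 'rV[R]_n) : R :=
  \prod_(i < n) Num.max 0 (B.2 ord0 i - B.1 ord0 i).

Definition box_cover (A : set 'rV[R]_n) (D : set ('rV[R]_n * 'rV[R]_n)) :=
  countable D /\ A `<=` \bigcup_(B in D) box B.

Definition lebesgue_outer (A : set 'rV[R]_n) : \bar R :=
  ereal_inf [set \esum_(B in D) (box_volume B)%:E | D in box_cover A].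

Local Open Scope ereal_scope.

Let vol_ge0 B : 0 <= (box_volume B)%:E.
Proof. by rewrite lee_fin; apply: prodr_ge0 => i _; rewrite le_max lexx. Qed.

Let lebesgue_outer_ge0 A : 0 <= lebesgue_outer A.
Proof. by apply: le_ereal_inf_tmp => _ [D _ <-]; exact: esum_ge0. Qed.

Let lebesgue_outer0 : lebesgue_outer set0 = 0.
Proof.
apply/eqP; rewrite eq_le lebesgue_outer_ge0 andbT.
apply: ereal_inf_lbound; exists set0; last exact: esum_set0.
by split => // x.
Qed.

Let le_lebesgue_outer : {homo lebesgue_outer : A B / A `<=` B >-> A <= B}.
Proof.
move=> A B AB; apply/ereal_inf_le_tmp => _ [D [cD BD] <-].
by exists D => //; split => //; exact: subset_trans BD.
Qed.

Let lebesgue_outer_sigma_subadditive : sigma_subadditive lebesgue_outer.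
Proof.
move=> A; have [[i ioo]|] := pselect (exists i, lebesgue_outer (A i) = +oo).
  by rewrite (eseries_pinfty _ _ ioo) ?leey// => k _; rewrite -ltNye
    (lt_le_trans _ (lebesgue_outer_ge0 _)).
rewrite -forallNE => Aoo; apply/lee_addgt0Pr => e e0.
rewrite (le_trans _ (epsilon_trick _ _ (ltW e0)))//.
pose P k D := box_cover (A k) D /\
  \esum_(B in D) (box_volume B)%:E <=
    lebesgue_outer (A k) + (e / (2 ^ k.+1)%:R)%:E.
have [G PG] : {G : (set _)^nat & forall k, P k (G k)}.
  apply: (@choice _ _ P) => k; rewrite /P.
  have fin : lebesgue_outer (A k) \is a fin_num.
    by rewrite ge0_fin_numE// ltey; apply/eqP/Aoo.
  have ek0 : (0 < e / (2 ^ k.+1)%:R)%R.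
    by rewrite divr_gt0// ltr0n expn_gt0.
  have [_ [D cD <-] /ltW leD] := lb_ereal_inf_adherent ek0 fin.
  by exists D.
apply: (@le_trans _ _ (\esum_(B in \bigcup_k G k) (box_volume B)%:E)).
  apply: ereal_inf_lbound; exists (\bigcup_k G k) => //; split.
    by apply: bigcup_countable => // k _; exact: (PG k).1.1.
  move=> x [k _ /(PG k).1.2 [B GB Bx]]; exists B => //.
  by exists k.
rewrite seqDU_bigcup_eq esum_bigcupT; [|exact: trivIset_seqDU|exact: vol_ge0].
rewrite -nneseries_esumT; last by move=> k; exact: esum_ge0.
apply: lee_nneseries => k _; first by move=> *; exact: esum_ge0.
apply: le_trans (PG k).2.
rewrite esum_mkcond [leRHS]esum_mkcond; apply: le_esum => B _.
have sub := @subset_seqDU _ G k B.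
case: ifPn => [/set_mem/sub GB|_]; first by rewrite mem_set.
by case: ifPn.
Qed.

HB.instance Definition _ := isOuterMeasure.Build R _ lebesgue_outer
  lebesgue_outer0 lebesgue_outer_ge0 le_lebesgue_outer
  lebesgue_outer_sigma_subadditive.

End lebesgue_rV.

(* R^n with the sigma-algebra of Lebesgue (not only Borel) measurable sets. *)
Definition Rn (R : realType) (n : nat) :=
  caratheodory_type (@lebesgue_outer R n : {outer_measure set _ -> \bar R}).

HB.instance Definition _ (R : realType) (n : nat) := Measurable.copy (Rn R n)
  (caratheodory_type (@lebesgue_outer R n : {outer_measure set _ -> \bar R})).

Definition mes (R : realType) (n : nat) : {measure set (Rn R n) -> \bar R} :=
  [the {measure set (caratheodory_type _) -> \bar R} of
    (@lebesgue_outer R n : {outer_measure set _ -> \bar R})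
      : set (caratheodory_type _) -> \bar R].

(** * Euclidean neighbourhoods *)

Section euclidean.
Context {R : realType} {n : nat}.
Implicit Types (x y : 'rV[R]_n) (W : set 'rV[R]_n).

(* The library norm on 'rV[R]_n is the sup norm: it induces the same topology
   and the same bounded sets, but distances have to be Euclidean. *)
Definition edist x y : R :=
  Num.sqrt (\sum_(i < n) (x ord0 i - y ord0 i) ^+ 2).

Definition edist_set x W : \bar R :=
  ereal_inf [set (edist x y)%:E | y in W].

Definition nbd W (r : R) : set 'rV[R]_n :=
  [set x | (edist_set x W < r%:E)%E].

Definition bounded_domain W :=
  [/\ open W, connected W, W !=set0 & bounded_set W].

Definition ess_inf_on W (h : 'rV[R]_n -> R) : \bar R :=
  ess_inf (mes R n) (patch (cst +oo%E) W (EFin \o h)).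

End euclidean.

(** * Partial derivatives and test functions *)

Section test_functions.
Context {R : realType} {n : nat}.
Implicit Types (phi : 'rV[R]_n -> R) (U : set 'rV[R]_n).

Definition partial (i : 'I_n) phi : 'rV[R]_n -> R :=
  fun x => 'D_(delta_mx ord0 i) phi x.

Definition smooth phi := forall s : seq 'I_n,
  let psi := foldr partial phi s in
  continuous psi /\ forall i x, derivable psi x (delta_mx ord0 i).

Definition test_function U phi :=
  [/\ smooth phi, compact (closure [set x | phi x != 0])
    & closure [set x | phi x != 0] `<=` U].

(* The multi-indices alpha with |alpha| = m, as a finite type: their entries
   are at most m. *)
Definition multi_index (m : nat) :=
  {alpha : {ffun 'I_n -> 'I_m.+1} | (\sum_(i < n) alpha i == m)%N}.

Definition partial_multi m (alpha : multi_index m) phi : 'rV[R]_n -> R :=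
  foldr (fun i psi => iter (val alpha i) (partial i) psi) phi (enum 'I_n).

End test_functions.
Arguments multi_index : clear implicits.

(** * Weak solutions and removability *)

Section weak_solutions.
Context {R : realType} {m n : nat}.
Variable Omega S : set 'rV[R]_n.
Variable a : multi_index n m -> 'rV[R]_n -> R -> R.
Variables f : 'rV[R]_n -> R.
Variable g : R -> R.
Implicit Types (U : set 'rV[R]_n) (u : 'rV[R]_n -> R).
Local Open Scope ereal_scope.

Definition caratheodory_function U (b : 'rV[R]_n -> R -> R) :=
  (forall z : R, measurable_fun (U : set (Rn R n)) (b ^~ z)) /\
  {ae mes R n, forall x, U x -> continuous (b x)}.

Definition L1 U u := (mes R n).-integrable (U : set (Rn R n)) (EFin \o u).

Definition weak_inequality U u := forall phi : 'rV[R]_n -> R,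
  test_function U phi -> (forall x, (0 <= phi x)%R) ->
  \int[mes R n]_(x in Omega)
     (\sum_alpha (-1) ^+ m * a alpha x (u x) * partial_multi alpha phi x)%:E
  >= \int[mes R n]_(x in Omega) (f x * g `|u x| * phi x)%:E.

Definition weak_solution u :=
  (forall r : R, (0 < r)%R ->
     L1 (Omega `\` nbd S r) u /\
     L1 (Omega `\` nbd S r) (fun x => f x * g `|u x|)%R) /\
  weak_inequality (Omega `\` S) u.

Definition removable u :=
  let u0 := u \_ (~` S) in
  [/\ L1 Omega u0, L1 Omega (fun x => f x * g `|u0 x|)%R
    & weak_inequality Omega u0].

End weak_solutions.

(** * The functions built from g *)

(* g lives on [0, +oo[: only its values there matter, and its derivatives are
   taken within [0, +oo[ (one-sided at 0). *)
Section halfline.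
Context {R : realType}.
Implicit Type g : R -> R.

Definition diff_quot g (x : R) : R -> R := fun y => (g y - g x) / (y - x).

Definition halfline_dnbhs (x : R) := within `[0, +oo[%classic x^'.

Definition hderive g : R -> R :=
  fun x => lim (diff_quot g x @ halfline_dnbhs x).

Definition hderivable g :=
  forall x : R, 0 <= x -> cvg (diff_quot g x @ halfline_dnbhs x).

Definition C2_halfline g :=
  [/\ hderivable g, hderivable (hderive g)
    & {within `[0, +oo[%classic, continuous (hderive (hderive g))}].

Local Open Scope ereal_scope.

Definition hderive_inv g : R -> R :=
  'pinv_(cst 0%R) `[0%R, +oo[%classic (hderive g).

Definition legendre g (xi : R) : \bar R :=
  if (hderive g 0 < xi)%R then
    \int[lebesgue_measure]_(z in `[hderive g 0%R, xi]) (hderive_inv g z)%:E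
  else 0.

Definition gamma g (xi : R) : \bar R := legendre g xi * (xi^-1)%:E.

Definition gamma_recip g (y : R) : \bar R :=
  if y == 0%R then +oo else gamma g (1 / y).

Definition mu g (xi : R) : \bar R :=
  ereal_inf [set (g t / t)%:E | t in `[xi, +oo[%classic].

Definition G (m : nat) g (t : R) : \bar R :=
  \int[lebesgue_measure]_(z in `[t, +oo[)
    (g z `^ (- (1 / m%:R)) * z `^ (1 / m%:R - 1))%:E.

(* The argument is extended real because essential infima are; G maps
   ]0, +oo[ into ]0, +oo[ whenever G 1 is finite. *)
Definition G_inv (m : nat) g (s : \bar R) : \bar R :=
  if s == 0 then +oo else ('pinv_(cst 0%R) `]0%R, +oo[%classic (G m g) s)%:E.

End halfline.

(* Main.v *)
(* Testing the weak inequality on smooth cutoffs of S bounds the mass of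
   f g(|u|) off S_r2 by a constant plus C (r2 - r1)^-m times the mass of |u| in
   the layer S_r2 \ S_r1.  Let F be the essential infimum of f^(1/m) on S_r \ S
   and w(s) the mass of |u| in S_r \ S_(r-s), divided by M = C' r^(n-k), which
   dominates mes (S_r \ S).  By Jensen's inequality, either the mass of f g(|u|)
   off S_r is at most a constant, or (F h)^m g(w(s)) <= K w(s + h); each doubling
   of w then takes a distance at most C (t / g(t))^(1/m) / F, where t is the
   value reached, and these distances sum to at most C G(w(s) / 2) / F.  Hence
   w(r/2) <= 2 G^-1(c r F), and the limsup hypothesis bounds the mass of f g(|u|)
   as r -> 0.  Young's inequality for g and g^* then gives u in L_1.
   The liminf hypothesis yields |u| <= eps r^(m-n+k) + (r^m / c) f g(|u|) on
   S_r \ S, so the mass of |u| there is o(r^m) along some r -> 0: this is what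
   it takes to cut a test function off near S at scale r at no cost in the limit. *)

Require Import Defs.
From mathcomp Require Import all_boot all_order all_algebra.
From mathcomp Require Import all_classical all_reals all_analysis.
From mathcomp Require Import measurable_realfun ess_sup_inf.
From mathcomp Require Import ring lra.
Set Implicit Arguments.
Unset Strict Implicit.
Unset Printing Implicit Defensive.
Import Order.TTheory GRing.Theory Num.Theory.
Import numFieldNormedType.Exports.
Local Open Scope classical_set_scope.
Local Open Scope ring_scope.

Local Notation edist := Defs.edist.

(** * Lebesgue measurability in R^n *)

(** The mass [w] is only monotone and may jump, so there is no differential inequality to integrate
    by separation of variables. A finite-difference inequality replaces it. One doubling up from [t]
    costs a distance of order [(t / g t)^(1/m)], which is at most twice [G (t / 2) - G t] because
    the integrand of [G] decreases, and these differences telescope. The constant produced by the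
    cutoff far from [S] would spoil this inequality. It is absorbed as soon as the mass of
    [f g(|u|)] exceeds twice that constant; otherwise the mass is already bounded. Dividing by the
    upper bound [M] instead of the true measure is harmless since [g 0 = 0]. Finiteness of [G 1]
    also forces [g'] to be unbounded. Hence the inverse of [g'] is defined on all of [[g'(0), +oo[],
    and Young's inequality holds at every [1 / f x] with [f x > 0]. [S] may have positive measure
    and [u] is arbitrary on it, so the estimates are carried out on [Omega] minus [S]. In the last
    step a cutoff at scale [r] costs [r^-m] in the flux, and a mass of size [o(r^m)] compensates
    exactly this. *)

Lemma esum_image_le (R : realType) (T T' : pointedType) (D : set T) (e : T -> T')
    (a : T' -> \bar R) : (forall y, (0 <= a y)%E) ->
  (\esum_(y in e @` D) a y <= \esum_(x in D) a (e x))%E.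
Proof.
move=> a0.
have [s Ps] : {s : T' -> T & forall y, (e @` D) y -> D (s y) /\ e (s y) = y}.
  apply: (@choice _ _ (fun y x => (e @` D) y -> D x /\ e x = y)) => y.
  have [[x Dx exy]|nD] := pselect ((e @` D) y); first by exists x.
  by exists point.
have sI : set_inj (e @` D) s.
  by move=> y y' /set_mem /Ps[_ {2}<-] /set_mem /Ps[_ {2}<-] ->.
rewrite (eq_esum (b := fun y => a (e (s y)))); last by move=> y /Ps[_ ->].
rewrite -(esum_image _ _ (a \o e) sI).
rewrite esum_mkcond [leRHS]esum_mkcond; apply: le_esum => x _.
case: ifPn => [/set_mem[y ey <-]|_]; first by rewrite mem_set//; case: (Ps _ ey).
by case: ifPn => //=.
Qed.

Section lebesgue_measurable.
Context {R : realType} {n : nat}.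
Implicit Types U : set 'rV[R]_n.

Let box_le (i : 'I_n) c (B : 'rV[R]_n * 'rV[R]_n) : 'rV[R]_n * 'rV[R]_n :=
  (B.1, \row_j (if j == i then Num.min (B.2 ord0 j) c else B.2 ord0 j)).

Let box_ge (i : 'I_n) c (B : 'rV[R]_n * 'rV[R]_n) : 'rV[R]_n * 'rV[R]_n :=
  (\row_j (if j == i then Num.max (B.1 ord0 j) c else B.1 ord0 j), B.2).

(** Only the [i]-th factor changes. The truncation by [Num.max 0] keeps the identity true when one
    half is empty or when the box itself is. *)
Lemma box_volume_split i c (B : 'rV[R]_n * 'rV[R]_n) :
  box_volume (box_le i c B) + box_volume (box_ge i c B) = box_volume B.
Proof.
rewrite /box_volume (bigD1 i)//= [X in _ + X](bigD1 i)//= [RHS](bigD1 i)//=.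
set P := (X in _ = _ * X).
have -> : \prod_(j < n | j != i) Num.max 0
    ((\row_j (if j == i then Num.min (B.2 ord0 j) c else B.2 ord0 j)) ord0 j
      - B.1 ord0 j) = P.
  by apply: eq_bigr => j ji; rewrite mxE (negbTE ji).
have -> : \prod_(j < n | j != i) Num.max 0 (B.2 ord0 j -
    (\row_j (if j == i then Num.max (B.1 ord0 j) c else B.1 ord0 j)) ord0 j) = P.
  by apply: eq_bigr => j ji; rewrite mxE (negbTE ji).
rewrite !mxE eqxx -mulrDl; congr (_ * _).
move: (B.1 ord0 i) (B.2 ord0 i) => a b.
case: (leP b c) => ?; case: (leP a c) => ?; case: (leP 0 (b - a)) => ?;
  repeat match goal with |- context [Num.max 0 ?x] => case: (leP 0 x) => ? end; lra.
Qed.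

(** Carathéodory's criterion: the half-space cuts a cover of [X] into a cover of each part, and
    [box_volume_split] preserves the total volume. The halves share a face, which costs nothing.
    Distinct boxes may have the same half, hence [esum_image_le]. *)
Lemma halfspace_measurable (i : 'I_n) (c : R) :
  measurable ([set x | x ord0 i <= c] : set (Rn R n)).
Proof.
apply: le_caratheodory_measurable => X.
apply: le_ereal_inf_tmp => _ [D [cD XD] <-].
have v0 (B : 'rV[R]_n * 'rV[R]_n) : (0 <= (box_volume B)%:E)%E.
  by rewrite lee_fin; apply: prodr_ge0 => j _; rewrite le_max lexx.
have -> : \esum_(B in D) (box_volume B)%:E =
    (\esum_(B in D) (box_volume (box_le i c B))%:E +
     \esum_(B in D) (box_volume (box_ge i c B))%:E)%E.
  rewrite -esumD//; apply: eq_esum => B _.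
  by rewrite -EFinD box_volume_split.
apply: leeD.
  apply: le_trans (esum_image_le D (box_le i c) (a := fun B => (box_volume B)%:E) _) => //.
  apply: ereal_inf_lbound; exists (box_le i c @` D) => //; split.
    exact: sub_countable (card_image_le _ _) cD.
  move=> x [Xx /= xc]; have [B DB Bx] := XD _ Xx.
  exists (box_le i c B); first by exists B.
  move=> j; rewrite /= mxE; have /andP[-> xB] := Bx j.
  by case: eqP => [ji|//]; rewrite le_min xB/= ji xc.
apply: le_trans (esum_image_le D (box_ge i c) (a := fun B => (box_volume B)%:E) _) => //.
apply: ereal_inf_lbound; exists (box_ge i c @` D) => //; split.
  exact: sub_countable (card_image_le _ _) cD.
move=> x [Xx /= /negP xc]; have [B DB Bx] := XD _ Xx.
exists (box_ge i c B); first by exists B.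
move=> j; rewrite /= mxE; have /andP[xB ->] := Bx j.
rewrite andbT; case: eqP => [ji|//]; rewrite ge_max xB/= ji.
by rewrite ltW// ltNge.
Qed.

Lemma box_measurable (B : 'rV[R]_n * 'rV[R]_n) : measurable (box B : set (Rn R n)).
Proof.
have -> : box B = \bigcap_(i in [set: 'I_n])
    ([set x | x ord0 i <= B.2 ord0 i] `&`
     ~` (\bigcup_k [set x | x ord0 i <= B.1 ord0 i - k.+1%:R^-1])).
  apply/seteqP; split => [x Bx i _|x Bx i].
    have /andP[lx xu] := Bx i; split => // -[k _ /=] /(le_trans lx).
    by apply/negP; rewrite -ltNge ltrBlDr ltrDl invr_gt0.
  have [/= -> lx] := Bx i I; rewrite andbT leNgt; apply/negP => xl.
  apply: lx; have /ltr_add_invr[k kx] := xl.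
  by exists k => //=; rewrite lerBrDr ltW.
apply: fin_bigcap_measurable; first exact: finite_finset.
move=> i _; apply: measurableI; first exact: halfspace_measurable.
by apply/measurableC/bigcupT_measurable => k; exact: halfspace_measurable.
Qed.

(** The boxes with rational corners contained in [U] are countably many and cover it. *)
Lemma open_measurable_Rn U : open U -> measurable (U : set (Rn R n)).
Proof.
move=> oU.
pose ratbox (p : 'rV[rat]_n * 'rV[rat]_n) : set 'rV[R]_n :=
  box (map_mx ratr p.1, map_mx ratr p.2).
have -> : U = \bigcup_(p in [set: 'rV[rat]_n * 'rV[rat]_n])
    (if pselect (ratbox p `<=` U) then ratbox p else set0).
  apply/seteqP; split => [x Ux|x [p _]]; last by case: pselect => // h /h.
  have /nbhs_ballP[e/= e0 xeU] := open_nbhs_nbhs (conj oU Ux).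
  have [p Pp] : {p : 'I_n -> rat & forall i, x ord0 i - e < ratr (p i) < x ord0 i}.
    apply: (@choice _ _ (fun i q => x ord0 i - e < ratr q < x ord0 i)) => i.
    have : x ord0 i - e < x ord0 i by rewrite ltrBlDr ltrDl.
    by move=> /rat_in_itvoo[q]; rewrite in_itv/= => ?; exists q.
  have [q Pq] : {q : 'I_n -> rat & forall i, x ord0 i < ratr (q i) < x ord0 i + e}.
    apply: (@choice _ _ (fun i q => x ord0 i < ratr q < x ord0 i + e)) => i.
    have : x ord0 i < x ord0 i + e by rewrite ltrDl.
    by move=> /rat_in_itvoo[q]; rewrite in_itv/= => ?; exists q.
  exists (\row_i p i, \row_i q i) => //; case: pselect => [h|]; last case.
    move=> i; rewrite /= !mxE.
    by have /andP[_ /ltW->] := Pp i; have /andP[/ltW->] := Pq i.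
  move=> y By; apply: xeU; split => // a i; rewrite (ord1 a) /ball/=.
  have /= := By i; rewrite !mxE => /andP[py yq].
  have /andP[px _] := Pp i; have /andP[_ qx] := Pq i.
  by rewrite ltr_norml; apply/andP; split; lra.
apply: countable_bigcupT_measurable => // p.
case: pselect => h /=; [exact: (box_measurable (map_mx ratr p.1, map_mx ratr p.2))|exact: measurable0].
Qed.

Lemma closed_measurable_Rn U : closed U -> measurable (U : set (Rn R n)).
Proof.
by move=> cU; rewrite -[U]setCK; apply/measurableC/open_measurable_Rn/closed_openC.
Qed.

Lemma continuous_measurable_Rn (h : 'rV[R]_n -> R) (D : set (Rn R n)) :
  measurable D -> continuous h -> measurable_fun D (h : Rn R n -> R).
Proof.
move=> mD ch; apply: (@measurable_funS _ _ _ _ setT) => //.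
apply: (measurability _ (RGenOpens.measurableE R)) => // V0 [V [a [b ->]] <-].
rewrite setTI; apply: open_measurable_Rn.
apply: (@open_comp _ _ h `]a, b[%classic); last exact: interval_open.
by move=> x _; exact: ch.
Qed.

(** Completeness of Carathéodory's measure: every preimage inside [N] is a subset of a null set. *)
Lemma null_measurable_fun (N : set (Rn R n)) (h : Rn R n -> R) :
  mes R n N = 0%E -> measurable N -> measurable_fun N h.
Proof.
move=> N0 mN _ B mB; apply: (@measure_is_complete_caratheodory R).
by exists N; split => //; exact: subIsetl.
Qed.

(** Completeness handles the null set where [b x] may fail to be continuous. Elsewhere [u] is
    rounded down to multiples of [1 / (k + 1)]: each [h k] is pieced together from countably many
    sections [b ^~ z], and [h k] converges to the composition by continuity of [b x]. *)
Lemma caratheodory_comp_measurable (D : set (Rn R n)) (b : 'rV[R]_n -> R -> R)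
    (u : 'rV[R]_n -> R) : measurable D ->
  caratheodory_function D b -> measurable_fun D (u : Rn R n -> R) ->
  measurable_fun D ((fun x => b x (u x)) : Rn R n -> R).
Proof.
move=> mD [mb [N [mN N0 bN]]] mu.
have mDN : measurable (D `\` N) by exact: measurableD.
rewrite -(setDUK (@subIsetl _ D N)) setUC setDIr setDv set0U.
apply/measurable_funU => //; first exact: measurableI.
split; last first.
  apply: (@measurable_funS _ _ _ _ N) => //.
  exact: null_measurable_fun.
pose h (k : nat) (x : Rn R n) := b x ((Num.floor (u x * k.+1%:R))%:~R / k.+1%:R).
apply: (@measurable_fun_cvg _ _ _ _ h); last first.
  move=> x [Dx Nx].
  have cbx : continuous (b x) by apply: contrapT => ncb; apply: Nx; apply: bN => /(_ Dx).
  suff cu : (fun k => (Num.floor (u x * k.+1%:R))%:~R / k.+1%:R) @ \oo --> u x.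
    exact: (cvg_comp _ _ cu (cbx (u x))).
  apply/cvgrPdist_le => e e0; near=> k.
  have k0 : (0 : R) < k.+1%:R by [].
  rewrite -{1}[u x](mulfK (lt0r_neq0 k0)) -mulrBl normrM normfV (gtr0_norm k0).
  rewrite ler_pdivrMr// ger0_norm ?subr_ge0 ?floor_le//.
  apply: (@le_trans _ _ 1); last first.
    rewrite mulrC -ler_pdivrMr// mul1r.
    by rewrite (le_trans (ltW (near (nbhs_infty_gtr e^-1) k _)))// ler_nat.
  by have /andP[_] := floor_itv (u x * k.+1%:R); rewrite intrD => /ltW; rewrite lerBlDl.
move=> k _ B mB.
rewrite [X in measurable X](_ : _ = \bigcup_(z in [set: int])
   ((D `\` N) `&` u @^-1` `[z%:~R / k.+1%:R, (z + 1)%:~R / k.+1%:R[ `&`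
    ((D `\` N) `&` (b ^~ (z%:~R / k.+1%:R)) @^-1` B))).
  apply: countable_bigcupT_measurable => // z; apply: measurableI.
    apply: (measurable_funS mD _ mu) => //.
  by apply: (measurable_funS mD _ (mb _)) => //.
have k0 : (0 : R) < k.+1%:R by [].
apply/seteqP; split => [x [DNx Bx]|x [z _ [[DNx /= uz] [_ Bx]]]].
  exists (Num.floor (u x * k.+1%:R)) => //; do 2 split => //=.
  by rewrite in_itv/= ler_pdivrMr// ltr_pdivlMr// floor_itv.
split => //; rewrite /preimage/= /h (_ : Num.floor _ = z)//.
by apply: floor_def; move: uz; rewrite in_itv/= ler_pdivrMr// ltr_pdivlMr.
Unshelve. all: end_near. Qed.

End lebesgue_measurable.

(** * Smooth functions and cutoffs *)

Section smooth_line.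
Context {R : realType}.
Implicit Types f g : R -> R.

Definition smooth1 f := forall k (x : R), derivable ((derive1n k f)) x 1.

(** The innermost derivative is peeled off first, unlike in [smooth1]. Closure under products,
    inverses and affine changes then follows by induction on [k] from the formula for the first
    derivative. *)
Fixpoint derivable_upto k f :=
  if k is k'.+1 then (forall x : R, derivable f x 1) /\ derivable_upto k' (derive1 f) else True.

Lemma smooth1P f : smooth1 f <-> forall k, derivable_upto k f.
Proof.
split=> [sf k|sf k x].
  elim: k f sf => //= k IH f sf; split => [x|]; first exact: (sf 0%N).
  by apply: IH => j x; rewrite -derive1Sn; exact: sf.
have : derivable_upto k.+1 f by [].
elim: k f {sf} => [|k IH] f [df sf]; first exact: df.
by rewrite derive1Sn; exact: IH.
Qed.

Lemma is_derive_derive1 f df : (forall x, is_derive (x : R) 1 f (df x)) -> (derive1 f) = df.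
Proof. by move=> fdf; apply/funext => x; rewrite derive1E; case: (fdf x). Qed.

Lemma derivable_uptoW k f : derivable_upto k.+1 f -> derivable_upto k f.
Proof. by elim: k f => // k IH f [df sf]; split => //; exact: IH. Qed.

Lemma derivable_is_derive1 f x : derivable f x 1 -> is_derive (x : R) 1 f ((derive1 f) x).
Proof. by move=> df; rewrite derive1E; apply: DeriveDef. Qed.

Lemma derivable_upto_eq k f df : (forall x, is_derive (x : R) 1 f (df x)) ->
  derivable_upto k df -> derivable_upto k.+1 f.
Proof.
move=> fdf sdf; split; first by move=> x; case: (fdf x).
by rewrite (is_derive_derive1 fdf).
Qed.

Lemma derivable_upto_cst k (c : R) : derivable_upto k (cst c).
Proof.
elim: k c => // k IH c; apply: (@derivable_upto_eq _ _ (cst 0)); exact: IH.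
Qed.

Lemma derivable_uptoD k f g : derivable_upto k f -> derivable_upto k g ->
  derivable_upto k (f \+ g).
Proof.
elim: k f g => // k IH f g [df sf] [dg sg].
apply: (@derivable_upto_eq _ _ ((derive1 f) \+ (derive1 g))); last exact: IH.
by move=> x; apply: is_deriveD; exact: derivable_is_derive1.
Qed.

Lemma derivable_uptoM k f g : derivable_upto k f -> derivable_upto k g ->
  derivable_upto k (f \* g).
Proof.
elim: k f g => // k IH f g sf sg; have [df sf'] := sf; have [dg sg'] := sg.
apply: (@derivable_upto_eq _ _ ((f \* (derive1 g)) \+ (g \* (derive1 f)))).
  by move=> x; apply: is_deriveM; exact: derivable_is_derive1.
by apply: derivable_uptoD; apply: IH => //; exact: derivable_uptoW.
Qed.

Lemma derivable_uptoV k f : (forall x, f x != 0) -> derivable_upto k f ->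
  derivable_upto k (fun x => (f x)^-1).
Proof.
move=> f0; elim: k => // k IH sf; have [df sf'] := sf.
pose V x := (f x)^-1.
apply: (@derivable_upto_eq _ _ (cst (-1) \* ((V \* V) \* (derive1 f)))).
  move=> x; apply: DeriveDef; first exact: derivableV.
  by rewrite deriveV// -derive1E /= /V scaleNr mulN1r -exprVn expr2.
have sV := IH (derivable_uptoW sf).
by repeat apply: derivable_uptoM => //; exact: derivable_upto_cst.
Qed.

Lemma derivable_upto_affine k f a b : derivable_upto k f ->
  derivable_upto k (fun x => f (a * x + b)).
Proof.
elim: k f => // k IH f [df sf].
apply: (@derivable_upto_eq _ _ ((fun x => (derive1 f) (a * x + b)) \* cst a)); last first.
  by apply: derivable_uptoM; [exact: IH|exact: derivable_upto_cst].
move=> x; apply: (@is_derive1_comp _ f (fun x => a * x + b)).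
  exact: derivable_is_derive1.
rewrite -[X in is_derive _ _ _ X]addr0; apply: is_deriveD.
have := @is_deriveZ _ _ _ (@id R) a x 1 1 (is_derive_id _ _).
by rewrite /GRing.scale/= mulr1.
Qed.

Lemma smooth1_affine_deriven f a b k : smooth1 f ->
  (derive1n k (fun x => f (a * x + b))) = (fun x => a ^+ k * (derive1n k f) (a * x + b)).
Proof.
move=> sf; elim: k => [|k IH]; first by apply/funext => x; rewrite expr0 mul1r.
rewrite derive1nS IH; apply: is_derive_derive1 => x.
have -> : a ^+ k.+1 * (derive1n (k.+1) f) (a * x + b) =
    a ^+ k *: ((derive1 (derive1n k f)) (a * x + b) * a).
  by rewrite derive1nS /GRing.scale/= exprSr -!mulrA [a * _]mulrC.
apply: is_deriveZ.
apply: (@is_derive1_comp _ (derive1n k f) (fun x => a * x + b)).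
  exact: derivable_is_derive1.
rewrite -[X in is_derive _ _ _ X]addr0; apply: is_deriveD.
have := @is_deriveZ _ _ _ (@id R) a x 1 1 (is_derive_id _ _).
by rewrite /GRing.scale/= mulr1.
Qed.

(* The polynomials make this family of flat functions stable under derivation. *)
Definition flat (p : {poly R}) (t : R) : R :=
  if 0 < t then p.[t^-1] * expR (- t^-1) else 0.

(** With [y = t^-1], the bound [expR y >= y^(i+1) / (i+1)!] gives [y^i expR (- y) <= (i+1)! t] for
    each monomial of [p]. *)
Lemma flat_bound p : exists K, forall t, 0 < t -> t <= 1 -> `|flat p t| <= K * t.
Proof.
exists (\sum_(i < size p) `|p`_i| * (i.+1)`!%:R) => t t0 t1.
rewrite /flat t0 horner_coef !mulr_suml.
apply: le_trans (ler_norm_sum _ _ _) _; apply: ler_sum => i _.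
have y0 : 0 < t^-1 by rewrite invr_gt0.
rewrite !normrM -!mulrA ler_wpM2l// (gtr0_norm (expR_gt0 _)) normrX gtr0_norm//.
rewrite expRN ler_pdivrMr ?expR_gt0// -mulrA -ler_pdivrMl ?ltr0n ?fact_gt0//.
rewrite -ler_pdivrMl//.
apply: le_trans (_ : 1 + t^-1 ^+ i.+1 / (i.+1)`!%:R <= _); last exact: expR_ge1Dxn (ltW y0).
by rewrite mulrCA -exprS mulrC lerDr.
Qed.

Lemma is_derive_flat p (x : R) :
  is_derive x 1 (flat p) (flat ('X^2 * (p - p^`())) x).
Proof.
have [x0|x0|->] := ltgtP x 0.
- have -> : flat ('X^2 * (p - p^`())) x = 0 by rewrite /flat ltNge (ltW x0).
  apply: (@near_eq_is_derive _ _ _ (cst 0)).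
  near=> y; rewrite /flat ltNge ltW//; near: y; exact: lt_nbhsl.
- have xn : x != 0 by rewrite gt_eqF.
  have dV : is_derive x 1 (fun t : R => t^-1) (- x ^- 2).
    apply: DeriveDef; first by apply: derivableV => //; exact: derivable_id.
    by rewrite deriveV// ?derive_id /GRing.scale/= ?mulr1//; exact: derivable_id.
  have d1 : is_derive x 1 (fun t => p.[t^-1]) (p^`().[x^-1] * (- x ^- 2)).
    exact: (@is_derive1_comp _ (horner p) (fun t => t^-1) x _ _ (is_derive_poly p x^-1) dV).
  have d2 : is_derive x 1 (fun t => expR (- t^-1)) (expR (- x^-1) * (- (- x ^- 2))).
    exact: (@is_derive1_comp _ expR (fun t => - t^-1) x _ _ (is_derive_expR _) (is_deriveN dV)).
  have d3 := @is_deriveM R R (fun t : R => p.[t^-1]) (fun t : R => expR (- t^-1)) _ _ _ _ d1 d2.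
  have -> : flat ('X^2 * (p - p^`())) x = p.[x^-1] *: (expR (- x^-1) * (- (- x ^- 2))) +
      expR (- x^-1) *: (p^`().[x^-1] * (- x ^- 2)).
    rewrite /flat x0 !hornerE exprVn /GRing.scale/=; ring.
  apply: (near_eq_is_derive _ d3).
  by near=> y; rewrite /flat ifT//; near: y; exact: lt_nbhsr.
- have -> : flat ('X^2 * (p - p^`())) 0 = 0 by rewrite /flat ltxx.
  (* The difference quotient at 0 is [flat ('X * p)] itself, so the linear bound for ['X * p] makes
     it tend to 0. *)
  have [K Kp] := flat_bound ('X * p).
  have K0 : 0 <= K by have := Kp 1 ltr01 (lexx _); rewrite mulr1; apply: le_trans.
  have lim0 : (fun h => h^-1 *: (flat p (h *: 1 + 0) - flat p 0)) @ 0^' --> (0 : R).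
    apply/cvgr0Pnorm_le => e e0; near=> h.
    have hn : h != 0 by near: h; exact: nbhs_dnbhs_neq.
    have h1 : `|h| <= 1 by near: h; apply: dnbhs0_le.
    have he : `|h| <= e / (K + 1).
      by near: h; apply: dnbhs0_le; rewrite divr_gt0// ltr_wpDl.
    have -> : h^-1 *: (flat p (h *: 1 + 0) - flat p 0) = flat ('X * p) h.
      rewrite /flat ltxx subr0 addr0 /GRing.scale/= mulr1.
      by case: ifP => _; [rewrite hornerM hornerX mulrA|rewrite mulr0].
    have [h0|h0] := ltP 0 h; last by rewrite /flat ltNge h0/= normr0 ltW.
    move: h1 he; rewrite (gtr0_norm h0) => h1 he.
    apply: le_trans (Kp _ h0 h1) _.
    rewrite ler_pdivlMr ?ltr_wpDl// in he; apply: le_trans he.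
    by rewrite mulrC ler_pM2l// lerDl.
  apply: DeriveDef; first by apply/cvg_ex; exists 0.
  exact: cvg_lim lim0.
Unshelve. all: end_near. Qed.

Lemma derivable_upto_flat k p : derivable_upto k (flat p).
Proof.
elim: k p => // k IH p; exact: derivable_upto_eq (is_derive_flat p) _.
Qed.

Let e := flat 1.

Let e_gt0 t : 0 < t -> 0 < e t.
Proof. by move=> t0; rewrite /e /flat t0 hornerC mul1r expR_gt0. Qed.

Let e_ge0 t : 0 <= e t.
Proof. by have [t0|t0] := ltP 0 t; [exact/ltW/e_gt0|rewrite /e /flat ltNge t0]. Qed.

Let e_le s t : s <= t -> e s <= e t.
Proof.
move=> st; have [s0|s0] := ltP 0 s; last by rewrite {1}/e /flat ltNge s0/= e_ge0.
have t0 := lt_le_trans s0 st.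
rewrite /e /flat s0 t0 !hornerC !mul1r ler_expR lerN2 lef_pV2//.
Qed.

(** The usual quotient of flat exponentials. One of [t] and [1 - t] is positive, so the denominator
    never vanishes. *)
Definition smooth_step (t : R) := e t / (e t + e (1 - t)).

Let den_gt0 t : 0 < e t + e (1 - t).
Proof.
have [t0|t0] := ltP 0 t; first by rewrite ltr_pwDl ?e_gt0.
by rewrite ltr_wpDl// e_gt0// subr_gt0 (le_lt_trans t0).
Qed.

Lemma smooth1_step : smooth1 smooth_step.
Proof.
apply/smooth1P => k; apply: derivable_uptoM; first exact: derivable_upto_flat.
apply: derivable_uptoV; first by move=> x; rewrite gt_eqF.
apply: derivable_uptoD; first exact: derivable_upto_flat.
have -> : (fun t => e (1 - t)) = (fun t => e (-1 * t + 1)).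
  by apply/funext => t; rewrite mulN1r addrC.
by apply: derivable_upto_affine; exact: derivable_upto_flat.
Qed.

Lemma smooth_step_le s t : s <= t -> smooth_step s <= smooth_step t.
Proof.
move=> st; rewrite /smooth_step ler_pdivrMr// mulrAC ler_pdivlMr//.
rewrite !mulrDr mulrC lerD2l ler_pM ?e_le//.
by rewrite lerD2l lerN2.
Qed.

Lemma smooth_step_ge0 t : 0 <= smooth_step t.
Proof. by rewrite divr_ge0// ltW. Qed.

Lemma smooth_step_le1 t : smooth_step t <= 1.
Proof. by rewrite ler_pdivrMr// mul1r lerDl. Qed.

Lemma smooth_step0 t : t <= 0 -> smooth_step t = 0.
Proof. by move=> t0; rewrite /smooth_step {1}/e /flat ltNge t0/= mul0r. Qed.

Lemma smooth_step1 t : 1 <= t -> smooth_step t = 1.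
Proof.
move=> t1; rewrite /smooth_step {3}/e /flat ltNge subr_le0 t1/= addr0 divff//.
by rewrite gt_eqF// e_gt0// (lt_le_trans ltr01).
Qed.

Lemma eq_open_deriven f g (U : set R) k : open U -> (forall x, U x -> f x = g x) ->
  forall x, U x -> (derive1n k f) x = (derive1n k g) x.
Proof.
move=> oU fg; elim: k => [|k IH] x Ux; first exact: fg.
rewrite !derive1nS !derive1E; apply: near_eq_derive.
by apply: filterS (open_nbhs_nbhs (conj oU Ux)) => y; exact: IH.
Qed.

Lemma deriven_cst k (c x : R) : (0 < k)%N -> (derive1n k (cst c)) x = 0.
Proof.
case: k => // k _; rewrite derive1Sn.
have -> : (derive1 (cst c)) = cst (0 : R) by apply: is_derive_derive1 => y; exact: is_derive_cst.
elim: k x => // k IH x; rewrite derive1Sn.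
have -> : (derive1 (cst (0 : R))) = cst 0 by apply: is_derive_derive1 => y; exact: is_derive_cst.
exact: IH.
Qed.

Lemma smooth1_continuous f k : smooth1 f -> continuous ((derive1n k f)).
Proof. by move=> sf x; apply/differentiable_continuous/derivable1_diffP. Qed.

Lemma partition_of_unity : exists beta : R -> R,
  [/\ smooth1 beta, forall x, 0 <= beta x,
      forall k x, 1 < `|x| -> (derive1n k beta) x = 0,
      forall (N : nat) x, \sum_(j < N.*2.+1) beta (x - (j%:R - N%:R)) <= 1 &
      forall (N : nat) x, `|x| <= N%:R ->
        \sum_(j < N.*2.+1) beta (x - (j%:R - N%:R)) = 1].
Proof.
(* Integer translates of this difference telescope: [2N + 1] of them sum to [smooth_step (x + N + 1)
   - smooth_step (x - N)], which is 1 for [|x| <= N]. *)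
pose beta (x : R) := smooth_step (x + 1) - smooth_step x.
have sum_beta (N : nat) x : \sum_(j < N.*2.+1) beta (x - (j%:R - N%:R)) =
    smooth_step (x + N%:R + 1) - smooth_step (x - N%:R).
  pose F (j : nat) := - smooth_step (x + N%:R - j%:R + 1).
  rewrite (eq_bigr (fun j : 'I_ _ => F j.+1 - F j)); last first.
    move=> j _; rewrite /beta /F opprK addrC -natr1.
    by congr (- smooth_step _ + smooth_step _); lra.
  rewrite -(big_mkord xpredT (fun j => F j.+1 - F j)) telescope_sumr//.
  rewrite /F opprK addrC subr0; congr (_ - smooth_step _).
  by rewrite -natr1 -addnn natrD; lra.
exists beta; split.
- apply/smooth1P => k.
  have -> : beta = (fun x => smooth_step (1 * x + 1)) \+ (cst (-1) \* smooth_step).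
    by apply/funext => x; rewrite /beta /= mul1r mulN1r.
  have /smooth1P/(_ k) st := smooth1_step.
  apply: derivable_uptoD; first exact: derivable_upto_affine.
  by apply: derivable_uptoM => //; exact: derivable_upto_cst.
- by move=> x; rewrite subr_ge0 smooth_step_le// lerDl.
- move=> k x x1.
  have : forall y, 1 < `|y| -> beta y = cst 0 y.
    move=> y; rewrite ltr_normr /beta => /orP[y1|y1] /=.
      by rewrite !smooth_step1 ?subrr//; lra.
    by rewrite !smooth_step0 ?subrr//; lra.
  have oU : open [set y : R | 1 < `|y|].
    by apply: (@open_comp _ _ (fun y : R => `|y|) [set z | 1 < z]) => //; move=> y _; exact: norm_continuous.
  move=> /(eq_open_deriven k oU) ->//.
  by case: k => [//|k]; rewrite deriven_cst.
- by move=> N x; rewrite sum_beta lerBlDr (le_trans (smooth_step_le1 _))// lerDl smooth_step_ge0.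
- move=> N x; rewrite ler_norml => /andP[Nx xN].
  by rewrite sum_beta smooth_step1 ?smooth_step0 ?subr0//; lra.
Qed.

Lemma smooth1_compact_bounded f k : smooth1 f -> (forall x, 1 < `|x| -> (derive1n k f) x = 0) ->
  exists M, forall x, `|(derive1n k f) x| <= M.
Proof.
move=> sf f0.
have cf : {within `[(-1 : R), 1], continuous (fun x => `|(derive1n k f) x|)}.
  apply: continuous_subspaceT => x; apply: continuous_comp; last exact: norm_continuous.
  exact: smooth1_continuous.
have N11 : (-1 : R) <= 1 by lra.
have [c _ cM] := EVT_max N11 cf.
exists `|(derive1n k f) c| => x; have [x1|x1] := leP `|x| 1; last by rewrite f0// normr0.
by apply: cM; rewrite in_itv/= -ler_norml.
Qed.

End smooth_line.

(** * Iterated partial derivatives, Leibniz bounds and tensor products *)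

Section smooth_space.
Context {R : realType} {n : nat}.
Implicit Types (phi psi : 'rV[R]_n -> R) (s : seq 'I_n) (c : 'rV[R]_n -> R).

Let e_ (i : 'I_n) : 'rV[R]_n := delta_mx ord0 i.

Definition pderiv s phi := foldr partial phi s.

Lemma pderiv_rcons s i phi : pderiv (rcons s i) phi = pderiv s (partial i phi).
Proof. by rewrite /pderiv foldr_rcons. Qed.

Lemma smooth_partial phi i : smooth phi -> smooth (partial i phi).
Proof. by move=> sphi s; have := sphi (rcons s i); rewrite foldr_rcons. Qed.

Lemma smooth_pderiv phi s : smooth phi -> smooth (pderiv s phi).
Proof.
by move=> sphi s'; have := sphi (s' ++ s); rewrite foldr_cat.
Qed.

Lemma smooth_derivable phi i x : smooth phi -> derivable phi x (e_ i).
Proof. by move=> sphi; apply: (sphi [::]).2. Qed.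

Lemma smooth_continuous phi : smooth phi -> continuous phi.
Proof. by move=> sphi; apply: (sphi [::]).1. Qed.

(** As with [derivable_upto], the induction replaces a function by its partial derivative. The
    innermost derivative is the last element of the list, whence the case analyses on [rcons]. *)
Definition smooth_upto k phi := forall s, (size s <= k)%N ->
  continuous (pderiv s phi) /\ forall i x, derivable (pderiv s phi) x (e_ i).

Lemma smooth_upto0 phi : continuous phi -> (forall i x, derivable phi x (e_ i)) ->
  smooth_upto 0 phi.
Proof. by move=> ? ? [|]. Qed.

Lemma smooth_uptoS k phi : continuous phi -> (forall i x, derivable phi x (e_ i)) ->
  (forall i, smooth_upto k (partial i phi)) -> smooth_upto k.+1 phi.
Proof.
move=> cphi dphi sphi s; case/lastP: s => [|s i]; first by [].
by rewrite size_rcons ltnS pderiv_rcons => /sphi.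
Qed.

Lemma smooth_uptoP phi : smooth phi <-> forall k, smooth_upto k phi.
Proof. by split=> [sphi k s _|sphi s]; [exact: sphi|exact: (sphi (size s))]. Qed.

Lemma smooth_upto_partial k i phi : smooth_upto k.+1 phi -> smooth_upto k (partial i phi).
Proof. by move=> sphi s sk; rewrite -pderiv_rcons; apply: sphi; rewrite size_rcons. Qed.

Lemma smooth_uptoW k phi : smooth_upto k.+1 phi -> smooth_upto k phi.
Proof. by move=> sphi s sk; apply: sphi; exact: leqW. Qed.

Lemma partialD i phi psi : (forall x, derivable phi x (e_ i)) ->
  (forall x, derivable psi x (e_ i)) ->
  partial i (phi \+ psi) = partial i phi \+ partial i psi.
Proof. by move=> dphi dpsi; apply/funext => x; rewrite /partial /= deriveD. Qed.

Lemma partialM i phi psi : (forall x, derivable phi x (e_ i)) ->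
  (forall x, derivable psi x (e_ i)) ->
  partial i (phi \* psi) = (phi \* partial i psi) \+ (psi \* partial i phi).
Proof. by move=> dphi dpsi; apply/funext => x; rewrite /partial /= deriveM. Qed.

Lemma partialN i phi : (forall x, derivable phi x (e_ i)) ->
  partial i (\- phi) = \- partial i phi.
Proof. by move=> dphi; apply/funext => x; rewrite /partial /= deriveN. Qed.

Lemma smooth_uptoD k phi psi : smooth_upto k phi -> smooth_upto k psi ->
  smooth_upto k (phi \+ psi).
Proof.
elim: k phi psi => [|k IH] phi psi sphi spsi.
all: have [cphi dphi] : continuous phi /\ forall i x, derivable phi x (e_ i) := sphi [::] isT.
all: have [cpsi dpsi] : continuous psi /\ forall i x, derivable psi x (e_ i) := spsi [::] isT.
  apply: smooth_upto0; first by move=> x; exact: (continuousD (cphi x) (cpsi x)).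
  by move=> i x; exact: derivableD.
apply: smooth_uptoS; first by move=> x; exact: (continuousD (cphi x) (cpsi x)).
  by move=> i x; exact: derivableD.
move=> i; rewrite partialD//.
by apply: IH; exact: smooth_upto_partial.
Qed.

Lemma smooth_uptoM k phi psi : smooth_upto k phi -> smooth_upto k psi ->
  smooth_upto k (phi \* psi).
Proof.
elim: k phi psi => [|k IH] phi psi sphi spsi.
all: have [cphi dphi] : continuous phi /\ forall i x, derivable phi x (e_ i) := sphi [::] isT.
all: have [cpsi dpsi] : continuous psi /\ forall i x, derivable psi x (e_ i) := spsi [::] isT.
  apply: smooth_upto0; first by move=> x; exact: (continuousM (cphi x) (cpsi x)).
  by move=> i x; exact: derivableM.
apply: smooth_uptoS; first by move=> x; exact: (continuousM (cphi x) (cpsi x)).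
  by move=> i x; exact: derivableM.
move=> i; rewrite partialM//.
apply: smooth_uptoD; apply: IH; do ?[exact: smooth_upto_partial|exact: smooth_uptoW].
Qed.

Lemma smoothD phi psi : smooth phi -> smooth psi -> smooth (phi \+ psi).
Proof.
by move=> /smooth_uptoP sphi /smooth_uptoP spsi; apply/smooth_uptoP => k; exact: smooth_uptoD.
Qed.

Lemma smoothM phi psi : smooth phi -> smooth psi -> smooth (phi \* psi).
Proof.
by move=> /smooth_uptoP sphi /smooth_uptoP spsi; apply/smooth_uptoP => k; exact: smooth_uptoM.
Qed.

Lemma smooth_cst (a : R) : smooth (cst a : 'rV[R]_n -> R).
Proof.
apply/smooth_uptoP => k; elim: k a => [|k IH] a.
  by apply: smooth_upto0 => [x|i x]; [exact: cst_continuous|exact: derivable_cst].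
apply: smooth_uptoS => [x|i x|i]; [exact: cst_continuous|exact: derivable_cst|].
have -> : partial i (cst a) = cst 0 by apply/funext => x; exact: derive_cst.
exact: IH.
Qed.

Lemma smoothN phi : smooth phi -> smooth (\- phi).
Proof.
move=> sphi; have -> : \- phi = cst (-1) \* phi.
  by apply/funext => x /=; rewrite mulN1r.
by apply: smoothM => //; exact: smooth_cst.
Qed.

Lemma pderiv_cst s (a : R) : s != [::] -> pderiv s (cst a) = cst 0.
Proof.
elim: s => // i s IH _ /=; have [->|/IH ->] := eqVneq s [::].
  by apply/funext => x; exact: derive_cst.
by apply/funext => x; exact: derive_cst.
Qed.

Lemma pderivD s phi psi : smooth phi -> smooth psi ->
  pderiv s (phi \+ psi) = pderiv s phi \+ pderiv s psi.
Proof.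
move=> sphi spsi; elim: s => //= i s ->; rewrite partialD// => x.
- exact: (sphi s).2.
- exact: (spsi s).2.
Qed.

Lemma pderivN s phi : smooth phi -> pderiv s (\- phi) = \- pderiv s phi.
Proof.
move=> sphi; elim: s => //= i s ->; rewrite partialN// => x.
exact: (sphi s).2.
Qed.

Lemma smooth_sum (I : Type) (r : seq I) (P : pred I) (F : I -> 'rV[R]_n -> R) :
  (forall i, smooth (F i)) -> smooth (fun x => \sum_(i <- r | P i) F i x).
Proof.
move=> sF; elim: r => [|a r IH].
  have -> : (fun x => \sum_(i <- [::] | P i) F i x) = cst 0.
    by apply/funext => x; rewrite big_nil.
  exact: smooth_cst.
have [Pa|Pa] := boolP (P a); last first.
  have -> // : (fun x => \sum_(i <- a :: r | P i) F i x) = (fun x => \sum_(i <- r | P i) F i x).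
  by apply/funext => x; rewrite big_cons (negbTE Pa).
have -> : (fun x => \sum_(i <- a :: r | P i) F i x) = F a \+ (fun x => \sum_(i <- r | P i) F i x).
  by apply/funext => x; rewrite big_cons Pa.
exact: smoothD.
Qed.

Lemma pderiv_sum s (I : Type) (r : seq I) (P : pred I) (F : I -> 'rV[R]_n -> R) :
  (forall i, smooth (F i)) ->
  pderiv s (fun x => \sum_(i <- r | P i) F i x) =
  fun x => \sum_(i <- r | P i) pderiv s (F i) x.
Proof.
move=> sF; elim: r => [|a r IH].
  have -> : (fun x => \sum_(i <- [::] | P i) F i x) = cst 0.
    by apply/funext => x; rewrite big_nil.
  have -> : (fun x => \sum_(i <- [::] | P i) pderiv s (F i) x) = cst 0.
    by apply/funext => x; rewrite big_nil.
  by case: s => // i s; rewrite pderiv_cst.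
have [Pa|Pa] := boolP (P a); last first.
  have -> : (fun x => \sum_(i <- a :: r | P i) F i x) = (fun x => \sum_(i <- r | P i) F i x).
    by apply/funext => x; rewrite big_cons (negbTE Pa).
  by rewrite IH; apply/funext => x; rewrite big_cons (negbTE Pa).
have -> : (fun x => \sum_(i <- a :: r | P i) F i x) = F a \+ (fun x => \sum_(i <- r | P i) F i x).
  by apply/funext => x; rewrite big_cons Pa.
rewrite pderivD//; last exact: smooth_sum.
by rewrite IH; apply/funext => x; rewrite big_cons Pa.
Qed.

Lemma eq_open_pderiv s phi psi (U : set 'rV[R]_n) : open U ->
  (forall x, U x -> phi x = psi x) -> forall x, U x -> pderiv s phi x = pderiv s psi x.
Proof.
move=> oU eq; elim: s => [|i s IH] x Ux /=; first exact: eq.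
apply: near_eq_derive.
by apply: filterS (open_nbhs_nbhs (conj oU Ux)) => y; exact: IH.
Qed.

(* [c] carries the localization: it vanishes where the derivatives should *)
Definition pderiv_bound k phi c (q : R) := forall s x, (size s <= k)%N ->
  `|pderiv s phi x| <= c x * q ^+ size s.

Lemma pderiv_boundS k phi c q : (forall x, `|phi x| <= c x) ->
  (forall i, pderiv_bound k (partial i phi) (fun x => c x * q) q) ->
  pderiv_bound k.+1 phi c q.
Proof.
move=> phic bphi s x; case/lastP: s => [|s i]; first by rewrite expr0 mulr1.
rewrite size_rcons ltnS pderiv_rcons => /bphi /le_trans; apply.
by rewrite exprS mulrA.
Qed.

Lemma pderiv_bound_partial k phi c q i : pderiv_bound k.+1 phi c q ->
  pderiv_bound k (partial i phi) (fun x => c x * q) q.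
Proof.
move=> bphi s x sk; rewrite -pderiv_rcons -mulrA -exprS.
by have := bphi (rcons s i) x; rewrite size_rcons; apply.
Qed.

Lemma pderiv_boundW k phi c q : pderiv_bound k.+1 phi c q -> pderiv_bound k phi c q.
Proof. by move=> bphi s x sk; apply: bphi; exact: leqW. Qed.

Lemma pderiv_bound0 k phi c q x : pderiv_bound k phi c q -> `|phi x| <= c x.
Proof. by move=> /(_ [::] x isT); rewrite expr0 mulr1. Qed.

(** Leibniz' rule doubles the number of terms with each derivative, hence [2 ^+ k]. Both factors are
    measured on the same scale [q], so the powers of [q] add up whichever factor is
    differentiated. *)
Lemma pderiv_boundM k phi psi c d q : 0 <= q -> smooth phi -> smooth psi ->
  pderiv_bound k phi c q -> pderiv_bound k psi d q ->
  pderiv_bound k (phi \* psi) (fun x => 2 ^+ k * (c x * d x)) q.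
Proof.
move=> q0; elim: k phi psi c d => [|k IH] phi psi c d sphi spsi bphi bpsi.
all: have b0 x : `|phi x * psi x| <= c x * d x by rewrite normrM ler_pM// (pderiv_bound0 _ bphi, pderiv_bound0 _ bpsi).
  by move=> s x; rewrite leqn0 size_eq0 => /eqP ->; rewrite /= !expr0 mul1r mulr1; exact: b0.
have cd0 x : 0 <= c x * d x by exact: le_trans (b0 x).
apply: pderiv_boundS.
  by move=> x; rewrite (le_trans (b0 x))// ler_peMl// exprn_ege1// ler1n.
move=> i; rewrite partialM; [|by move=> x; exact: smooth_derivable..].
have sphi' := smooth_partial i sphi; have spsi' := smooth_partial i spsi.
move=> s x sk; rewrite pderivD; do ?exact: smoothM.
apply: le_trans (ler_normD _ _) _.
have /(_ s x sk) := IH _ _ _ _ sphi spsi' (pderiv_boundW bphi) (pderiv_bound_partial i bpsi).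
have /(_ s x sk) := IH _ _ _ _ spsi sphi' (pderiv_boundW bpsi) (pderiv_bound_partial i bphi).
move=> h1 h2; apply: le_trans (lerD h2 h1) _.
rewrite -mulrDl exprS le_eqVlt; apply/orP; left; apply/eqP; ring.
Qed.

Section tensor.
Implicit Types (h : 'I_n -> R -> R).

Lemma continuous_prod (F : 'I_n -> 'rV[R]_n -> R) (r : seq 'I_n) :
  (forall i, continuous (F i)) -> continuous (fun x => \prod_(i <- r) F i x).
Proof.
move=> cF; elim: r => [|a r IH].
  have -> : (fun x => \prod_(i <- [::]) F i x) = cst 1.
    by apply/funext => x; rewrite big_nil.
  exact: cst_continuous.
have -> : (fun x => \prod_(i <- a :: r) F i x) = F a \* (fun x => \prod_(i <- r) F i x).
  by apply/funext => x; rewrite big_cons.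
by move=> x; exact: (continuousM (cF a x) (IH x)).
Qed.

Definition tensor h : 'rV[R]_n -> R := fun x => \prod_(i < n) h i (x ord0 i).

Let upd h i (hi : R -> R) (j : 'I_n) := if j == i then hi else h j.

Lemma tensor_line h i x (t : R) :
  tensor h (t *: e_ i + x) =
  h i (t + x ord0 i) * \prod_(j < n | j != i) h j (x ord0 j).
Proof.
rewrite /tensor (bigD1 i)//= !mxE !eqxx mulr1; congr (_ * _).
by apply: eq_bigr => j ji; rewrite !mxE (negbTE ji) mulr0 add0r.
Qed.

(** Along the [i]-th coordinate line every factor but [h i] is constant. *)
Lemma is_derive_tensor h i (x : 'rV[R]_n) (d : R) : is_derive (x ord0 i : R) 1 (h i) d ->
  is_derive x (e_ i) (tensor h) (d * \prod_(j < n | j != i) h j (x ord0 j)).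
Proof.
set P := \prod_(j < n | _) _ => dh.
have : (fun t : R => t^-1 *: ((tensor h \o shift x) (t *: e_ i) - tensor h x)) @ 0^'
    --> d * P.
  have : derivable (h i) (x ord0 i) 1 by case: dh.
  move=> /cvg_ex[l hl].
  have ld : l = d by case: dh => _ <-; apply/esym/cvg_lim.
  rewrite ld in hl.
  have hP := @cvgMr_tmp R R (dnbhs (0 : R)) (dnbhs_filter 0) _ _ P hl.
  apply: cvg_trans hP; apply: near_eq_cvg; near=> t => /=.
  rewrite tensor_line -[in tensor h x](add0r x) -[in tensor h _](scale0r (e_ i)).
  rewrite tensor_line add0r -mulrBl /GRing.scale/= mulr1 mulrA; congr (_ * _).
move=> dP; apply: DeriveDef; first by apply/cvg_ex; exists (d * P).
exact: cvg_lim dP.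
Unshelve. all: end_near. Qed.

Lemma partial_tensor h i : (forall t : R, derivable (h i) t 1) ->
  partial i (tensor h) = tensor (upd h i (derive1 (h i))).
Proof.
move=> dh; apply/funext => x.
have dhx : is_derive (x ord0 i) 1 (h i) (derive1 (h i) (x ord0 i)).
  by rewrite derive1E; apply: DeriveDef.
have [_ dt] := is_derive_tensor dhx; rewrite /partial dt /tensor [RHS](bigD1 i)//=.
rewrite /upd eqxx; congr (_ * _); apply: eq_bigr => j ji.
by rewrite (negbTE ji).
Qed.

Lemma pderiv_tensor h s : (forall i k (t : R), derivable (derive1n k (h i)) t 1) ->
  pderiv s (tensor h) = tensor (fun i => derive1n (count_mem i s) (h i)).
Proof.
move=> dh; elim: s => //= i s ->; rewrite partial_tensor//.
congr tensor; apply/funext => j; rewrite /upd eq_sym.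
by case: eqP => [->|]; rewrite ?add1n ?derive1nS.
Qed.

Lemma smooth_tensor h : (forall i k (t : R), derivable (derive1n k (h i)) t 1) ->
  smooth (tensor h).
Proof.
move=> dh s psi; rewrite /psi -/(pderiv s (tensor h)) pderiv_tensor//.
split; last first.
  move=> i x; apply: ex_derive.
  apply: is_derive_tensor; apply: DeriveDef; first exact: dh.
  reflexivity.
apply: continuous_prod => i x; apply: (@continuous_comp _ _ _ (fun x : 'rV[R]_n => x ord0 i)).
  exact: coord_continuous.
by apply/differentiable_continuous/derivable1_diffP; exact: (dh i (count_mem i s)).
Qed.

End tensor.

End smooth_space.

(** * Euclidean neighbourhoods of compact sets *)

Section euclidean_neighbourhoods.
Context {R : realType} {n : nat}.
Implicit Types (x y z : 'rV[R]_n) (W U : set 'rV[R]_n).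

Lemma edist_coord x y (i : 'I_n) : `|x ord0 i - y ord0 i| <= edist x y.
Proof.
rewrite -sqrtr_sqr ler_wsqrtr// (bigD1 i)//= lerDl.
by apply: sumr_ge0 => j _; exact: sqr_ge0.
Qed.

Lemma edist_le_sup x y d : 0 <= d ->
  (forall i, `|x ord0 i - y ord0 i| <= d) -> edist x y <= n%:R * d.
Proof.
move=> d0 xyd; rewrite -[leRHS]ger0_norm ?mulr_ge0// -sqrtr_sqr.
apply: ler_wsqrtr; apply: (@le_trans _ _ (\sum_(i < n) d ^+ 2)).
  by apply: ler_sum => i _; rewrite -[leLHS]real_normK ?num_real// lerXn2r// ?nnegrE.
rewrite sumr_const card_ord exprMn -[d ^+ 2 *+ n]mulr_natl ler_wpM2r ?sqr_ge0//.
by rewrite -natrX ler_nat -{1}[n]expn1; case: (n) => // k; rewrite leq_pexp2l.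
Qed.

Lemma edist_lt_sum x y r : 0 < r ->
  (edist x y < r) = (\sum_(i < n) (x ord0 i - y ord0 i) ^+ 2 < r ^+ 2).
Proof.
move=> r0; have s0 : 0 <= \sum_(i < n) (x ord0 i - y ord0 i) ^+ 2.
  by apply: sumr_ge0 => i _; exact: sqr_ge0.
rewrite /edist -[in RHS](sqr_sqrtr s0) ltr_pXn2r// ?nnegrE ?sqrtr_ge0//.
exact: ltW.
Qed.

Lemma edist_ge0 x y : 0 <= edist x y. Proof. exact: sqrtr_ge0. Qed.

Lemma edist_lt_triangle x y z a b :
  edist x y < a -> edist y z < b -> edist x z < a + b.
Proof.
move=> xya yzb.
have a0 : 0 < a := le_lt_trans (edist_ge0 _ _) xya.
have b0 : 0 < b := le_lt_trans (edist_ge0 _ _) yzb.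
move: xya yzb; rewrite !edist_lt_sum ?addr_gt0// => xya yzb.
(* convexity of the square: (s + t)^2 <= (a + b) (s^2 / a + t^2 / b) *)
apply: (@le_lt_trans _ _ ((a + b) *
    ((\sum_(i < n) (x ord0 i - y ord0 i) ^+ 2) / a +
     (\sum_(i < n) (y ord0 i - z ord0 i) ^+ 2) / b))).
  rewrite !mulr_suml -big_split/= mulr_sumr; apply: ler_sum => i _.
  rewrite -(subrKA (y ord0 i)).
  move: (x ord0 i - y ord0 i) (y ord0 i - z ord0 i) => s t.
  rewrite -subr_ge0 (_ : _ - _ = (b * s - a * t) ^+ 2 / (a * b)).
    by rewrite divr_ge0 ?sqr_ge0// mulr_ge0// ltW.
  by field; rewrite !gt_eqF.
rewrite expr2 ltr_pM2l ?addr_gt0// ltrD//.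
  by rewrite ltr_pdivrMr.
by rewrite ltr_pdivrMr.
Qed.

Lemma nbdP W r x : nbd W r x <-> exists2 y, W y & edist x y < r.
Proof.
split => [|[y Wy xy]].
  by move=> /ereal_inf_lt[_ [y Wy <-]]; rewrite lte_fin => xy; exists y.
by apply: (@le_lt_trans _ _ (edist x y)%:E) => //; apply: ereal_inf_lbound; exists y.
Qed.

Lemma nbd_le W r1 r2 : r1 <= r2 -> nbd W r1 `<=` nbd W r2.
Proof.
by move=> r12 x /nbdP[y Wy xy]; apply/nbdP; exists y => //; exact: lt_le_trans r12.
Qed.

Lemma edistxx x : edist x x = 0.
Proof.
by rewrite /edist big1 ?sqrtr0// => i _; rewrite subrr expr0n.
Qed.

Lemma sub_nbd W r : 0 < r -> W `<=` nbd W r.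
Proof. by move=> r0 x Wx; apply/nbdP; exists x => //; rewrite edistxx. Qed.

Lemma edistC x y : edist x y = edist y x.
Proof. by rewrite /edist; congr Num.sqrt; apply: eq_bigr => i _; rewrite -sqrrN opprB. Qed.

Lemma nbhs_edist x r : 0 < r -> \forall y \near x, edist x y < r.
Proof.
move=> r0; apply/nbhs_ballP; exists (r / n.+1%:R) => /=.
  by rewrite divr_gt0.
move=> y [e0 xy]; apply: (@le_lt_trans _ _ (n%:R * (r / n.+1%:R))).
  apply: edist_le_sup; first exact: ltW.
  by move=> i; exact: ltW (xy ord0 i).
by rewrite mulrCA -[ltRHS]mulr1 ltr_pM2l// ltr_pdivrMr// mul1r ltr_nat.
Qed.

Lemma nbd_open W r : open (nbd W r).
Proof.
rewrite openE => x /nbdP[y Wy xy].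
have r0 : 0 < r - edist x y by rewrite subr_gt0.
near=> z; apply/nbdP; exists y => //.
have xz : edist z x < (r - edist x y) / 2.
  by rewrite edistC; near: z; apply: nbhs_edist; rewrite divr_gt0.
have xy' : edist x y < edist x y + (r - edist x y) / 2 by rewrite ltrDl divr_gt0.
by apply: lt_le_trans (edist_lt_triangle xz xy') _; lra.
Unshelve. all: end_near. Qed.

Lemma closure_nbd W r1 r2 : r1 < r2 -> closure (nbd W r1) `<=` nbd W r2.
Proof.
move=> r12 x; have d0 : 0 < r2 - r1 by rewrite subr_gt0.
move=> /(_ _ (nbhs_edist x d0))[z [/nbdP[y Wy zy] xz]].
by apply/nbdP; exists y => //; rewrite -(subrK r1 r2); exact: edist_lt_triangle zy.
Qed.

Lemma compact_coord_bounded W : compact W ->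
  exists K : nat, forall x, W x -> forall i, `|x ord0 i| <= K%:R.
Proof.
move=> /compact_bounded[M [Mreal WM]].
exists (Num.truncn (M + 1)).+1 => x Wx i.
have : `|x| <= M + 1 by apply: WM => //; rewrite ltrDl.
move=> xM; have : `|x ord0 i| <= `|x|.
  rewrite [leRHS]/Num.norm/= mx_normrE.
  by apply: (le_bigmax _ (fun ij : 'I_1 * 'I_n => `|x ij.1 ij.2|) (ord0, i)).
move=> /le_trans/(_ xM)/le_trans; apply; apply/ltW/truncnS_gt.
Qed.

(** Each point of [W] has an admissible radius that also serves nearby points; the near-covering
    form of compactness yields a common one. *)
Lemma compact_nbd_sub W U : compact W -> open U -> W `<=` U ->
  exists2 r, 0 < r & nbd W r `<=` U.
Proof.
move=> cW oU WU.
have : \forall r \near (0 : R)^'+, W `<=` [set y | forall z, edist z y < r -> U z].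
  apply: (compact_near_coveringP W).1 => // x Wx.
  have /nbhs_ballP[e/= e0 xeU] := open_nbhs_nbhs (conj oU (WU _ Wx)).
  have e20 : 0 < e / 2 by rewrite divr_gt0.
  near=> y r => z zy.
  apply: xeU; split => // a i; rewrite (ord1 a) /ball/=.
  apply: le_lt_trans (edist_coord _ _ i) _.
  rewrite [e]splitr; apply: (@edist_lt_triangle _ y); first by near: y; exact: nbhs_edist.
  rewrite edistC; apply: (lt_le_trans zy) => /=.
  by near: r; exact: nbhs_right_le.
move=> near0; have : \forall r \near (0 : R)^'+, 0 < r /\ W `<=` [set y | forall z, edist z y < r -> U z].
  by near=> r; split; [near: r; exact: nbhs_right_gt|near: r].
move=> /filter_ex[r [r0 Wr]]; exists r => // x /nbdP[y Wy xy].
exact: Wr Wy _ xy.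
Unshelve. all: end_near. Qed.

Lemma nbd_bounded W r : compact W -> bounded_set (nbd W r).
Proof.
move=> /compact_coord_bounded[K WK].
exists (K%:R + `|r|); split; first exact: num_real.
move=> M KM x /nbdP[y Wy xy].
rewrite /= [`|x|]/Num.norm/= mx_normrE; apply/bigmax_leP; split.
  by apply: ltW; apply: le_lt_trans KM; rewrite addr_ge0.
move=> [a i] _ /=; rewrite (ord1 a) -[x ord0 i](subrK (y ord0 i)).
apply: (le_trans (ler_normD _ _)); rewrite addrC; apply: ltW; apply: le_lt_trans KM.
apply: lerD; first exact: WK.
by apply: le_trans (edist_coord x y i) _; apply: ltW; apply: lt_le_trans xy _; exact: ler_norm.
Qed.

End euclidean_neighbourhoods.

(** At most three integers lie within distance 1 of [tau]. Counted from the least index [k0] with a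
    nonzero term, these are among [k0], [k0 + 1] and [k0 + 2]. *)
Lemma sum_local_le (R : realType) (L : nat) (F : nat -> R) (B tau : R) :
  (forall k, F k <= B) -> 0 <= B -> (forall k, 1 < `|tau - k%:R| -> F k = 0) ->
  \sum_(k < L) F k <= 3 * B.
Proof.
move=> FB B0 F0.
have [/existsP ex|] := boolP [exists k : 'I_L, F k != 0]; last first.
  rewrite negb_exists => /forallP allF0; rewrite big1 ?mulr_ge0// => k _.
  by have := allF0 k; rewrite negbK => /eqP.
have exn : exists k, F k != 0 by case: ex => k; exists k.
case: (ex_minnP exn) => k0 Fk0 mink0.
have near k : F k != 0 -> `|tau - k%:R| <= 1.
  by move=> Fk; rewrite leNgt; apply: contra Fk => /F0 ->.
have ind a : \sum_(k < L) ((k : nat) == a)%:R <= (1 : R).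
  have -> : \sum_(k < L) ((k : nat) == a)%:R = ((a < L)%N)%:R :> R.
    elim: L {ex} => [|L IH]; first by rewrite big_ord0.
    by rewrite big_ord_recr/= IH -natrD ltnS; case: (ltngtP L a).
  by case: (a < L)%N.
apply: (@le_trans _ _ (\sum_(k < L) B * (((k : nat) == k0)%:R +
    ((k : nat) == k0.+1)%:R + ((k : nat) == k0.+2)%:R))); last first.
  rewrite -mulr_sumr mulrC ler_wpM2r// !big_split/=.
  by rewrite (_ : 3 = 1 + 1 + 1) ?lerD//; lra.
apply: ler_sum => k _; have [->|Fk] := eqVneq (F k) 0.
  by rewrite mulr_ge0// !addr_ge0.
have k0k := mink0 _ Fk.
have kk0 : (k <= k0.+2)%N.
  have := near _ Fk; have := near _ Fk0; rewrite !ler_norml => /andP[? ?] /andP[? ?].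
  by rewrite -(ler_nat R) -[k0.+2]addn2 natrD; lra.
apply: le_trans (FB k) _; rewrite -[leLHS]mulr1 ler_wpM2l//.
have : (k == k0 :> nat) || (k == k0.+1 :> nat) || (k == k0.+2 :> nat).
  move: k0k kk0; rewrite leq_eqVlt => /orP[/eqP ->|]; first by rewrite eqxx.
  rewrite leq_eqVlt => /orP[/eqP ->|k1]; first by rewrite eqxx !orbT.
  by move=> k2; rewrite [in X in _ || X]eqn_leq k1 k2 !orbT.
by case: eqP => _; case: eqP => _; case: eqP => _ //=; lra.
Qed.

(** * Cutoff functions with uniform derivative bounds *)

Section cutoff.
Context {R : realType} {n : nat}.

(** [chi] sums the bumps of a tensor partition of unity of mesh [(r2 - r1) / q] whose cubes meet
    [nbd S r1]. [C] depends only on [m] and [n]: at each point at most three bumps per coordinate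
    count, and each derivative costs one inverse mesh. This uniformity is what allows the layers to
    shrink later. *)
Lemma exists_cutoff (m : nat) : exists2 C : R, 0 < C &
  forall (S : set 'rV[R]_n) r1 r2, compact S -> r1 < r2 ->
  exists chi : 'rV[R]_n -> R,
  [/\ smooth chi, forall x, 0 <= chi x <= 1, forall x, nbd S r1 x -> chi x = 1,
      forall s x, ~ nbd S r2 x -> pderiv s chi x = 0 &
      forall s x, (size s <= m)%N ->
        `|pderiv s chi x| <= C * (r2 - r1)^-1 ^+ size s].
Proof.
have [beta [sbeta beta0 dbeta0 sumbeta_le1 sumbeta]] := @partition_of_unity R.
have [M Mbeta] : {M : nat -> R & forall k x, `|derive1n k beta x| <= M k}.
  apply: (@choice _ _ (fun k M => forall x, `|derive1n k beta x| <= M)) => k.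
  exact: smooth1_compact_bounded (dbeta0 k).
have M0 k : 0 <= M k by exact: le_trans (Mbeta k 0).
pose B := 1 + \sum_(k < m.+1) M k.
have B1 : 1 <= B by rewrite lerDl sumr_ge0.
have MB k x : (k <= m)%N -> `|derive1n k beta x| <= B.
  move=> km; apply: (le_trans (Mbeta k x)).
  rewrite /B (bigD1 (inord k))//= inordK// addrCA lerDl addr_ge0// sumr_ge0//.
(* Two points in the cube of one bump differ by at most [2 eps] in each coordinate, so their
   distance is at most [2 n eps]; with this [q] that is less than [r2 - r1]. *)
pose q : R := 2 * n.+1%:R.
have q1 : 1 <= q by rewrite /q -[leLHS]mulr1 ler_pM// ?ler1n// ler1n.
exists ((3 * B) ^+ n * q ^+ m).
  by rewrite mulr_gt0// exprn_gt0//; lra.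
move=> S r1 r2 cS r12.
have d0 : 0 < r2 - r1 by rewrite subr_gt0.
have q0 : 0 < q by lra.
pose eps := (r2 - r1) / q.
have eps0 : 0 < eps by rewrite divr_gt0.
have [K SK] := compact_coord_bounded cS.
have nbdK x i : nbd S r1 x -> `|x ord0 i| <= K%:R + `|r1|.
  move=> /nbdP[y Sy xy]; rewrite -[x ord0 i](subrK (y ord0 i)) addrC.
  apply: (le_trans (ler_normD _ _)); rewrite lerD ?SK//.
  apply: le_trans (edist_coord x y i) _; apply: ltW; apply: lt_le_trans xy _; exact: ler_norm.
(* Large enough for the grid of [2N + 1] nodes per coordinate to cover the bounded set
   [nbd S r1]. *)
pose N := (Num.truncn ((K%:R + `|r1|) / eps)).+1.
have nbdN x i : nbd S r1 x -> `|eps^-1 * x ord0 i| <= N%:R.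
  move=> /(nbdK _ i) xK; rewrite normrM gtr0_norm ?invr_gt0// mulrC ler_pdivrMr//.
  by rewrite (le_trans xK)// -ler_pdivrMr// ltW// truncnS_gt.
pose L := N.*2.+1.
pose h (j : {ffun 'I_n -> 'I_L}) i (t : R) := beta (eps^-1 * t + - ((j i)%:R - N%:R)).
have dh j i k : derive1n k (h j i) =
    (fun t => eps^-1 ^+ k * derive1n k beta (eps^-1 * t + - ((j i)%:R - N%:R))).
  exact: smooth1_affine_deriven.
have sh j i : smooth1 (h j i).
  by apply/smooth1P => k; apply: derivable_upto_affine; move/smooth1P: sbeta.
pose b j := tensor (h j).
have sb j : smooth (b j) by apply: smooth_tensor => i k t; exact: sh.
have pb s j x : pderiv s (b j) x = \prod_(i < n) (eps^-1 ^+ count_mem i s *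
    derive1n (count_mem i s) beta (eps^-1 * x ord0 i + - ((j i)%:R - N%:R))).
  rewrite /b pderiv_tensor; last by move=> i k t; exact: sh.
  by rewrite /tensor; apply: eq_bigr => i _; rewrite dh.
have pb0 s j x : pderiv s (b j) x != 0 ->
    forall i, `|eps^-1 * x ord0 i - ((j i)%:R - N%:R)| <= 1.
  move=> nz i; rewrite leNgt; apply: contra nz => /dbeta0 z.
  by rewrite pb (bigD1 i)//= z mulr0 mul0r.
pose J (j : {ffun 'I_n -> 'I_L}) := `[< exists2 y, nbd S r1 y &
  forall i, `|eps^-1 * y ord0 i - ((j i)%:R - N%:R)| <= 1 >].
pose chi x := \sum_(j | J j) b j x.
have pchi s x : pderiv s chi x = \sum_(j | J j) pderiv s (b j) x.
  by rewrite /chi pderiv_sum.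
have b0 j x : 0 <= b j x by apply: prodr_ge0 => i _; exact: beta0.
have sumb x : \sum_j b j x =
    \prod_(i < n) \sum_(k < L) beta (eps^-1 * x ord0 i - (k%:R - N%:R)).
  by rewrite bigA_distr_bigA.
have sum1 x : nbd S r1 x -> chi x = 1.
  (* A bump that is not selected vanishes on [nbd S r1], so there [chi] is the full partition of
     unity. *)
  move=> Sx; have -> : chi x = \sum_j b j x.
    rewrite /chi big_mkcond/=; apply: eq_bigr => j _; case: ifPn => // /asboolPn nJ.
    apply/esym/eqP; apply: contrapT => /negP nz; apply: nJ; exists x => //.
    exact: (pb0 [::]).
  by rewrite sumb big1// => i _; apply: sumbeta; exact: nbdN.
exists chi; split => //.
- exact: smooth_sum.
- move=> x; rewrite sumr_ge0//=.
  apply: (@le_trans _ _ (\sum_j b j x)).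
    by rewrite /chi big_mkcond/=; apply: ler_sum => j _; case: ifP.
  rewrite sumb -[leRHS](@big1_eq _ _ *%R _ (index_enum 'I_n) xpredT).
  apply: ler_prod => i _; rewrite sumbeta_le1 andbT; exact: sumr_ge0.
- move=> s x nx; rewrite pchi big1// => j /asboolP[y Sy yj].
  apply/eqP; apply: contrapT => /negP/pb0 xj; apply: nx.
  have xy : edist x y < r2 - r1.
    apply: (@le_lt_trans _ _ (n%:R * (2 * eps))).
      apply: edist_le_sup; first by rewrite mulr_ge0// ltW.
      move=> i; rewrite -ler_pdivrMr// mulrC -{1}(gtr0_norm (_ : 0 < eps^-1)) ?invr_gt0//.
      rewrite -normrM mulrBr; have := xj i; have := yj i; rewrite !ler_norml.
      by move=> /andP[? ?] /andP[? ?]; apply/andP; split; lra.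
    rewrite mulrCA mulrA -natrM /eps mulrA ltr_pdivrMr// mulrC ltr_pM2l//.
    by rewrite /q -natrM ltr_nat ltn_pmul2l.
  have /nbdP[z Sz yz] := Sy; apply/nbdP; exists z => //.
  by rewrite -(subrK r1 r2); exact: edist_lt_triangle yz.
- move=> s x sm; rewrite pchi.
  apply: (le_trans (ler_norm_sum _ _ _)).
  apply: (@le_trans _ _ (\sum_j `|pderiv s (b j) x|)).
    by rewrite big_mkcond/=; apply: ler_sum => j _; case: ifP.
  have cnt i : (count_mem i s <= m)%N by rewrite (leq_trans _ sm)// count_size.
  (* The sum over the grid of products is a product of one-dimensional sums, and each of these is at
     most [3 * B] by [sum_local_le]. *)
  have -> : \sum_j `|pderiv s (b j) x| = eps^-1 ^+ size s * \prod_(i < n) \sum_(k < L)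
      `|derive1n (count_mem i s) beta (eps^-1 * x ord0 i + - (k%:R - N%:R))|.
    rewrite bigA_distr_bigA mulr_sumr; apply: eq_bigr => j _.
    rewrite pb normr_prod (eq_bigr (fun i => eps^-1 ^+ count_mem i s *
      `|derive1n (count_mem i s) beta (eps^-1 * x ord0 i + - ((j i)%:R - N%:R))|)); last first.
      by move=> i _; rewrite normrM ger0_norm// exprn_ge0// invr_ge0 ltW.
    rewrite big_split/=; congr (_ * _).
    rewrite prodrXr; congr (_ ^+ _).
    elim: s {sm cnt} => [|i0 s IH]; first by rewrite big1.
    rewrite /= big_split/= IH -[RHS]add1n; congr (_ + _)%N.
    by rewrite (bigD1 i0)//= eqxx big1 // => i; rewrite eq_sym => /negbTE ->.
  have -> : eps^-1 ^+ size s = q ^+ size s * (r2 - r1)^-1 ^+ size s.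
    by rewrite -exprMn /eps invf_div.
  rewrite mulrC mulrA ler_wpM2r ?exprn_ge0 ?invr_ge0 ?(ltW d0)//.
  rewrite ler_pM ?prodr_ge0// ?exprn_ge0 ?(ltW q0)//.
  + by move=> i _; rewrite sumr_ge0.
  + rewrite -[in leRHS](card_ord n) -prodr_const; apply: ler_prod => i _.
    rewrite sumr_ge0//=.
    apply: (@sum_local_le _ _
      (fun k => `|derive1n (count_mem i s) beta (eps^-1 * x ord0 i + - (k%:R - N%:R))|) _
      (eps^-1 * x ord0 i + N%:R)).
    * by move=> k; exact: MB.
    * by lra.
    * move=> k k1; apply/normr0P; rewrite dbeta0//.
      by apply: lt_le_trans k1 _; rewrite opprB addrA.
  + exact: ler_weXn2l.
Qed.

End cutoff.

(** * The nonlinearity g *)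

Section halfline_calculus.
Context {R : realType}.
Implicit Types f : R -> R.

(** Near a positive point the half-line is a full neighbourhood, so the derivative within it is the
    ordinary one. *)
Lemma hderivable_is_derive f (x : R) : 0 < x ->
  cvg (diff_quot f x @ halfline_dnbhs x) -> is_derive x 1 f (hderive f x).
Proof.
move=> x0 cf.
have lim_f : (fun h => h^-1 *: ((f \o shift x) (h *: 1) - f x)) @ 0^' --> hderive f x.
  apply/cvgrPdist_le => e e0.
  have /cvgrPdist_le/(_ e e0) := cf.
  rewrite /halfline_dnbhs => /nbhs_ballP[d/= d0 dP].
  have [d' d'0 d'd] : exists2 d', 0 < d' & d' <= Num.min d x.
    by exists (Num.min d x) => //; rewrite lt_min d0.
  near=> h.
  have hn : h != 0 by near: h; exact: nbhs_dnbhs_neq.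
  have hd : `|h| < d' by near: h; apply: dnbhs0_lt.
  have /andP[hd1 hx] : (`|h| < d) && (`|h| < x) by rewrite -lt_min (lt_le_trans hd).
  have := dP (h + x).
  rewrite /ball/= opprD addrCA subrr addr0 normrN => /(_ hd1).
  have -> : h + x != x by rewrite -subr_eq0 addrK.
  have -> : (h + x \in `[0, +oo[) = true.
    by rewrite in_itv/= andbT; move: hx; rewrite ltr_norml => /andP[? _]; lra.
  by rewrite /diff_quot addrK /= /GRing.scale/= mulr1 mulrC => /(_ isT isT).
apply: DeriveDef; first by apply/cvg_ex; exists (hderive f x).
exact: cvg_lim lim_f.
Unshelve. all: end_near. Qed.

(** Near [x] the difference quotient is bounded by [|L| + 1], which gives a Lipschitz bound at [x],
    the endpoint 0 included. *)
Lemma hderivable_continuous_at f (x : R) : 0 <= x ->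
  cvg (diff_quot f x @ halfline_dnbhs x) ->
  forall e, 0 < e -> exists2 d, 0 < d & forall y, 0 <= y -> `|y - x| < d -> `|f y - f x| <= e.
Proof.
move=> x0 cf e e0; set L := hderive f x.
have /cvgrPdist_le/(_ 1 ltr01) := cf.
rewrite /halfline_dnbhs => /nbhs_ballP[d/= d0 dP].
have L0 : 0 < `|L| + 1 by rewrite ltr_wpDl.
exists (Num.min d (e / (`|L| + 1))); first by rewrite lt_min d0 divr_gt0.
move=> y y0; rewrite lt_min => /andP[yd ye].
have [->|yx] := eqVneq y x; first by rewrite subrr normr0 ltW.
have := dP y; rewrite /ball/= distrC => /(_ yd yx).
rewrite in_itv/= andbT => /(_ y0) q1.
have -> : f y - f x = diff_quot f x y * (y - x) by rewrite /diff_quot divfK// subr_eq0.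
have : `|diff_quot f x y| <= `|L| + 1.
  rewrite -[X in `|X|](subrK L) (le_trans (ler_normD _ _))// addrC lerD2l distrC.
  exact: q1.
move=> q2; rewrite normrM; apply: (@le_trans _ _ ((`|L| + 1) * (e / (`|L| + 1)))).
  by rewrite ler_pM// ltW.
by rewrite mulrCA divff ?mulr1// gt_eqF.
Qed.

Lemma hderivable_continuous f : hderivable f -> {within `[0, +oo[, continuous f}.
Proof.
move=> hf; apply/subspace_continuousP => x; rewrite /= in_itv/= andbT => x0.
apply/cvgrPdist_le => e e0.
have [d d0 dP] := hderivable_continuous_at x0 (hf x x0) e0.
rewrite near_withinE; near=> y; rewrite /= in_itv/= andbT => y0.
rewrite distrC; apply: dP; first by [].
by near: y; apply/nbhs_ballP; exists d => //= y; rewrite /ball/= distrC.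
Unshelve. all: end_near. Qed.

Lemma halfline_MVT f (x y : R) : hderivable f -> 0 <= x -> x < y ->
  exists2 c, x < c < y & f y - f x = hderive f c * (y - x).
Proof.
move=> hf x0 xy.
have [||c cxy fE] := @MVT R f (hderive f) x y xy; last by exists c => //; move: cxy; rewrite in_itv.
  move=> z; rewrite in_itv/= => /andP[xz _]; have z0 := le_lt_trans x0 xz.
  by apply: hderivable_is_derive => //; exact/hf/ltW.
apply: continuous_subspaceW (hderivable_continuous hf) => z /=.
by rewrite !in_itv/= andbT => /andP[xz _]; exact: le_trans xz.
Qed.

End halfline_calculus.

Definition G_real {R : realType} (m : nat) (g : R -> R) (t : R) : R := fine (G m g t).

(** * Convexity of [g], the function [G], the Legendre transform and the blow-up bound *)

Section convex_function.
Context {R : realType}.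
Variable g : R -> R.
Hypothesis hg : C2_halfline g.
Hypothesis g0 : g 0 = 0.
Hypothesis g_pos : forall z : R, 0 < z ->
  [/\ 0 < g z, 0 < hderive g z & 0 < hderive (hderive g) z].

Local Notation P := (hderive g).

Lemma hderive_lt x y : 0 <= x -> x < y -> P x < P y.
Proof.
move=> x0 xy; have [_ h2 _] := hg.
have [c /andP[xc _] e] := halfline_MVT h2 x0 xy.
rewrite -subr_gt0 e mulr_gt0 ?subr_gt0//.
by have [] := g_pos (le_lt_trans x0 xc).
Qed.

Lemma hderive_le x y : 0 <= x -> x <= y -> P x <= P y.
Proof. by move=> x0; rewrite le_eqVlt => /orP[/eqP->//|/(hderive_lt x0)/ltW]. Qed.

Lemma convex_support x y : 0 <= x -> 0 <= y -> g x + P x * (y - x) <= g y.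
Proof.
move=> x0 y0; have [h1 _ _] := hg; rewrite -lerBrDl.
have [xy|yx|->] := ltgtP x y; last by rewrite !subrr mulr0.
- have [c /andP[xc _] ->] := halfline_MVT h1 x0 xy.
  by rewrite ler_wpM2r ?subr_ge0 ?(ltW xy)// hderive_le// ltW.
- have [c /andP[yc cx] e] := halfline_MVT h1 y0 yx.
  rewrite -[leRHS]opprB e -opprB mulrN lerN2 ler_wpM2r ?subr_ge0 ?(ltW yx)//.
  by rewrite hderive_le ?(ltW cx)// (le_trans y0)// ltW.
Qed.

Lemma convex_ge0 x : 0 <= x -> 0 <= g x.
Proof. by rewrite le_eqVlt => /orP[/eqP<-|/g_pos[/ltW]//]; rewrite g0. Qed.

Lemma convex_lt x y : 0 <= x -> x < y -> g x < g y.
Proof.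
move=> x0 xy; have [h1 _ _] := hg; have [c /andP[xc _] e] := halfline_MVT h1 x0 xy.
rewrite -subr_gt0 e mulr_gt0 ?subr_gt0//.
by have [] := g_pos (le_lt_trans x0 xc).
Qed.

Lemma convex_le x y : 0 <= x -> x <= y -> g x <= g y.
Proof. by move=> x0; rewrite le_eqVlt => /orP[/eqP->//|/(convex_lt x0)/ltW]. Qed.

Lemma convex_measurable : measurable_fun (`[0, +oo[%classic : set R) g.
Proof.
have [h1 _ _] := hg.
by apply: subspace_continuous_measurable_fun => //; exact: hderivable_continuous.
Qed.

Variable m : nat.
Hypothesis m_gt0 : (0 < m)%N.
Hypothesis G1 : (G m g 1 < +oo)%E.

Let I (z : R) := g z `^ (- (1 / m%:R)) * z `^ (1 / m%:R - 1).

Let I_ge0 z : 0 <= I z.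
Proof. by rewrite mulr_ge0 ?powR_ge0. Qed.

Let m1 : 1 / m%:R <= (1 : R).
Proof. by rewrite ler_pdivrMr ?ltr0n// mul1r ler1n. Qed.

Let m0 : 0 < 1 / m%:R :> R.
Proof. by rewrite divr_gt0// ltr0n. Qed.

(** Both factors are nonincreasing: [g] increases, and the exponent [1 / m - 1] is at most 0. *)
Let I_le s t : 0 < s -> s <= t -> I t <= I s.
Proof.
move=> s0 st; have t0 := lt_le_trans s0 st.
have gs0 : 0 < g s by have [] := g_pos s0.
have gt0 : 0 < g t by have [] := g_pos t0.
rewrite ler_pM ?powR_ge0//.
  rewrite !powRN lef_pV2 ?posrE ?powR_gt0//; apply: ge0_ler_powR; rewrite ?nnegrE ?(ltW gs0) ?(ltW gt0) ?(ltW m0)//.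
  exact: convex_le (ltW s0) st.
have E z : z `^ (1 / m%:R - 1) = (z `^ (1 - 1 / m%:R))^-1 by rewrite -powRN opprB.
rewrite !E lef_pV2 ?posrE ?powR_gt0//.
by apply: ge0_ler_powR; rewrite ?nnegrE ?(ltW s0) ?(ltW t0) ?subr_ge0.
Qed.

Let I_gt0 t : 0 < t -> 0 < I t.
Proof. by move=> t0; have [? _ _] := g_pos t0; rewrite mulr_gt0 ?powR_gt0. Qed.

Let mI (t : R) : 0 < t -> measurable_fun (`[t, +oo[%classic : set R) I.
Proof.
move=> t0; apply: measurable_funM.
  apply: (@measurableT_comp _ _ _ _ _ _ (@powR R ^~ (- (1 / m%:R)))).
    exact: measurable_powR.
  apply: measurable_funS convex_measurable => // z /=.
  by rewrite !in_itv/= !andbT; apply: le_trans; exact: ltW.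
by apply: measurable_funTS; exact: measurable_powR.
Qed.

Let G_split s t : 0 < s -> s <= t ->
  G m g s = (\int[lebesgue_measure]_(z in `[s, t[) (I z)%:E + G m g t)%E.
Proof.
move=> s0 st; rewrite /G (@itv_bndbnd_setU _ _ (BLeft s) (BLeft t) +oo%O) ?bnd_simp//.
rewrite ge0_integral_setU//.
- rewrite -itv_bndbnd_setU ?bnd_simp//.
  by apply/measurable_EFinP; exact: mI.
- by move=> z _; rewrite lee_fin I_ge0.
- apply/disj_setPS => z /= []; rewrite !in_itv/= andbT => /andP[_ zt].
  by rewrite leNgt zt.
Qed.

Let integral_cst_itv (s t c : R) : s <= t ->
  (\int[lebesgue_measure]_(z in `[s, t[) c%:E = (c * (t - s))%:E)%E.
Proof.
move=> st; rewrite integral_cst//= lebesgue_measure_itv/= lte_fin.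
have [_|] := ltP s t; first by rewrite -EFinB -EFinM.
by move=> ts; rewrite mule0 (le_anti (introT andP (conj st ts))) subrr mulr0.
Qed.

Let G_diff_ge s t : 0 < s -> s <= t ->
  ((I t * (t - s))%:E + G m g t <= G m g s)%E.
Proof.
move=> s0 st; rewrite (G_split s0 st) leeD2r// -integral_cst_itv//.
apply: ge0_le_integral => //.
- by move=> z _; rewrite lee_fin I_ge0.
- apply/measurable_EFinP; apply: measurable_funS (mI s0) => // z /=.
  by rewrite !in_itv/= andbT => /andP[].
- by move=> z /=; rewrite in_itv/= => /andP[sz zt]; rewrite lee_fin I_le ?(ltW zt)// (lt_le_trans s0).
Qed.

Let G_diff_le s t : 0 < s -> s <= t ->
  (G m g s <= (I s * (t - s))%:E + G m g t)%E.
Proof.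
move=> s0 st; rewrite (G_split s0 st) leeD2r// -integral_cst_itv//.
apply: ge0_le_integral => //.
- by move=> z _; rewrite lee_fin I_ge0.
- apply/measurable_EFinP; apply: measurable_funS (mI s0) => // z /=.
  by rewrite !in_itv/= andbT => /andP[].
- by move=> z /=; rewrite in_itv/= => /andP[sz zt]; rewrite lee_fin I_le.
Qed.

Lemma G_ge0 t : (0 <= G m g t)%E.
Proof. by apply: integral_ge0 => z _; rewrite lee_fin I_ge0. Qed.

Lemma G_fin t : 0 < t -> G m g t \is a fin_num.
Proof.
move=> t0; rewrite ge0_fin_numE ?G_ge0//.
have [t1|t1] := leP t 1.
  by apply: le_lt_trans (G_diff_le t0 t1) _; rewrite lte_add_pinfty// ltry.
apply: le_lt_trans G1; apply: le_trans (G_diff_ge ltr01 (ltW t1)).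
by rewrite leeDr// lee_fin mulr_ge0 ?I_ge0// subr_ge0 ltW.
Qed.

Local Notation Gr := (G_real m g).

Let GrE t : 0 < t -> G m g t = (Gr t)%:E.
Proof. by move=> /G_fin/fineK. Qed.

Let Gr_diff_ge s t : 0 < s -> s <= t -> I t * (t - s) <= Gr s - Gr t.
Proof.
move=> s0 st; have := G_diff_ge s0 st.
by rewrite !GrE// ?(lt_le_trans s0)// -EFinD lee_fin lerBrDr.
Qed.

Let Gr_diff_le s t : 0 < s -> s <= t -> Gr s - Gr t <= I s * (t - s).
Proof.
move=> s0 st; have := G_diff_le s0 st.
by rewrite !GrE// ?(lt_le_trans s0)// -EFinD lee_fin lerBlDr.
Qed.

Lemma Gr_lt s t : 0 < s -> s < t -> Gr t < Gr s.
Proof.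
move=> s0 st; have t0 := lt_trans s0 st; rewrite -subr_gt0.
by apply: lt_le_trans (Gr_diff_ge s0 (ltW st)); rewrite mulr_gt0 ?I_gt0 ?subr_gt0.
Qed.

(** The interval [[t / 2, t]] contributes at least its length times the least value [I t] of the
    integrand, and [I t = (t / g t)^(1/m) / t]. This is how [G] measures the cost of one
    doubling. *)
Lemma Gr_doubling t : 0 < t -> (t / g t) `^ (1 / m%:R) / 2 <= Gr (t / 2) - Gr t.
Proof.
move=> t0; have t20 : 0 < t / 2 by rewrite divr_gt0.
have [gt0 _ _] := g_pos t0.
have t2t : t / 2 <= t by lra.
have := Gr_diff_ge t20 t2t; apply: le_trans.
rewrite (_ : t - t / 2 = t / 2); last by rewrite {1}[t]splitr addrK.
have -> : I t = (t / g t) `^ (1 / m%:R) / t.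
  have -> : t / g t = t * g t `^ (-1) by rewrite powR_inv1// ltW.
  rewrite powRM ?(ltW t0) ?powR_ge0// -powRrM mulN1r /I powRB; last by rewrite [t == 0]gt_eqF// implybT.
  by rewrite powRr1 ?(ltW t0)// mulrCA mulrA.
by rewrite -mulrA mulKf ?gt_eqF// -mulrA [t / 2 * _]mulrC.
Qed.

(** Otherwise the integrals over [[1, i + 1[] would all stay below [G 1 - e], although they converge
    to [G 1]. *)
Lemma Gr_tail e : 0 < e -> exists2 t, 1 <= t & Gr t <= e.
Proof.
move=> e0; apply: contrapT => nex.
have big t : 1 <= t -> e < Gr t.
  by move=> t1; rewrite ltNge; apply/negP => Gte; apply: nex; exists t.
pose F (i : nat) : set R := `[1, i.+1%:R[%classic.
have FU : \bigcup_i F i = `[1, +oo[%classic.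
  apply/seteqP; split => z /=; first by move=> [i _] /=; rewrite !in_itv/= andbT => /andP[].
  rewrite in_itv/= andbT => z1; exists (Num.truncn z) => //.
  by rewrite /F /= in_itv/= z1 truncnS_gt.
have i1 (i : nat) : (1 : R) <= i.+1%:R by rewrite ler1n.
have FG i : (\int[lebesgue_measure]_(z in F i) (I z)%:E <= (Gr 1 - e)%:E)%E.
  have := G_split ltr01 (i1 i); rewrite !GrE ?ltr01// => E1.
  have : (\int[lebesgue_measure]_(z in F i) (I z)%:E + e%:E <= (Gr 1)%:E)%E.
    by rewrite E1 leeD2l// lee_fin ltW// big.
  by rewrite EFinB leeBrDr.
have cF : (\int[lebesgue_measure]_(z in F i) (I z)%:E)%E @[i --> \oo] --> (Gr 1)%:E.
  rewrite -GrE ?ltr01// /G -FU.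
  apply: ge0_nondecreasing_set_cvg_integral.
  - move=> i j ij; apply/subsetPset => z; rewrite /F /= !in_itv/= => /andP[-> zi].
    by rewrite (lt_le_trans zi)// ler_nat ltnS.
  - by move=> i; exact: measurable_itv.
  - move=> i; apply/measurable_EFinP; apply: measurable_funS (mI ltr01) => // z; rewrite /F /=.
    by rewrite !in_itv/= andbT => /andP[].
  - by move=> i z _; rewrite lee_fin I_ge0.
have : ((Gr 1)%:E <= (Gr 1 - e)%:E)%E.
  rewrite -(cvg_lim _ cF)//; apply: lime_le; first by apply/cvg_ex; exists (Gr 1)%:E.
  by apply: nearW => i; exact: FG.
by rewrite lee_fin; lra.
Qed.

Lemma Gr_continuous a b : 0 < a -> {within `[a, b], continuous Gr}.
Proof.
move=> a0; apply/subspace_continuousP => x; rewrite /= in_itv/= => /andP[ax _].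
apply/cvgrPdist_le => e e0.
rewrite near_withinE; near=> y; rewrite /= in_itv/= => /andP[ay _].
have xy : `|x - y| <= e / I a.
  by near: y; apply: cvgr_dist_le; [exact: cvg_id|rewrite divr_gt0 ?I_gt0].
have bound s t : a <= s -> s <= t -> `|Gr s - Gr t| <= I a * `|s - t|.
  move=> as_ st; have s0 := lt_le_trans a0 as_.
  rewrite ger0_norm; last by apply: le_trans (Gr_diff_ge s0 st); rewrite mulr_ge0 ?I_ge0 ?subr_ge0.
  rewrite distrC ger0_norm ?subr_ge0//; apply: le_trans (Gr_diff_le s0 st) _.
  by rewrite ler_wpM2r ?subr_ge0// I_le.
have : `|Gr x - Gr y| <= I a * `|x - y|.
  by have [/bound|/ltW/bound] := leP x y; [exact|rewrite distrC [`|x - y|]distrC; exact].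
move=> /le_trans; apply; rewrite -(ler_pdivlMl _ _ (I_gt0 a0)) mulrC; exact: xy.
Unshelve. all: end_near. Qed.

(** ['pinv_] is meaningful only on the range of [G]. Since [G] is continuous and gets arbitrarily
    small, every [s] with [0 < s <= G t] is attained at some [tau >= t], and strict monotonicity
    identifies [tau] with the value of the inverse. *)
Lemma G_inv_ge (s t : R) : 0 < t -> 0 < s -> s <= Gr t ->
  exists2 tau, t <= tau & G_inv m g s%:E = tau%:E.
Proof.
move=> t0 s0 sG; have [T T1 TGs] := Gr_tail s0.
have tT : t <= T.
  rewrite leNgt; apply/negP => /(Gr_lt (lt_le_trans ltr01 T1)).
  by rewrite ltNge (le_trans TGs).
have [|tau] := IVT tT (@Gr_continuous t T t0) (v := s).
  by rewrite ge_min TGs orbT/= le_max sG.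
rewrite in_itv/= => /andP[ttau _] Gtau; exists tau => //.
have tau0 := lt_le_trans t0 ttau.
rewrite /G_inv eqe gt_eqF//; congr EFin.
rewrite -Gtau -GrE//; apply: pinvKV; last by rewrite inE/= in_itv/= tau0.
move=> x y; rewrite !inE/= !in_itv/= !andbT => x0 y0.
rewrite !GrE// => -[]; have [/(Gr_lt x0)|/(Gr_lt y0)|//] := ltgtP x y.
  by move=> + e; rewrite e ltxx.
by move=> + e; rewrite e ltxx.
Qed.

Lemma Gr_ge0 t : 0 <= Gr t.
Proof. by apply: fine_ge0; exact: G_ge0. Qed.

(** If [g'] were bounded by [L'], then [g t <= t g'(t) <= L' t], so every doubling would use up a
    fixed amount of [G], against the finiteness of [G 1]. *)
Lemma hderive_unbounded (L : R) : exists2 x, 0 < x & L < P x.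
Proof.
apply: contrapT => nex; pose L' := Num.max L 1.
have L'0 : 0 < L' by rewrite lt_max ltr01 orbT.
have PL x : 0 < x -> P x <= L'.
  move=> x0; rewrite le_max leNgt; apply/orP; left; apply/negP => Lx.
  by apply: nex; exists x.
pose c := (L'^-1) `^ (1 / m%:R).
have c0 : 0 < c by rewrite powR_gt0// invr_gt0.
have step t : 0 < t -> c / 2 <= Gr (t / 2) - Gr t.
  move=> t0; apply: le_trans (Gr_doubling t0); rewrite ler_pM2r//.
  have [gt0 _ _] := g_pos t0.
  apply: ge0_ler_powR; rewrite ?nnegrE ?(ltW m0) ?invr_ge0 ?divr_ge0 ?(ltW gt0) ?(ltW t0) ?(ltW L'0)//.
  rewrite ler_pdivlMr// mulrC ler_pdivrMr//.
  have := convex_support (ltW t0) (lexx 0); rewrite g0 sub0r mulrN subr_le0.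
  by move=> /le_trans; apply; rewrite mulrC ler_pM2l// PL.
have ind k : k%:R * (c / 2) <= Gr 1 - Gr (2 ^+ k).
  elim: k => [|k IH]; first by rewrite expr0 subrr mul0r.
  have p2 : 0 < 2 ^+ k.+1 :> R by rewrite exprn_gt0.
  have := step _ p2.
  have -> : 2 ^+ k.+1 / 2 = 2 ^+ k :> R by rewrite exprSr mulfK.
  rewrite -[k.+1%:R]natr1.
  by move: IH; set A := Gr 1; set B := Gr (2 ^+ k); move: (Gr _) => D; lra.
have := ind (Num.truncn (Gr 1 / (c / 2))).+1; apply/negP; rewrite -ltNge.
apply: (@le_lt_trans _ _ (Gr 1)); first by rewrite lerBlDr lerDl Gr_ge0.
by rewrite -ltr_pdivrMr ?divr_gt0//; exact: truncnS_gt.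
Qed.

Lemma hderive_surj xi : P 0 <= xi -> exists2 y, 0 <= y & P y = xi.
Proof.
move=> Pxi; have [x x0 xix] := hderive_unbounded xi.
have cP : {within `[0, x], continuous P}.
  have [_ h2 _] := hg; apply: continuous_subspaceW (hderivable_continuous h2) => z /=.
  by rewrite !in_itv/= andbT => /andP[].
have [|y] := IVT (ltW x0) cP (v := xi).
  by rewrite ge_min Pxi/= le_max (ltW xix) orbT.
by rewrite in_itv/= => /andP[y0 _] Py; exists y.
Qed.

Let q := hderive_inv g.

Let qP y : 0 <= y -> q (P y) = y.
Proof.
move=> y0; apply: pinvKV; last by rewrite inE/= in_itv/= y0.
move=> a b; rewrite !inE/= !in_itv/= !andbT => a0 b0 Pab.
by have [/(hderive_lt a0)|/(hderive_lt b0)|//] := ltgtP a b; rewrite Pab ltxx.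
Qed.

Let q_ge0 xi : P 0 <= xi -> 0 <= q xi.
Proof. by move=> /hderive_surj[y y0 <-]; rewrite qP. Qed.

Let PqK xi : P 0 <= xi -> P (q xi) = xi.
Proof. by move=> /hderive_surj[y y0 <-]; rewrite qP. Qed.

Let q_le a b : P 0 <= a -> a <= b -> q a <= q b.
Proof.
move=> Pa ab; have Pb := le_trans Pa ab; rewrite leNgt; apply/negP.
by move=> /(hderive_lt (q_ge0 Pb)); rewrite !PqK// ltNge ab.
Qed.

(** Clamping the argument at [P 0] gives a function monotone on the whole line, hence measurable,
    that agrees with [q] here. *)
Let mq : measurable_fun (`[P 0, +oo[%classic : set R) q.
Proof.
apply: (@eq_measurable_fun _ _ _ _ _ (fun x => q (Num.max (P 0) x))).
  by move=> x; rewrite inE/= in_itv/= andbT => Px; rewrite (max_idPr Px).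
apply: measurable_funTS; apply: nondecreasing_measurable => // x y xy.
by apply: q_le; [rewrite le_max lexx|rewrite ge_max !le_max lexx xy !orbT].
Qed.

(** Half-open at [b], so that consecutive pieces are disjoint. *)
Let J b := (\int[lebesgue_measure]_(z in `[P 0, b[) (q z)%:E)%E.

Let J_step x y : 0 <= x -> x <= y -> (J (P x) + (x * (P y - P x))%:E <= J (P y))%E.
Proof.
move=> x0 xy; have Px := hderive_le (lexx 0) x0; have Pxy := hderive_le x0 xy.
rewrite [leRHS]/J (@itv_bndbnd_setU _ _ (BLeft (P 0)) (BLeft (P x)) (BLeft (P y))) ?bnd_simp//.
rewrite ge0_integral_setU//.
- rewrite leeD2l// -integral_cst_itv//; apply: ge0_le_integral => //.
  + apply/measurable_EFinP; apply: measurable_funS mq => // z /=.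
    by rewrite !in_itv/= andbT => /andP[Pxz _]; exact: le_trans Pxz.
  + move=> z /=; rewrite in_itv/= lee_fin => /andP[Pxz _].
    by rewrite -[leLHS](qP x0) q_le.
- rewrite -itv_bndbnd_setU ?bnd_simp//.
  apply/measurable_EFinP; apply: measurable_funS mq => // z /=.
  by rewrite !in_itv/= andbT => /andP[].
- rewrite -itv_bndbnd_setU ?bnd_simp// => z /=; rewrite in_itv/= lee_fin => /andP[? _].
  exact: q_ge0.
- apply/disj_setPS => z /= []; rewrite !in_itv/= => /andP[_ zt] /andP[].
  by rewrite leNgt zt.
Qed.

Lemma legendre_ge0 xi : (0 <= legendre g xi)%E.
Proof.
rewrite /legendre; case: ifP => // _; apply: integral_ge0 => z /=.
by rewrite in_itv/= lee_fin => /andP[? _]; exact: q_ge0.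
Qed.

(** The half of the classical identity for the Legendre transform at [g' y] that Young's inequality
    uses. A uniform partition replaces the change of variables: [J_step] bounds each piece from
    below, and the tangent at one node bounds [g] at the next. *)
Lemma legendre_hderive y : 0 <= y -> ((y * P y - g y)%:E <= legendre g (P y))%E.
Proof.
move=> y0; have PPy := hderive_le (lexx 0) y0.
have JL : (J (P y) <= legendre g (P y))%E.
  rewrite /legendre; case: ifPn => [Py|]; last first.
    by rewrite -leNgt => Py; rewrite /J set_itv_ge ?integral_set0// bnd_simp -leNgt.
  apply: ge0_subset_integral => //.
  - apply/measurable_EFinP; apply: measurable_funS mq => // z /=.
    by rewrite !in_itv/= andbT => /andP[].
  - by move=> z /=; rewrite in_itv/= lee_fin => /andP[? _]; exact: q_ge0.
  - by move=> z /=; rewrite !in_itv/= => /andP[-> /ltW].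
apply: le_trans JL.
apply/lee_addgt0Pr => e e0.
(* The mesh [d] makes the error [d (P y - P 0)] of the lower sums at most [e]. *)
pose N := (Num.truncn (y * (P y - P 0) / e)).+1; pose d := y / N%:R.
have d0 : 0 <= d by rewrite divr_ge0.
(* lower Riemann-Stieltjes sums of [x dP] over the partition [i * d] *)
have ind i : ((i%:R * d * P (i%:R * d) - g (i%:R * d) - d * (P (i%:R * d) - P 0))%:E
    <= J (P (i%:R * d)))%E.
  elim: i => [|i IH].
    rewrite !mul0r g0 !subrr mulr0 subrr; apply: integral_ge0 => z /=.
    by rewrite in_itv/= lee_fin => /andP[? _]; exact: q_ge0.
  set x := i%:R * d in IH *; set x' := i.+1%:R * d.
  have x'E : x' = x + d by rewrite /x' -natr1 mulrDl mul1r.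
  have x0 : 0 <= x by rewrite mulr_ge0.
  have xx' : x <= x' by rewrite x'E lerDl.
  apply: le_trans (J_step x0 xx').
  apply: le_trans (leeD2r _ IH); rewrite -EFinD lee_fin.
  have := convex_support x0 (le_trans x0 xx'); rewrite x'E addrAC subrr add0r.
  by move: (g x) (P x) (g _) (P (x + d)) (P 0) => gx Px gx' Px' P0; nra.
have := ind N; rewrite /d mulrCA divff ?mulr1 ?pnatr_eq0// => /leeD2r - /(_ e%:E).
apply: le_trans; rewrite -EFinD lee_fin.
suff : y / N%:R * (P y - P 0) <= e by lra.
by rewrite mulrAC ler_pdivrMr// -ler_pdivrMl// mulrC ltW// truncnS_gt.
Qed.

(** For [xi >= g'(0)] the tangent at the point where [g' = xi] lies below [g]. For smaller [xi] the
    tangent at 0 already gives [z xi <= g z]. *)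
Lemma young_legendre z xi : 0 <= z -> ((z * xi)%:E <= (g z)%:E + legendre g xi)%E.
Proof.
move=> z0; have [Pxi|xiP] := leP (P 0) xi.
  have [y y0 Py] := hderive_surj Pxi.
  apply: (@le_trans _ _ ((g z)%:E + (y * P y - g y)%:E)%E).
    rewrite -EFinD lee_fin -Py; have := convex_support y0 z0.
    by move: (g y) (P y) (g z) => gy Py' gz; nra.
  by rewrite leeD2l// -Py legendre_hderive.
apply: (@le_trans _ _ (g z)%:E); last by rewrite leeDl// legendre_ge0.
rewrite lee_fin; have := convex_support (lexx 0) z0; rewrite g0 add0r subr0.
by apply: le_trans; rewrite mulrC ler_wpM2r// ltW.
Qed.

Lemma legendre_fin xi : legendre g xi \is a fin_num.
Proof.
rewrite ge0_fin_numE ?legendre_ge0// /legendre; case: ifP => // Pxi.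
apply: (@le_lt_trans _ _ (\int[lebesgue_measure]_(z in `[P 0%R, xi]) (q xi)%:E)%E).
  apply: ge0_le_integral => //.
  - by move=> z /=; rewrite in_itv/= lee_fin => /andP[? _]; exact: q_ge0.
  - apply/measurable_EFinP; apply: measurable_funS mq => // z /=.
    by rewrite !in_itv/= andbT => /andP[].
  - by move=> z /=; rewrite in_itv/= lee_fin => /andP[? ?]; exact: q_le.
rewrite integral_cst//= lebesgue_measure_itv/= lte_fin Pxi.
by rewrite -EFinB -EFinM ltry.
Qed.

Lemma legendre_le a b : a <= b -> (legendre g a <= legendre g b)%E.
Proof.
move=> ab; rewrite {1}/legendre; case: ifPn => [Pa|_]; last exact: legendre_ge0.
rewrite /legendre ifT; last exact: lt_le_trans ab.
apply: ge0_subset_integral => //.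
- apply/measurable_EFinP; apply: measurable_funS mq => // z /=.
  by rewrite !in_itv/= andbT => /andP[].
- by move=> z /=; rewrite in_itv/= lee_fin => /andP[? _]; exact: q_ge0.
- by move=> z /=; rewrite !in_itv/= => /andP[-> /le_trans]; exact.
Qed.

Lemma gamma_recipE y : y != 0 -> gamma_recip g y = (fine (legendre g y^-1) * y)%:E.
Proof.
move=> y0; rewrite /gamma_recip (negbTE y0) /gamma div1r invrK EFinM.
by rewrite fineK ?legendre_fin.
Qed.

Lemma gamma_recip_ge0 y : 0 <= y -> (0 <= gamma_recip g y)%E.
Proof.
have [->|y0] := eqVneq y 0; first by rewrite /gamma_recip eqxx.
by move=> ?; rewrite gamma_recipE// lee_fin mulr_ge0// fine_ge0// legendre_ge0.
Qed.

(** Young's inequality at [xi = 1 / y], multiplied by [y]. *)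
Lemma young_gamma y z : 0 <= y -> 0 <= z ->
  (z%:E <= (y * g z)%:E + gamma_recip g y)%E.
Proof.
move=> y_ge0 z0; have [->|y0] := eqVneq y 0.
  by rewrite /gamma_recip eqxx addey// leey.
have yp : 0 < y by rewrite lt_neqAle eq_sym y0.
rewrite gamma_recipE// -EFinD lee_fin.
have := young_legendre y^-1 z0; rewrite -[legendre _ _]fineK ?legendre_fin//.
rewrite -EFinD lee_fin -(ler_pM2r yp) mulfVK ?gt_eqF// => /le_trans; apply.
by rewrite mulrDl [g z * y]mulrC.
Qed.

Lemma measurable_gamma_recip :
  measurable_fun (`[0, +oo[%classic : set R) (gamma_recip g).
Proof.
have -> : `[0, +oo[%classic = [set (0 : R)] `|` `]0, +oo[%classic.
  by rewrite setU1itv.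
apply/measurable_funU => //; split; first exact: measurable_fun_set1.
apply: (@eq_measurable_fun _ _ _ _ _ (fun y : R => (fine (legendre g y^-1) * y)%:E)).
  by move=> y; rewrite inE/= in_itv/= andbT => y0; rewrite gamma_recipE// gt_eqF.
apply/measurable_EFinP; apply: measurable_funM; last exact: measurable_id.
apply: (@measurableT_comp _ _ _ _ _ _ (fun xi => fine (legendre g xi))).
  apply: nondecreasing_measurable => // a b ab.
  by apply: fine_le; rewrite ?legendre_fin// legendre_le.
apply: open_continuous_measurable_fun; first exact: interval_open.
move=> y; rewrite inE/= in_itv/= andbT => y0.
by apply: inv_continuous; rewrite gt_eqF.
Qed.

(** A growth inequality strong enough to double [w] within short distances limits the room left
    before [r]. As [w] may jump, there need be no point where it equals [2 t], so the argument goes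
    by contradiction at a point chosen by distance and not by the value of [w]. *)
Lemma blowup_bound (w : R -> R) (r F K s : R) : 0 < F -> 0 < K ->
  (forall a b, 0 <= a -> a <= b -> b < r -> w a <= w b) ->
  (forall a h, 0 <= a -> 0 < h -> a + h < r -> (F * h) ^+ m * g (w a) <= K * w (a + h)) ->
  0 <= s -> s < r -> 0 < w s ->
  (r - s) * F <= 2 * (2 * K) `^ (1 / m%:R) * Gr (w s / 2).
Proof.
move=> F0 K0 wmono wineq s0 sr ws0; set C := 2 * (2 * K) `^ (1 / m%:R).
have C0 : 0 < C by rewrite mulr_gt0// powR_gt0// mulr_gt0.
have Gmono a b : 0 < a -> a <= b -> Gr b <= Gr a.
  by move=> a0; rewrite le_eqVlt => /orP[/eqP->//|/(Gr_lt a0)/ltW].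
(* Induction on the number of doublings of [w] over [[a, b]]; the right-hand side is the telescoped
   cost. *)
have step N : forall t a b, 0 <= a -> a <= b -> b < r -> 0 < t -> t <= w a ->
    w b < 2 ^+ N * t -> (b - a) * F <= C * (Gr (t / 2) - Gr (2 ^+ N * t / 2)).
  elim: N => [|N IH] t a b a0 ab br t0 ta wb.
    by move: wb; rewrite expr0 mul1r ltNge (le_trans ta)// wmono.
  rewrite leNgt; apply/negP => big.
  have t2 : 0 < t / 2 by rewrite divr_gt0.
  have E2 : 2 ^+ N.+1 * t / 2 = 2 ^+ N * t.
    by rewrite exprS -!mulrA mulrC !mulrA mulfVK// pnatr_eq0.
  pose X := C * (Gr (t / 2) - Gr t); pose Y := C * (Gr t - Gr (2 ^+ N.+1 * t / 2)).
  have X0 : 0 <= X by rewrite mulr_ge0 ?(ltW C0)// subr_ge0 Gmono//; lra.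
  have Y0 : 0 <= Y.
    rewrite mulr_ge0 ?(ltW C0)// subr_ge0 Gmono// E2 ler_peMl ?(ltW t0)//.
    by rewrite exprn_ege1// ler1n.
  have XY : X + Y < (b - a) * F by rewrite /X /Y -mulrDr addrA subrK.
  (* split [a, b] strictly between the two contributions *)
  pose p := a + (X + ((b - a) * F - X - Y) / 2) / F.
  have pa : (p - a) * F = X + ((b - a) * F - X - Y) / 2.
    by rewrite /p addrAC subrr add0r divfK ?gt_eqF.
  have pb : (b - p) * F = Y + ((b - a) * F - X - Y) / 2.
    have -> : b - p = (b - a) - (p - a) by rewrite opprB addrA subrK.
    by rewrite mulrBl pa; lra.
  have ap : a < p by rewrite -subr_gt0 -(pmulr_lgt0 _ F0) pa; lra.
  have pb' : p < b by rewrite -subr_gt0 -(pmulr_lgt0 _ F0) pb; lra.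
  have p0 : 0 <= p by rewrite (le_trans a0)// ltW.
  (* If [w] has not doubled at [p], the growth inequality gives [(F (p - a))^m g(t) <= 2 K t], hence
     [(p - a) F <= X]. If it has, the induction hypothesis on [[p, b]] gives [(b - p) F <= Y]. Both
     contradict the choice of [p]. *)
  have [wp|wp] := ltP (w p) (2 * t).
    have := wineq a (p - a) a0; rewrite subr_gt0 => /(_ ap).
    have -> : a + (p - a) = p by lra.
    move=> /(_ (lt_trans pb' br)) ineq.
    have [gt0 _ _] := g_pos t0.
    suff : (p - a) * F <= X by rewrite pa; lra.
    have h0 : 0 <= F * (p - a) by rewrite mulr_ge0 ?subr_ge0 ?ltW.
    have le1 : (F * (p - a)) ^+ m <= 2 * K * (t / g t).
      rewrite mulrA ler_pdivlMr//; apply: le_trans (_ : K * w p <= _); last by nra.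
      by apply: le_trans ineq; rewrite ler_wpM2l ?exprn_ge0// convex_le// ltW.
    have -> : (p - a) * F = ((F * (p - a)) ^+ m) `^ (1 / m%:R).
      by rewrite -powR_mulrn// -powRrM mulrCA divff ?mulr1 ?powRr1 ?pnatr_eq0 -?lt0n// mulrC.
    apply: (@le_trans _ _ ((2 * K * (t / g t)) `^ (1 / m%:R))).
      apply: ge0_ler_powR => //; rewrite ?nnegrE ?(ltW m0) ?exprn_ge0//.
      by rewrite mulr_ge0 ?divr_ge0 ?mulr_ge0 ?invr_ge0 ?(ltW K0) ?(ltW t0) ?(ltW gt0).
    rewrite powRM ?mulr_ge0 ?divr_ge0 ?invr_ge0 ?(ltW K0) ?(ltW gt0) ?(ltW t0)//.
    have := Gr_doubling t0; rewrite /X /C.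
    have : 0 <= (2 * K) `^ (1 / m%:R) by exact: powR_ge0.
    move: ((2 * K) `^ _) ((t / g t) `^ _) (Gr (t / 2) - Gr t) => A1 A2 A3; nra.
  have t20 : 0 < 2 * t by rewrite mulr_gt0.
  have wb2 : w b < 2 ^+ N * (2 * t) by rewrite mulrA -exprSr.
  have := IH (2 * t) p b p0 (ltW pb') br t20 wp wb2.
  have -> : 2 * t / 2 = t by rewrite mulrC mulKf// pnatr_eq0.
  have -> : 2 ^+ N * (2 * t) / 2 = 2 ^+ N.+1 * t / 2 by rewrite mulrA -exprSr.
  by rewrite -/Y pb; lra.
have main b : s <= b -> b < r -> (b - s) * F <= C * Gr (w s / 2).
  move=> sb br; pose N := Num.truncn (w b / w s).
  have wbN : w b < 2 ^+ N.+1 * w s.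
    rewrite -ltr_pdivrMr//; apply: lt_trans (truncnS_gt _) _.
    by rewrite -natrX ltr_nat ltn_expl.
  apply: le_trans (step _ _ _ _ s0 sb br ws0 (lexx _) wbN) _.
  by rewrite ler_wpM2l ?(ltW C0)// lerBlDr lerDl Gr_ge0.
rewrite leNgt; apply/negP => big.
pose D := C * Gr (w s / 2).
(* [main] only speaks of [b < r], so [b] is taken halfway between [s + D / F] and [r]. *)
pose b := s + ((r - s) + D / F) / 2.
have DF : D / F < r - s by rewrite ltr_pdivrMr.
have D0 : 0 <= D / F by rewrite divr_ge0 ?(ltW F0)// mulr_ge0 ?(ltW C0)// Gr_ge0.
have := main b; rewrite /b.
have -> : s <= s + (r - s + D / F) / 2 by lra.
have -> : s + (r - s + D / F) / 2 < r by lra.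
move=> /(_ isT isT); rewrite -/D -ler_pdivlMr// => ?; lra.
Qed.

End convex_function.

(** * Derivatives and bounds of test functions *)

Section test_function_theory.
Context {R : realType} {n : nat}.
Implicit Types (phi psi : 'rV[R]_n -> R) (S U : set 'rV[R]_n).

(** The word in which each index [i] is repeated [alpha i] times makes the bounds on lists of
    derivatives available. *)
Lemma partial_multiE m (alpha : multi_index n m) :
  exists2 s : seq 'I_n, size s = m &
    forall phi, partial_multi alpha phi = pderiv s phi.
Proof.
exists (flatten [seq nseq (val alpha i) i | i <- enum 'I_n]); last first.
  move=> phi; rewrite /partial_multi; elim: (enum 'I_n) => //= i e ->.
  rewrite [in RHS]/pderiv foldr_cat; elim: (nat_of_ord _) => //= k IH.
  by rewrite IH.
rewrite size_flatten /shape -map_comp sumnE big_map big_enum/=.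
rewrite (eq_bigr (fun i => nat_of_ord (val alpha i))); first exact/eqP/(valP alpha).
by move=> i _; rewrite /= size_nseq.
Qed.

Lemma pderiv_out phi s x : ~ closure [set x | phi x != 0] x -> pderiv s phi x = 0.
Proof.
move=> nx; rewrite (@eq_open_pderiv _ _ s phi (cst 0) (~` closure [set x | phi x != 0])) //.
- by case: s => // i s; rewrite pderiv_cst.
- exact/closed_openC/closed_closure.
- move=> y ny; apply/eqP; apply: contrapT => /negP phy; apply: ny.
  exact: subset_closure.
Qed.

Lemma test_function_nbd U S r phi : smooth phi -> compact S ->
  [set x | phi x != 0] `<=` nbd S r -> closure [set x | phi x != 0] `<=` U ->
  test_function U phi.
Proof.
move=> sphi cS phiS phiU; split => //.
apply: bounded_closed_compact; last exact: closed_closure.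
have [M [Mreal SM]] := nbd_bounded (r + 1) cS.
exists M; split => // x Mx y cy; apply: SM Mx _ _.
apply: (@closure_nbd _ _ _ r); first by rewrite ltrDl.
exact: closureS phiS _ cy.
Qed.

(** The induction on the order keeps only smoothness and vanishing off the compact set [K], both of
    which pass to partial derivatives. *)
Lemma test_function_bounded U phi k : test_function U phi ->
  exists2 B, 0 <= B & forall s x, (size s <= k)%N -> `|pderiv s phi x| <= B.
Proof.
move=> [sphi + _]; set K := closure _ => cK.
have K0 s x : ~ K x -> pderiv s phi x = 0 by exact: pderiv_out.
have base psi : continuous psi -> (forall x, ~ K x -> psi x = 0) ->
    exists2 B, 0 <= B & forall x, `|psi x| <= B.
  move=> cpsi psi0.
  have /compact_bounded[M [Mreal psiM]] : compact (psi @` K).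
    by apply: continuous_compact => //; exact: continuous_subspaceT.
  exists (`|M| + 1); first by rewrite addr_ge0.
  move=> x; have [Kx|/psi0 ->] := pselect (K x); last by rewrite normr0 addr_ge0.
  apply: (psiM (`|M| + 1)); last by exists x.
  by rewrite ltr_pwDr// ler_norm.
move: K K0 base {cK} => K K0 base.
elim: k phi sphi K0 => [|k IH] psi spsi psi0.
  have [B B0 psiB] := base _ (smooth_continuous spsi) (psi0 [::]).
  by exists B => // -[|].
have [B B0 psiB] := base _ (smooth_continuous spsi) (psi0 [::]).
have [C CP] : {C : 'I_n -> R & forall i, 0 <= C i /\
    forall s x, (size s <= k)%N -> `|pderiv s (partial i psi) x| <= C i}.
  apply: (@choice _ _ (fun i C => 0 <= C /\
    forall s x, (size s <= k)%N -> `|pderiv s (partial i psi) x| <= C)) => i.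
  have [|C C0 psiC] := IH _ (smooth_partial i spsi); last by exists C.
  by move=> s x Kx; rewrite -pderiv_rcons psi0.
have C0 : 0 <= \sum_i C i by apply: sumr_ge0 => i _; case: (CP i).
exists (B + \sum_i C i); first by rewrite addr_ge0.
move=> s x; case/lastP: s => [|s i]; first by rewrite (le_trans (psiB x))// lerDl.
rewrite size_rcons ltnS pderiv_rcons => sk; have [_ Ci] := CP i.
rewrite (le_trans (Ci s x sk))// (bigD1 i)//= addrCA lerDl addr_ge0// sumr_ge0// => j _.
by case: (CP j).
Qed.

End test_function_theory.

(** * Upper and lower limits as the radius tends to 0 *)

Section limits_at_zero.
Context {R : realType}.
Implicit Type F : R -> \bar R.

Lemma nbhs_at_right0 (V : set R) : (0^'+ : set (set R)) V ->
  exists2 e, 0 < e & forall r, 0 < r -> r < e -> V r.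
Proof.
case=> e /= e0 eV; exists e => // r r0 re; apply: eV => //.
by rewrite /ball_/= sub0r normrN gtr0_norm.
Qed.

Lemma limf_esup_lt_pinfty F : (limf_esup F 0^'+ < +oo)%E ->
  exists B e, [/\ 0 < B, 0 < e & forall r, 0 < r -> r < e -> (F r <= B%:E)%E].
Proof.
move=> /ereal_inf_lt[_ [V /nbhs_at_right0[e e0 eV] <-] supV].
(* The maximum with 1 makes the bound positive and covers a supremum equal to [-oo]. *)
exists (Num.max 1 (fine (ereal_sup (F @` V)))), e; split => //.
  by rewrite lt_max ltr01.
move=> r r0 re; have : (F r <= ereal_sup (F @` V))%E.
  by apply: ereal_sup_ubound; exists r => //; exact: eV.
move/le_trans; apply; move: supV; case: (ereal_sup _) => //= [y _|_].
  by rewrite lee_fin le_max lexx orbT.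
exact: leNye.
Qed.

Lemma limf_einf_gt0 F : (0 < limf_einf F 0^'+)%E ->
  exists c e, [/\ 0 < c, 0 < e & forall r, 0 < r -> r < e -> (c%:E <= F r)%E].
Proof.
rewrite limf_einfE => /ereal_sup_gt[_ [V /nbhs_at_right0[e e0 eV] <-] infV].
exists (if ereal_inf (F @` V) is y%:E then y else 1), e; split => //.
  by move: infV; case: (ereal_inf _).
move=> r r0 re; have : (ereal_inf (F @` V) <= F r)%E.
  by apply: ereal_inf_lbound; exists r => //; exact: eV.
apply: le_trans; move: infV; case: (ereal_inf _) => //= _.
exact: leey.
Qed.

End limits_at_zero.

(** * Jensen's inequality with an upper bound on the measure *)

Section jensen.
Context d (T : measurableType d) (R : realType) (mu : {measure set T -> \bar R}).

(** The supporting line at [v] is integrated over [W]. Its constant, moved to the side of [g], is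
    [p v - g v], which is nonnegative because [g 0 = 0]. So the upper bound [M] may replace the
    measure of [W]. *)
Lemma jensen_support (W : set T) (w : T -> R) (g : R -> R) (M v p : R) :
  measurable W -> (mu W <= M%:E)%E -> measurable_fun W w ->
  measurable_fun W (g \o w) -> (forall x, W x -> 0 <= w x) ->
  (forall y, 0 <= y -> 0 <= g y) -> g 0 = 0 -> 0 <= p ->
  0 <= v -> (forall y, 0 <= y -> g v + p * (y - v) <= g y) ->
  (\int[mu]_(x in W) (w x)%:E = (M * v)%:E)%E ->
  ((M * g v)%:E <= \int[mu]_(x in W) (g (w x))%:E)%E.
Proof.
move=> mW muW mw mgw w0 g_ge0 g0 p0 v0 supp intw.
have c0 : 0 <= p * v - g v.
  by have := supp 0 (lexx _); rewrite g0 sub0r mulrN; lra.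
have : (\int[mu]_(x in W) (p%:E * (w x)%:E) <=
    \int[mu]_(x in W) ((g (w x))%:E + (p * v - g v)%:E))%E.
  apply: ge0_le_integral.
  - exact: mW.
  - by move=> x Wx; rewrite -EFinM lee_fin mulr_ge0// w0.
  - by apply/measurable_EFinP; apply: measurable_funM => //; exact: measurable_cst.
  - apply/measurable_EFinP; apply: measurable_funD => //; exact: measurable_cst.
  - move=> x Wx; rewrite -EFinM -EFinD lee_fin.
    by have := supp _ (w0 _ Wx); lra.
have -> : (\int[mu]_(x in W) (p%:E * (w x)%:E) = p%:E * \int[mu]_(x in W) (w x)%:E)%E.
  by apply: ge0_integralZl_EFin => //; exact/measurable_EFinP.
rewrite intw ge0_integralD//.
- rewrite integral_cst// => le1.
  have : ((p * (M * v))%:E <= \int[mu]_(x in W) (g (w x))%:E + ((p * v - g v) * M)%:E)%E.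
    apply: le_trans le1 _; rewrite leeD2l// EFinM lee_wpmul2l// lee_fin//.
  rewrite -leeBlDr// -EFinB; apply: le_trans; rewrite lee_fin le_eqVlt.
  by apply/orP; left; apply/eqP; ring.
- by move=> x Wx; rewrite lee_fin g_ge0// w0.
- exact/measurable_EFinP.
Qed.

End jensen.

(** * Integrals over the complement of a compact set *)

Section integral_off_compact.
Context {R : realType} {n : nat} (S : set 'rV[R]_n).
Hypothesis cS : compact S.
Local Notation T := (Rn R n).
Local Notation mun := (mes R n).

Lemma compact_closed_rV (W : set 'rV[R]_n) : compact W -> closed W.
Proof. by apply: compact_closed; exact: norm_hausdorff. Qed.

Lemma measurable_compact : measurable (S : set T).
Proof. by apply: closed_measurable_Rn; exact: compact_closed_rV. Qed.

Lemma measurable_nbd r : measurable (nbd S r : set T).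
Proof. exact/open_measurable_Rn/nbd_open. Qed.

Lemma notin_nbd x : ~ S x -> exists k : nat, ~ nbd S k.+1%:R^-1 x.
Proof.
move=> nSx; have oU : open (~` [set x]).
  by apply: closed_openC; apply: compact_closed_rV; exact: compact_set1.
have [|r r0 Sr] := compact_nbd_sub cS oU; first by move=> y Sy /= yx; apply: nSx; rewrite -yx.
have [k rk] : exists k : nat, k.+1%:R^-1 <= r.
  exists (Num.truncn r^-1); rewrite -[leRHS]invrK lef_pV2 ?posrE ?invr_gt0//.
  exact/ltW/truncnS_gt.
by exists k => /(nbd_le rk)/Sr; exact.
Qed.

Lemma setD_bigcup_nbd W : W `\` S = \bigcup_k (W `\` nbd S k.+1%:R^-1).
Proof.
apply/seteqP; split => [x [Wx /notin_nbd[k nk]]|x [k _ [Wx nk]]]; first by exists k.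
by split => // Sx; apply: nk; apply: sub_nbd Sx; rewrite invr_gt0.
Qed.

(** Monotone convergence: since [S] is closed, the complements of its neighbourhoods of radius
    [1 / (k + 1)] exhaust the complement of [S]. *)
Lemma integral_off_compact_le (W : set T) (v : T -> \bar R) (B : \bar R) e :
  measurable W -> measurable_fun (W `\` S : set T) v ->
  (forall x, W x -> ~ S x -> (0 <= v x)%E) -> 0 < e ->
  (forall r, 0 < r -> r < e -> (\int[mun]_(x in W `\` nbd S r) v x <= B)%E) ->
  (\int[mun]_(x in W `\` S) v x <= B)%E.
Proof.
move=> mW mv v0 e0 vB.
have inv0 k : 0 < k.+1%:R^-1 :> R by rewrite invr_gt0.
have sub k : W `\` nbd S k.+1%:R^-1 `<=` W `\` S.
  by move=> x [Wx nk]; split => // Sx; apply: nk; exact: sub_nbd Sx.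
have mk k : measurable (W `\` nbd S k.+1%:R^-1 : set T).
  by apply: measurableD => //; exact/open_measurable_Rn/nbd_open.
rewrite setD_bigcup_nbd.
have nd : nondecreasing_seq (fun k => W `\` nbd S k.+1%:R^-1 : set T).
  move=> i j ij; apply/subsetPset => x [Wx nk]; split => // xj; apply: nk.
  by apply: nbd_le xj; rewrite lef_pV2 ?posrE// ler_nat.
have H : (\int[mun]_(x in W `\` nbd S k.+1%:R^-1) v x @[k --> \oo] -->
    \int[mun]_(x in \bigcup_k (W `\` nbd S k.+1%:R^-1)) v x)%E.
  apply: ge0_nondecreasing_set_cvg_integral => //.
    move=> k; apply: measurable_funS mv; last exact: sub.
    by apply: measurableD => //; exact: measurable_compact.
  by move=> k x [Wx nk]; apply: v0 => // Sx; apply: nk; exact: sub_nbd Sx.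
have ek : exists N, N.+1%:R^-1 < e.
  exists (Num.truncn e^-1).+1; rewrite invf_plt ?posrE//.
  by apply: lt_trans (truncnS_gt _) _; rewrite ltr_nat.
have [N Ne] := ek.
rewrite -(cvg_lim _ H)//; apply: lime_le; first by apply/cvg_ex; eexists; exact: H.
near=> k; apply: vB => //; apply: le_lt_trans Ne; rewrite lef_pV2 ?posrE// ler_nat ltnS.
by near: k; exact: nbhs_infty_ge.
Unshelve. all: by end_near. Qed.

(** If every small neighbourhood carried more than [e], the whole integral [I] would satisfy
    [I <= I - e] by exhaustion. *)
Lemma integral_nbd_small (W : set T) (v : T -> \bar R) (e r0 : R) :
  measurable W -> measurable_fun (W `\` S : set T) v ->
  (forall x, W x -> ~ S x -> (0 <= v x)%E) ->
  (\int[mun]_(x in W `\` S) v x < +oo)%E ->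
  0 < e -> 0 < r0 -> nbd S r0 `<=` W ->
  exists r, [/\ 0 < r, r <= r0 &
    forall r', 0 < r' -> r' <= r -> (\int[mun]_(x in nbd S r' `\` S) v x <= e%:E)%E].
Proof.
move=> mW mv v0 vfin e0 r00 SW.
have mS : measurable (S : set T).
  exact: measurable_compact.
have mN r : measurable (nbd S r : set T) by exact/open_measurable_Rn/nbd_open.
have mono r r' : r' <= r -> r <= r0 -> (\int[mun]_(x in nbd S r' `\` S) v x <=
    \int[mun]_(x in nbd S r `\` S) v x)%E.
  move=> r'r rr0; have rW := subset_trans (nbd_le rr0) SW.
  apply: ge0_subset_integral.
  - exact: measurableD.
  - exact: measurableD.
  - by apply: measurable_funS mv; [exact: measurableD|move=> x [/rW]].
  - by move=> x [/rW Wx nSx]; exact: v0.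
  - by move=> x [/(nbd_le r'r)].
apply: contrapT => nex.
have big r : 0 < r -> r < r0 -> (e%:E < \int[mun]_(x in nbd S r `\` S) v x)%E.
  move=> r_gt0 rr0; rewrite ltNge; apply/negP => le_e; apply: nex.
  exists r; split => //; first exact: ltW.
  by move=> r' _ r'r; apply: le_trans (mono _ _ r'r (ltW rr0)) le_e.
set I := (\int[mun]_(x in W `\` S) v x)%E in vfin.
have I0 : (0 <= I)%E by apply: integral_ge0 => x [Wx nSx]; exact: v0.
have Ifin : I \is a fin_num by rewrite ge0_fin_numE.
have : (I <= I - e%:E)%E.
  apply: (@integral_off_compact_le W v _ r0) => // r r_gt0 rr0.
  have rW := subset_trans (nbd_le (ltW rr0)) SW.
  rewrite leeBrDr//; apply: (@le_trans _ _ (\int[mun]_(x in W `\` nbd S r) v x +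
    \int[mun]_(x in nbd S r `\` S) v x)%E).
    by rewrite leeD2l// ltW// big.
  have WE : (W `\` nbd S r) `|` (nbd S r `\` S) = W `\` S.
    apply/seteqP; split => [x [[Wx nr]|[xr nSx]]|x [Wx nSx]].
    - by split => // /(sub_nbd r_gt0).
    - by split => //; exact: rW.
    - by have [xr|nr] := pselect (nbd S r x); [right|left].
  rewrite -ge0_integral_setU//.
  - by rewrite WE.
  - exact: measurableD.
  - exact: measurableD.
  - by rewrite WE.
  - by rewrite WE => x [Wx nSx]; exact: v0.
  - by rewrite disj_set2E; apply/eqP/seteqP; split => // x [[_ nr] [xr _]].
rewrite leeBrDr// -[leRHS]adde0 leeD2lE// lee_fin leNgt e0//.
Qed.

End integral_off_compact.

(** * Estimates on weak solutions *)

Section weak_solution_estimates.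
Context {R : realType} {m n : nat}.
Hypothesis m_gt0 : (0 < m)%N.
Variables (Omega S : set 'rV[R]_n).
Hypothesis openO : open Omega.
Hypothesis cS : compact S.
Hypothesis SO : S `<=` Omega.
Variable a : multi_index n m -> 'rV[R]_n -> R -> R.
Hypothesis ha : forall alpha, caratheodory_function Omega (a alpha).
Variable A : R.
Hypothesis A_gt0 : 0 < A.
Hypothesis haA : forall alpha, {ae mes R n, forall x, Omega x ->
     forall z : R, `|a alpha x z| <= A * `|z|}.
Variable f : 'rV[R]_n -> R.
Hypothesis hf0 : forall x, Omega x -> 0 <= f x.
Variable g : R -> R.
Hypothesis hg_ge0 : forall z : R, 0 <= z -> 0 <= g z.
Variable u : 'rV[R]_n -> R.
Hypothesis uL1 : forall r : R, 0 < r -> L1 (Omega `\` nbd S r) u.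
Hypothesis hL1 : forall r : R, 0 < r -> L1 (Omega `\` nbd S r) (fun x => f x * g `|u x|).

Local Notation T := (Rn R n).
Local Notation mun := (mes R n).
Local Notation h := (fun x => f x * g `|u x|).

Lemma measurable_Omega : measurable (Omega : set T).
Proof. exact: open_measurable_Rn. Qed.

Let mO := measurable_Omega.
Let mS := measurable_compact cS.
Let mN := @measurable_nbd R n S.

Let mD : measurable (Omega `\` S : set T).
Proof. exact: measurableD. Qed.

Lemma measurable_off (v : 'rV[R]_n -> R) :
  (forall r, 0 < r -> L1 (Omega `\` nbd S r) v) ->
  measurable_fun (Omega `\` S : set T) (v : T -> R).
Proof.
move=> vL1; rewrite (setD_bigcup_nbd cS); apply/measurable_fun_bigcup => [k|k].
  exact: measurableD.
have k0 : (0 : R) < k.+1%:R^-1 by rewrite invr_gt0.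
by have /integrableP[/measurable_EFinP] := vL1 _ k0.
Qed.

Let mu_ : measurable_fun (Omega `\` S : set T) (u : T -> R).
Proof. exact: measurable_off. Qed.

Let mh_ : measurable_fun (Omega `\` S : set T) (h : T -> R).
Proof. exact: measurable_off. Qed.

Let h_ge0 x : Omega x -> 0 <= h x.
Proof. by move=> Ox; rewrite mulr_ge0 ?hf0// hg_ge0. Qed.

Lemma measurable_partial_multi (W : set T) alpha phi : measurable W -> smooth phi ->
  measurable_fun W (partial_multi (alpha : multi_index n m) phi : T -> R).
Proof.
move=> mW sphi; have [s _ E] := @partial_multiE R n m alpha.
rewrite E.
by apply: continuous_measurable_Rn => //; exact/smooth_continuous/smooth_pderiv.
Qed.

Lemma measurable_flux (v : 'rV[R]_n -> R) alpha phi (W : set T) :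
  measurable W -> W `<=` Omega -> measurable_fun W (v : T -> R) -> smooth phi ->
  measurable_fun W ((fun x => (-1) ^+ m * a alpha x (v x) * partial_multi alpha phi x) : T -> R).
Proof.
move=> mW WO mv sphi; apply: measurable_funM; last exact: measurable_partial_multi.
apply: measurable_funM; first exact: measurable_cst.
apply: (caratheodory_comp_measurable mW); last exact: mv; have [ma [N [mN_ N0 aN]]] := ha alpha.
split; first by move=> z; exact: measurable_funS (ma z).
exists N; split => // x /= ncx; apply: aN => cx; apply: ncx => Wx.
exact: cx (WO _ Wx).
Qed.

Lemma measurable_fun_zero (W : set T) (v : T -> R) : (forall x, W x -> v x = 0) ->
  measurable_fun W v.
Proof.
move=> v0; apply: (@eq_measurable_fun _ _ T R W (cst 0) v); last exact: measurable_cst.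
by move=> x; rewrite inE => /v0 ->.
Qed.

Lemma measurable_extend (v : T -> R) : measurable_fun (Omega `\` S : set T) v ->
  (forall x, S x -> v x = 0) -> measurable_fun (Omega : set T) v.
Proof.
move=> mv v0; have -> : (Omega : set T) = S `|` (Omega `\` S) by rewrite setDUK.
apply: (measurable_funU _ mS mD).2; split => //.
exact: measurable_fun_zero.
Qed.

Lemma ae_imply (P Q : T -> Prop) : {ae mun, forall x, P x} -> (forall x, P x -> Q x) ->
  {ae mun, forall x, Q x}.
Proof. by move=> aeP PQ; apply: (@filterS T (nbhs (almost_everywhere mun)) _ _ _ _ aeP). Qed.

Lemma ae_imply2 (P Q V : T -> Prop) : {ae mun, forall x, P x} -> {ae mun, forall x, Q x} ->
  (forall x, P x -> Q x -> V x) -> {ae mun, forall x, V x}.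
Proof.
by move=> aeP aeQ PQV; apply: (@filterS2 T (nbhs (almost_everywhere mun)) _ _ _ _ _ aeP aeQ).
Qed.

(** [S] may have positive measure, so passing from [Omega] to the complement of [S] requires an
    integrand that vanishes almost everywhere on [S]. *)
Lemma integral_extend (v : T -> \bar R) : measurable_fun (Omega : set T) v ->
  {ae mun, forall x, S x -> v x = 0%E} ->
  (\int[mun]_(x in Omega) v x = \int[mun]_(x in Omega `\` S) v x)%E.
Proof.
move=> mv v0; have OE : (Omega : set T) = S `|` (Omega `\` S) by rewrite setDUK.
rewrite [X in integral _ X _ = _]OE integral_setU.
- rewrite (@ae_eq_integral _ _ _ mun S (cst 0%E) v).
  + by rewrite integral0 add0e.
  + exact: mS.
  + by apply: measurable_funS mv.
  + exact: measurable_cst.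
  + exact: v0.
- exact: mS.
- exact: mD.
- by rewrite -OE.
- by rewrite disj_set2E setDIK.
Qed.

(** A single null set serves all values [z], all functions [phi] and all multi-indices, because the
    latter are finitely many. *)
Lemma flux_bound : {ae mun, forall x, Omega x -> forall (z : R) phi,
  `|\sum_alpha (-1) ^+ m * a alpha x z * partial_multi alpha phi x| <=
  \sum_(alpha : multi_index n m) A * `|z| * `|partial_multi alpha phi x|}.
Proof.
have haA' (e : seq (multi_index n m)) : {ae mun, forall x, forall alpha, alpha \in e ->
    Omega x -> forall z : R, `|a alpha x z| <= A * `|z|}.
  elim: e => [|al e IH]; first exact: nearW.
  apply: (ae_imply2 (haA al) IH) => x aal IH' alpha.
  by rewrite inE => /predU1P[->//|]; exact: IH'.
apply: (ae_imply (haA' (enum {: multi_index n m}))) => x ax Ox z phi.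
apply: (le_trans (ler_norm_sum _ _ _)); apply: ler_sum => alpha _.
by rewrite !normrM normrX normrN normr1 expr1n mul1r ler_wpM2r// ax// mem_enum.
Qed.

Lemma measurable_norm_comp (W : set T) (v : T -> R) : measurable_fun W v ->
  measurable_fun W ((fun x => `|v x|) : T -> R).
Proof. by move=> mv; apply: (@measurableT_comp _ _ _ _ _ _ (fun y : R => `|y|)). Qed.

Lemma measurable_abs_u (W : set T) : W `<=` Omega `\` S ->
  measurable_fun W ((fun x => `|u x|) : T -> R).
Proof. by move=> WD; apply: measurable_norm_comp; exact: measurable_funS mu_. Qed.

Lemma measurable_flux_bound phi : smooth phi ->
  measurable_fun (Omega `\` S : set T)
    ((fun x => \sum_(alpha : multi_index n m) A * `|u x| * `|partial_multi alpha phi x|) : T -> R).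
Proof.
move=> sphi; apply: measurable_sum => alpha; apply: measurable_funM.
  apply: measurable_funM; first exact: measurable_cst.
  exact: measurable_abs_u.
by apply: measurable_norm_comp; exact: measurable_partial_multi.
Qed.

Definition flux (v : 'rV[R]_n -> R) phi (x : T) : R :=
  \sum_(alpha : multi_index n m) (-1) ^+ m * a alpha x (v x) * partial_multi alpha phi x.

Lemma measurable_flux_sum v phi (W : set T) : measurable W -> W `<=` Omega ->
  measurable_fun W (v : T -> R) -> smooth phi -> measurable_fun W (flux v phi).
Proof. by move=> mW WO mv sphi; apply: measurable_sum => alpha; exact: measurable_flux. Qed.

Lemma flux_abs_le phi : smooth phi ->
  (\int[mun]_(x in Omega `\` S) `|(flux u phi x)%:E| <=
   \int[mun]_(x in Omega `\` S)
     (\sum_(alpha : multi_index n m) A * `|u x| * `|partial_multi alpha phi x|)%:E)%E.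
Proof.
move=> sphi; apply: ae_ge0_le_integral.
- exact: mD.
- by move=> x _; exact: abse_ge0.
- apply: (@measurableT_comp _ _ _ _ _ _ (@abse R)); first exact: abse_measurable.
  by apply/measurable_EFinP; apply: measurable_flux_sum => // x [].
- move=> x _; rewrite lee_fin sumr_ge0// => alpha _.
  by rewrite !mulr_ge0 ?(ltW A_gt0).
- exact/measurable_EFinP/measurable_flux_bound.
- apply: (ae_imply flux_bound) => x fx [Ox _].
  by rewrite lee_fin fx.
Qed.

(** The closed support of [phi] avoids [S], so both integrands vanish there, whatever [u] is on
    [S]. *)
Lemma weak_off phi : weak_inequality Omega a f g (Omega `\` S) u ->
  test_function (Omega `\` S) phi -> (forall x, 0 <= phi x) ->
  (\int[mun]_(x in Omega `\` S) (h x * phi x)%:E <=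
   \int[mun]_(x in Omega `\` S) (flux u phi x)%:E)%E.
Proof.
move=> weak tphi phi0; have := weak _ tphi phi0.
have [sphi _ supp] := tphi.
have out (alpha : multi_index n m) x : S x -> partial_multi alpha phi x = 0.
  move=> Sx; have [s _ E] := @partial_multiE R n m alpha; rewrite E.
  by apply: pderiv_out => /supp[].
have phiS x : S x -> phi x = 0 by move=> Sx; apply: (@pderiv_out _ _ phi [::]) => /supp[].
have FS x : S x -> flux u phi x = 0.
  by move=> Sx; rewrite /flux big1// => alpha _; rewrite out ?mulr0.
rewrite -/(flux u phi _) (@integral_extend (fun x => (h x * phi x)%:E)).
- rewrite (@integral_extend (fun x => (flux u phi x)%:E))//.
    by apply/measurable_EFinP/measurable_extend => //; apply: measurable_flux_sum => // x [].
  by apply: nearW => x /FS ->.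
- apply/measurable_EFinP/measurable_extend; last by move=> x /phiS ->; rewrite mulr0.
  apply: measurable_funM; first exact: mh_.
  by apply: continuous_measurable_Rn => //; exact: smooth_continuous.
- by apply: nearW => x /phiS ->; rewrite mulr0.
Qed.

Lemma weak_bound phi : weak_inequality Omega a f g (Omega `\` S) u ->
  test_function (Omega `\` S) phi -> (forall x, 0 <= phi x) ->
  (\int[mun]_(x in Omega `\` S) (h x * phi x)%:E <=
   \int[mun]_(x in Omega `\` S)
     (\sum_(alpha : multi_index n m) A * `|u x| * `|partial_multi alpha phi x|)%:E)%E.
Proof.
move=> weak tphi phi0; apply: le_trans (weak_off weak tphi phi0) _.
have [sphi _ _] := tphi; apply: le_trans (flux_abs_le sphi).
apply: le_trans (lee_abs _) _; apply: le_abse_integral; first exact: mD.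
by apply/measurable_EFinP; apply: measurable_flux_sum => // x [].
Qed.

Local Notation Uint W := (\int[mun]_(x in W) (`|u x|)%:E)%E.
Local Notation Hint W := (\int[mun]_(x in W) (f x * g `|u x|)%:E)%E.

Lemma L1_abs_fin (W : set T) (v : T -> R) : L1 W v ->
  (\int[mun]_(x in W) (`|v x|)%:E < +oo)%E.
Proof. by move=> /integrableP[_]. Qed.

Lemma pderiv_locally_cst s phi c (W : set 'rV[R]_n) : s != [::] -> open W ->
  (forall x, W x -> phi x = c) -> forall x, W x -> pderiv s phi x = 0.
Proof.
by move=> s0 oW phic x Wx; rewrite (@eq_open_pderiv _ _ s phi (cst c) W)// pderiv_cst.
Qed.

Lemma integral_patch_add (W P1 P2 : set T) (v1 v2 : T -> \bar R) :
  measurable W -> measurable P1 -> measurable P2 ->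
  measurable_fun W v1 -> measurable_fun W v2 ->
  (forall x, W x -> (0 <= v1 x)%E) -> (forall x, W x -> (0 <= v2 x)%E) ->
  (\int[mun]_(x in W) ((v1 \_ P1) x + (v2 \_ P2) x) =
   \int[mun]_(x in W `&` P1) v1 x + \int[mun]_(x in W `&` P2) v2 x)%E.
Proof.
move=> mW mP1 mP2 mv1 mv2 v1_ge0 v2_ge0.
have mpatch (v : T -> \bar R) P : measurable P -> measurable_fun W v -> measurable_fun W (v \_ P).
  move=> mP mv; apply/(measurable_restrict _ mP mW).1.
  by apply: measurable_funS mv => // x [].
have patch_ge0 (v : T -> \bar R) P : (forall x, W x -> (0 <= v x)%E) ->
    forall x, W x -> (0 <= (v \_ P) x)%E.
  by move=> v0 x Wx; rewrite patchE; case: ifP => // _; exact: v0.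
rewrite ge0_integralD//; [|exact: patch_ge0|exact: mpatch|exact: patch_ge0|exact: mpatch].
by rewrite -!integral_mkcondr.
Qed.

Lemma Uint_scale (W : set T) (c : R) : measurable W -> W `<=` Omega `\` S -> 0 <= c ->
  (\int[mun]_(x in W) (c%:E * (`|u x|)%:E) = c%:E * Uint W)%E.
Proof.
move=> mW WD c0; apply: ge0_integralZl_EFin; [exact: mW| |exact/measurable_EFinP/measurable_abs_u|exact: c0].
by move=> x _; rewrite lee_fin.
Qed.

(** The test function is a difference of two cutoffs. The outer one is fixed and its derivatives
    produce [C0]; the inner one varies, and its derivatives live on the layer of width [r2 - r1]. *)
Lemma annulus_estimate : weak_inequality Omega a f g (Omega `\` S) u ->
  exists R1 C0 C1, [/\ 0 < R1, 0 <= C0, 0 < C1, nbd S R1 `<=` Omega &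
    forall r1 r2, 0 < r1 -> r1 < r2 -> r2 <= R1 ->
    (Hint (nbd S R1 `\` nbd S r2) <=
     C0%:E + (C1 * (r2 - r1)^-1 ^+ m)%:E * Uint (nbd S r2 `\` nbd S r1))%E].
Proof.
move=> weak.
have [r0 r0_gt0 Sr0] := compact_nbd_sub cS openO SO.
have [C C_gt0 cutoff] := @exists_cutoff R n m.
(* The outer cutoff lives in [nbd S (2 * R1)], whose closure has to stay inside [nbd S r0]. *)
pose R1 := r0 / 4; have R1_gt0 : 0 < R1 by rewrite divr_gt0.
have R1O : nbd S R1 `<=` Omega.
  by apply: subset_trans Sr0; apply: nbd_le; rewrite /R1; lra.
pose N := #|{: multi_index n m}|.
(* Growth constant times number of multi-indices times cutoff constant; [N.+1] makes positivity
   immediate. *)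
pose C1 := A * N.+1%:R * C.
have C1_gt0 : 0 < C1 by rewrite !mulr_gt0.
pose C0 := fine ((C1 * R1^-1 ^+ m)%:E * Uint (Omega `\` nbd S R1))%E.
have U1_ge0 : (0 <= Uint (Omega `\` nbd S R1))%E by exact: integral_ge0.
have K_ge0 : 0 <= C1 * R1^-1 ^+ m by rewrite mulr_ge0 ?(ltW C1_gt0)// exprn_ge0// invr_ge0 ltW.
have C0E : C0%:E = ((C1 * R1^-1 ^+ m)%:E * Uint (Omega `\` nbd S R1))%E.
  rewrite /C0 fineK// fin_numM// ge0_fin_numE//; exact: L1_abs_fin (uL1 R1_gt0).
exists R1, C0, C1; split => //.
  by rewrite fine_ge0// mule_ge0.
move=> r1 r2 r1_gt0 r12 r2R1.
have r2_gt0 := lt_trans r1_gt0 r12.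
have R12 : R1 < 2 * R1 by lra.
have [chib [schib chib01 chib1 dchib0 dchib]] := cutoff S _ _ cS R12.
have [chis [schis chis01 chis1 dchis0 dchis]] := cutoff S _ _ cS r12.
have N12 := @nbd_le _ _ S _ _ (ltW r12).
have N2R := @nbd_le _ _ S _ _ r2R1.
have NR2 := @nbd_le _ _ S _ _ (ltW R12).
pose phi : 'rV[R]_n -> R := chib \+ (\- chis).
have sphi : smooth phi by exact: smoothD schib (smoothN schis).
have chis0 x : ~ nbd S r2 x -> chis x = 0 by exact: (dchis0 [::]).
have chib0 x : ~ nbd S (2 * R1) x -> chib x = 0 by exact: (dchib0 [::]).
have phi_ge0 x : 0 <= phi x.
  rewrite /phi /= subr_ge0; have [xr2|/chis0 ->] := pselect (nbd S r2 x).
    by rewrite (chib1 _ (N2R _ xr2)); have /andP[] := chis01 x.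
  by have /andP[] := chib01 x.
have tphi : test_function (Omega `\` S) phi.
  apply: (@test_function_nbd _ _ _ S (2 * R1)) => //.
    move=> x /= phix; apply: contrapT => nx; move: phix; rewrite /phi /= chib0// chis0 ?subrr ?eqxx//.
    by move=> /N2R/NR2.
  move=> x cx; split.
    apply: Sr0; apply: (@closure_nbd _ _ _ (2 * R1)); first by rewrite /R1; lra.
    apply: closureS cx => y /= phiy; apply: contrapT => ny; move: phiy; rewrite /phi /= chib0// chis0 ?subrr ?eqxx//.
    by move=> /N2R/NR2.
  move=> /(sub_nbd r1_gt0) xr1.
  have [y [/= phiy yr1]] := cx _ (open_nbhs_nbhs (conj (@nbd_open R n S r1) xr1)).
  by move: phiy; rewrite /phi /= chib1 ?chis1 ?subrr ?eqxx//; exact/N2R/N12.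
(* As [m > 0], derivatives of order [m] vanish wherever a cutoff is locally constant, which leaves
   only the inner layer and the region off [nbd S R1]. *)
have dphi s x : size s = m -> `|pderiv s phi x| <=
    C * R1^-1 ^+ m * \1_(~` nbd S R1) x +
    C * (r2 - r1)^-1 ^+ m * \1_(nbd S r2 `\` nbd S r1) x.
  move=> sm; have s0 : s != [::] by rewrite -size_eq0 sm -lt0n.
  have i1 : 0 <= C * R1^-1 ^+ m by rewrite mulr_ge0 ?(ltW C_gt0)// exprn_ge0// invr_ge0 ltW.
  have i2 : 0 <= C * (r2 - r1)^-1 ^+ m.
    by rewrite mulr_ge0 ?(ltW C_gt0)// exprn_ge0// invr_ge0 subr_ge0 ltW.
  rewrite (pderivD _ schib (smoothN schis)) (pderivN _ schis)/=; have [xR1|nxR1] := pselect (nbd S R1 x); last first.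
    rewrite (dchis0 s x) ?subr0; last by move=> /N2R.
    apply: (@le_trans _ _ (C * R1^-1 ^+ m)).
      by have := dchib s x; rewrite sm leqnn => /(_ isT); rewrite (_ : 2 * R1 - R1 = R1)//; lra.
    by rewrite (indicE _ (~` nbd S R1)) mem_set// mulr1 lerDl mulr_ge0.
  rewrite (pderiv_locally_cst s0 (@nbd_open R n S R1) chib1 xR1) sub0r normrN.
  have [xr2|/(dchis0 s) ->] := pselect (nbd S r2 x); last first.
    by rewrite normr0 addr_ge0// mulr_ge0.
  have [xr1|nxr1] := pselect (nbd S r1 x).
    rewrite (pderiv_locally_cst s0 (@nbd_open R n S r1) chis1 xr1) normr0.
    by rewrite addr_ge0// mulr_ge0.
  have := dchis s x; rewrite sm leqnn => /(_ isT) /le_trans; apply.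
  by rewrite [in leRHS](indicE _ (nbd S r2 `\` _)) mem_set// mulr1 lerDr mulr_ge0.
have lhs : (Hint (nbd S R1 `\` nbd S r2) <=
    \int[mun]_(x in Omega `\` S) (f x * g `|u x| * phi x)%:E)%E.
  apply: (@le_trans _ _ (\int[mun]_(x in nbd S R1 `\` nbd S r2) (f x * g `|u x| * phi x)%:E)%E).
    rewrite le_eqVlt; apply/orP; left; apply/eqP; apply: eq_integral => x; rewrite inE => -[xR1 nxr2].
    by rewrite /phi /= chib1// chis0// subr0 mulr1.
  apply: ge0_subset_integral.
  - exact: measurableD.
  - exact: mD.
  - apply/measurable_EFinP; apply: measurable_funM; first exact: mh_.
    by apply: continuous_measurable_Rn => //; exact: smooth_continuous.
  - by move=> x [Ox _]; rewrite lee_fin mulr_ge0 ?h_ge0.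
  - by move=> x [xR1 nxr2]; split; [exact: R1O|move=> /(sub_nbd r2_gt0)].
apply: le_trans lhs _; apply: le_trans (weak_bound weak tphi phi_ge0) _.
pose v1 (x : T) := ((C1 * R1^-1 ^+ m)%:E * (`|u x|)%:E)%E.
pose v2 (x : T) := ((C1 * (r2 - r1)^-1 ^+ m)%:E * (`|u x|)%:E)%E.
have K2_ge0 : 0 <= C1 * (r2 - r1)^-1 ^+ m.
  by rewrite mulr_ge0 ?(ltW C1_gt0)// exprn_ge0// invr_ge0 subr_ge0 ltW.
have mabs (W : set T) : measurable W -> W `<=` Omega `\` S ->
    measurable_fun W (fun x => (`|u x|)%:E).
  by move=> mW WD; exact/measurable_EFinP/measurable_abs_u.
have mv1 : measurable_fun (Omega `\` S : set T) v1.
  by apply: emeasurable_funM; [exact: measurable_cst|exact: mabs].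
have mv2 : measurable_fun (Omega `\` S : set T) v2.
  by apply: emeasurable_funM; [exact: measurable_cst|exact: mabs].
have v1_ge0 x : (0 <= v1 x)%E by rewrite mule_ge0.
have v2_ge0 x : (0 <= v2 x)%E by rewrite mule_ge0.
have mP2 : measurable (nbd S r2 `\` nbd S r1 : set T) by exact: measurableD.
have mP1 : measurable (~` nbd S R1 : set T) by exact: measurableC.
apply: (@le_trans _ _ (\int[mun]_(x in Omega `\` S)
    ((v1 \_ (~` nbd S R1)) x + (v2 \_ (nbd S r2 `\` nbd S r1)) x))%E).
  apply: ge0_le_integral.
  - exact: mD.
  - move=> x _; rewrite lee_fin sumr_ge0// => alpha _.
    by rewrite !mulr_ge0 ?(ltW A_gt0).
  - exact/measurable_EFinP/measurable_flux_bound.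
  - apply: emeasurable_funD.
      by apply/(measurable_restrict _ mP1 mD).1; apply: measurable_funS mv1 => // x [].
    by apply/(measurable_restrict _ mP2 mD).1; apply: measurable_funS mv2 => // x [].
  - move=> x [Ox nSx].
    have bound : \sum_(alpha : multi_index n m) A * `|u x| * `|partial_multi alpha phi x| <=
        C1 * R1^-1 ^+ m * `|u x| * \1_(~` nbd S R1) x +
        C1 * (r2 - r1)^-1 ^+ m * `|u x| * \1_(nbd S r2 `\` nbd S r1) x.
      pose q := C * R1^-1 ^+ m * \1_(~` nbd S R1) x +
        C * (r2 - r1)^-1 ^+ m * \1_(nbd S r2 `\` nbd S r1) x.
      apply: (@le_trans _ _ (\sum_(alpha : multi_index n m) A * `|u x| * q)).
        apply: ler_sum => alpha _; rewrite ler_wpM2l ?mulr_ge0 ?(ltW A_gt0)//.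
        by have [s sm E] := @partial_multiE R n m alpha; rewrite E dphi.
      rewrite sumr_const -/N -mulr_natr.
      have q0 : 0 <= q.
        by rewrite addr_ge0// mulr_ge0// mulr_ge0 ?(ltW C_gt0)// exprn_ge0// invr_ge0 ?subr_ge0 ltW.
      apply: (@le_trans _ _ (A * `|u x| * q * N.+1%:R)).
        by rewrite ler_wpM2l ?mulr_ge0 ?(ltW A_gt0)// ler_nat.
      rewrite /q /C1 le_eqVlt; apply/orP; left; apply/eqP; ring.
    apply: (@le_trans _ _ (C1 * R1^-1 ^+ m * `|u x| * \1_(~` nbd S R1) x +
        C1 * (r2 - r1)^-1 ^+ m * `|u x| * \1_(nbd S r2 `\` nbd S r1) x)%:E).
      by rewrite lee_fin.
    rewrite EFinD !patchE !indicE; apply: leeD.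
      by case: ifP => _; rewrite ?mulr1 ?mulr0// /v1 -EFinM.
    by case: ifP => _; rewrite ?mulr1 ?mulr0// /v2 -EFinM.
rewrite integral_patch_add//.
have -> : (Omega `\` S) `&` ~` nbd S R1 = Omega `\` nbd S R1.
  apply/seteqP; split => [x [[Ox _] nx]|x [Ox nx]]; split => //; split => //.
  by move=> /(sub_nbd R1_gt0).
have -> : (Omega `\` S) `&` (nbd S r2 `\` nbd S r1) = nbd S r2 `\` nbd S r1.
  apply/seteqP; split => [x [_ ]//|x [xr2 nx]]; split => //; split; first exact/R1O/N2R.
  by move=> /(sub_nbd r1_gt0).
have mP : measurable (Omega `\` nbd S R1 : set T) by exact: measurableD.
rewrite (@Uint_scale (Omega `\` nbd S R1))//.
- rewrite (@Uint_scale (nbd S r2 `\` nbd S r1))// -?C0E//.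
  by move=> x [xr2 nx]; split; [exact/R1O/N2R|move=> /(sub_nbd r1_gt0)].
- by move=> x [Ox nx]; split => // /(sub_nbd R1_gt0).
Qed.

Lemma test_functionM phi psi : test_function Omega phi -> smooth psi ->
  test_function Omega (phi \* psi).
Proof.
move=> [sphi cphi phiO] spsi.
have sub : closure [set x | (phi \* psi) x != 0] `<=` closure [set x | phi x != 0].
  by apply: closureS => x /=; rewrite mulf_eq0 negb_or => /andP[].
split; first exact: smoothM.
- by apply: subclosed_compact cphi sub; exact: closed_closure.
- exact: subset_trans phiO.
Qed.

Lemma flux_abs_le_on phi K (Q : set 'rV[R]_n) : measurable (Q : set T) -> smooth phi -> 0 <= K ->
  (forall s x, size s = m -> `|pderiv s phi x| <= K * \1_Q x) ->
  (\int[mun]_(x in Omega `\` S) `|(flux u phi x)%:E| <=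
   (A * #|{: multi_index n m}|%:R * K)%:E * Uint ((Omega `\` S) `&` Q))%E.
Proof.
move=> mQ sphi K0 phiK; set N := #|_|; set c := A * N%:R * K.
have c0 : 0 <= c by rewrite !mulr_ge0 ?(ltW A_gt0).
apply: le_trans (flux_abs_le sphi) _; rewrite -Uint_scale; last 3 first.
- exact: measurableI.
- by move=> x [].
- exact: c0.
have mv : measurable_fun (Omega `\` S : set T) (fun x => (c%:E * (`|u x|)%:E)%E).
  by apply: emeasurable_funM; [exact: measurable_cst|exact/measurable_EFinP/measurable_abs_u].
rewrite [leRHS]integral_mkcondr; apply: ge0_le_integral.
- exact: mD.
- move=> x _; rewrite lee_fin sumr_ge0// => alpha _.
  by rewrite !mulr_ge0 ?(ltW A_gt0).
- exact/measurable_EFinP/measurable_flux_bound.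
- apply/(measurable_restrict _ mQ mD).1; by apply: measurable_funS mv.
- move=> x _; apply: (@le_trans _ _ (c * `|u x| * \1_Q x)%:E).
    rewrite lee_fin; apply: (@le_trans _ _ (\sum_(alpha : multi_index n m) A * `|u x| * (K * \1_Q x))).
      apply: ler_sum => alpha _; rewrite ler_wpM2l ?mulr_ge0 ?(ltW A_gt0)//.
      by have [s sm E] := @partial_multiE R n m alpha; rewrite E phiK.
    rewrite sumr_const -/N -mulr_natr /c le_eqVlt; apply/orP; left; apply/eqP; ring.
  by rewrite patchE indicE; case: ifP => _; rewrite ?mulr1 ?mulr0// EFinM.
Qed.

(** A test function splits as [phi (1 - chi) + phi chi]. The first part vanishes near [S] and is
    admissible there. For the second, the source term is at most a bound of [phi] times the source
    mass near [S], and the flux is at most a constant times [r^-m] times the mass of [|u|]; both are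
    of order [eta]. *)
Lemma removable_of_decay : weak_inequality Omega a f g (Omega `\` S) u ->
  g 0 = 0 -> L1 (Omega `\` S) u -> L1 (Omega `\` S) h ->
  (forall eta e, 0 < eta -> 0 < e -> exists r, [/\ 0 < r, r < e,
     (Uint (nbd S r `\` S) <= (eta * r ^+ m)%:E)%E & (Hint (nbd S r `\` S) <= eta%:E)%E]) ->
  removable Omega S a f g u.
Proof.
move=> weak g0 uint hint decay; rewrite /removable; set u0 := u \_ (~` S).
have u0S x : S x -> u0 x = 0 by move=> Sx; rewrite /u0 patchE memNset.
have u0D x : ~ S x -> u0 x = u x by move=> Sx; rewrite /u0 patchE mem_set.
have L1_ext (v w : 'rV[R]_n -> R) : L1 (Omega `\` S) v -> (forall x, S x -> w x = 0) ->
    (forall x, ~ S x -> w x = v x) -> L1 Omega w.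
  move=> /integrableP[/measurable_EFinP mv vfin] w0 wv.
  have mw : measurable_fun (Omega : set T) (w : T -> R).
    apply: measurable_extend w0; apply: (@eq_measurable_fun _ _ T R _ (v : T -> R)); last exact: mv.
    by move=> x; rewrite inE => -[_ /wv].
  apply/integrableP; split; first exact/measurable_EFinP.
  rewrite integral_extend.
  - apply: le_lt_trans vfin; rewrite le_eqVlt; apply/orP; left; apply/eqP.
    by apply: eq_integral => x; rewrite inE => -[_ /wv /= ->].
  - by apply: measurableT_comp => //; exact/measurable_EFinP.
  - by apply: nearW => x /w0 /= ->; rewrite normr0.
have u0L1 : L1 Omega u0 by exact: L1_ext u0D.
split => //.
  apply: L1_ext hint _ _ => [x /u0S ->|x /u0D -> //].
  by rewrite normr0 g0 mulr0.
move=> phi tphi phi0; have [sphi _ suppphi] := tphi.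
have mu0 : measurable_fun (Omega : set T) (u0 : T -> R).
  by have /integrableP[/measurable_EFinP] := u0L1.
have [B B0 phiB] := test_function_bounded m tphi.
have phileB x : `|phi x| <= B by exact: (phiB [::] x).
have mphi (W : set T) : measurable W -> measurable_fun W (phi : T -> R).
  by move=> mW; apply: continuous_measurable_Rn => //; exact: smooth_continuous.
rewrite -/(flux u0 phi _) (@integral_extend (fun x => (f x * g `|u0 x| * phi x)%:E)); last 2 first.
- apply/measurable_EFinP/measurable_extend; last by move=> x /u0S ->; rewrite normr0 g0 mulr0 mul0r.
  apply: (@eq_measurable_fun _ _ T R _ (fun x : T => h x * phi x)).
    by move=> x; rewrite inE => -[_ /u0D ->].
  by apply: measurable_funM; [exact: mh_|exact: mphi].
- by apply: nearW => x /u0S ->; rewrite normr0 g0 mulr0 mul0r.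
rewrite (@integral_extend (fun x => (flux u0 phi x)%:E)); last 2 first.
- by apply/measurable_EFinP; exact: measurable_flux_sum.
(* On [S] the extended function is 0, and the growth bound gives [a alpha x 0 = 0] almost
   everywhere. *)
- apply: (ae_imply flux_bound) => x fx Sx; congr EFin; apply/eqP; rewrite -normr_le0.
  apply: le_trans (fx (SO Sx) _ _) _; rewrite u0S// normr0 big1// => alpha _.
  by rewrite mulr0 mul0r.
rewrite (@eq_integral _ _ _ mun _ (fun x => (h x * phi x)%:E)); last first.
  by move=> x; rewrite inE => -[_ /u0D ->].
rewrite [leRHS](@eq_integral _ _ _ mun _ (fun x => (flux u phi x)%:E)); last first.
  by move=> x; rewrite inE => -[_ /u0D E]; rewrite /flux E.
have flux_int psi : test_function Omega psi -> mun.-integrable (Omega `\` S) (fun x => (flux u psi x)%:E).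
  move=> tpsi; have [spsi _ _] := tpsi; have [K K0 psiK] := test_function_bounded m tpsi.
  apply/integrableP; split; first by apply/measurable_EFinP; apply: measurable_flux_sum => // x [].
  apply: (@le_lt_trans _ _ ((A * #|{: multi_index n m}|%:R * K)%:E * Uint ((Omega `\` S) `&` setT))%E).
    by apply: flux_abs_le_on => // s x sm; rewrite indicT mulr1 psiK// sm.
  have /integrableP[_ ufin] := uint; rewrite setIT lte_mul_pinfty// lee_fin !mulr_ge0 ?(ltW A_gt0)//.
have [r0 r0_gt0 Sr0] := compact_nbd_sub cS openO SO.
have [C C_gt0 cutoff] := @exists_cutoff R n m.
(* The first term controls the flux of [phi2], the last one its source. One factor [2 ^+ m] comes
   from Leibniz' rule, the other from the cutoff width [r / 2]. *)
pose K1 := A * #|{: multi_index n m}|%:R * (2 ^+ m * (B * C) * 2 ^+ m) + B.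
have K10 : 0 <= K1.
  by rewrite addr_ge0// !mulr_ge0 ?(ltW A_gt0) ?(ltW C_gt0)// exprn_ge0.
apply/lee_addgt0Pr => e e0.
pose eta := e / (K1 + 1).
have eta0 : 0 < eta by rewrite divr_gt0// ltr_wpDl.
(* [r < r0] keeps the cutoff inside [Omega]. [r < 1] makes the scale [q = 2 / r] at least 1, so that
   the bound [B] on [phi] is also a bound at scale [q]. *)
have e1 : 0 < Num.min r0 1 by rewrite lt_min r0_gt0/=.
have [r [r_gt0]] := decay eta _ eta0 e1.
rewrite lt_min => /andP[rr0 r1] Ur Hr.
have r2r : r / 2 < r by lra.
have [chi [schi chi01 chi1 dchi0 dchi]] := cutoff S _ _ cS r2r.
pose phi1 : 'rV[R]_n -> R := phi \* (cst 1 \+ (\- chi)).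
pose phi2 : 'rV[R]_n -> R := phi \* chi.
have schi' : smooth (cst 1 \+ (\- chi)) by apply: smoothD; [exact: smooth_cst|exact: smoothN].
have tphi1 : test_function Omega phi1 by exact: test_functionM.
have tphi2 : test_function Omega phi2 by exact: test_functionM.
have [sphi1 cphi1 suppphi1] := tphi1; have [sphi2 _ _] := tphi2.
have r20 : 0 < r / 2 by rewrite divr_gt0.
have tphi1S : test_function (Omega `\` S) phi1.
  split => // x cx; split; first exact: suppphi1.
  move=> /(sub_nbd r20) xr; have [y [/= + yr]] := cx _ (open_nbhs_nbhs (conj (@nbd_open R n S _) xr)).
  by rewrite /phi1 /= chi1// subrr mulr0 eqxx.
have phi1_ge0 x : 0 <= phi1 x.
  by rewrite mulr_ge0//= subr_ge0; have /andP[] := chi01 x.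
have phi2_ge0 x : 0 <= phi2 x by rewrite mulr_ge0//; have /andP[] := chi01 x.
have phiE : phi = phi1 \+ phi2 by apply/funext => x; rewrite /phi1 /phi2 /=; ring.
have chi_out x : ~ nbd S r x -> chi x = 0 by exact: (dchi0 [::]).
have SrE : (Omega `\` S) `&` nbd S r = nbd S r `\` S.
  apply/seteqP; split => [x [[_ nSx] xr]//|x [xr nSx]]; split => //; split => //.
  by apply: Sr0; apply: nbd_le xr; exact: ltW.
pose q := (r - r / 2)^-1.
have qE : q = 2 / r by rewrite /q (_ : r - r / 2 = r / 2) ?invf_div//; lra.
have q1 : 1 <= q by rewrite qE ler_pdivlMr// mul1r; lra.
have phi2B s x : size s = m -> `|pderiv s phi2 x| <= 2 ^+ m * (B * C) * q ^+ m * \1_(nbd S r) x.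
  have b1 : pderiv_bound m phi (cst B) q.
    move=> s' y sm; apply: le_trans (phiB _ _ sm) _.
    by rewrite ler_peMr// exprn_ege1.
  have b2 : pderiv_bound m chi (fun x => C * \1_(nbd S r) x) q.
    move=> s' y sm; have [yr|nyr] := pselect (nbd S r y); last first.
      by rewrite dchi0// normr0 !mulr_ge0 ?(ltW C_gt0)// exprn_ge0// (le_trans ler01).
    by rewrite indicE mem_set// mulr1 dchi.
  move=> sm; have := pderiv_boundM (le_trans ler01 q1) sphi schi b1 b2 (s := s) x.
  rewrite sm leqnn => /(_ isT) /le_trans; apply.
  by rewrite le_eqVlt; apply/orP; left; apply/eqP; rewrite /=; ring.
set D : set T := Omega `\` S.
have F2le : (\int[mun]_(x in D) `|(flux u phi2 x)%:E| <=
    (A * #|{: multi_index n m}|%:R * (2 ^+ m * (B * C) * 2 ^+ m) * eta)%:E)%E.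
  have K20 : 0 <= 2 ^+ m * (B * C) * q ^+ m.
    by rewrite !mulr_ge0 ?(ltW C_gt0) ?exprn_ge0// (le_trans ler01).
  apply: le_trans (flux_abs_le_on (mN r) sphi2 K20 phi2B) _.
  rewrite SrE; apply: (@le_trans _ _ ((A * #|{: multi_index n m}|%:R * (2 ^+ m * (B * C) * q ^+ m))%:E *
      (eta * r ^+ m)%:E)%E).
    by apply: lee_wpmul2l => //; rewrite lee_fin !mulr_ge0 ?(ltW A_gt0) ?(ltW C_gt0) ?exprn_ge0// (le_trans ler01).
  have rm : q ^+ m * r ^+ m = 2 ^+ m by rewrite qE -exprMn divfK// gt_eqF.
  rewrite -EFinM lee_fin -rm le_eqVlt; apply/orP; left; apply/eqP; ring.
have mhphi psi : smooth psi -> measurable_fun D (fun x => (h x * psi x)%:E).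
  move=> spsi; apply/measurable_EFinP; apply: measurable_funM; first exact: mh_.
  by apply: continuous_measurable_Rn => //; exact: smooth_continuous.
have h2le : (\int[mun]_(x in D) (h x * phi2 x)%:E <= (B * eta)%:E)%E.
  apply: (@le_trans _ _ (B%:E * Hint (nbd S r `\` S))%E); last first.
    by rewrite EFinM; apply: lee_wpmul2l.
  have mhr : measurable_fun (nbd S r `\` S : set T) (fun x => (h x)%:E).
    by apply/measurable_EFinP; apply: measurable_funS mh_; rewrite // -SrE => x [].
  rewrite -ge0_integralZl_EFin; last 4 first.
  - exact: measurableD.
  - by move=> x; rewrite -SrE => -[[Ox _] _]; rewrite lee_fin h_ge0.
  - exact: mhr.
  - exact: B0.
  rewrite -SrE [leRHS]integral_mkcondr; apply: ge0_le_integral.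
  - exact: mD.
  - by move=> x [Ox _]; rewrite lee_fin mulr_ge0// h_ge0.
  - exact: mhphi.
  - apply/(measurable_restrict _ (mN r) mD).1; rewrite SrE.
    by apply: emeasurable_funM; [exact: measurable_cst|exact: mhr].
  - move=> x [Ox nSx]; rewrite patchE; case: ifPn => [_|].
      rewrite -EFinM lee_fin mulrC ler_wpM2r ?h_ge0//.
      apply: le_trans (phileB x); rewrite ger0_norm// ler_piMr//.
      by have /andP[] := chi01 x.
    by move=> nxr; rewrite lee_fin /phi2 /= chi_out ?mulr0// => xr; move: nxr; rewrite mem_set.
have F1fin := integrable_fin_num mD (flux_int _ tphi1).
have F2fin := integrable_fin_num mD (flux_int _ tphi2).
have -> : (\int[mun]_(x in D) (flux u phi x)%:E =
    \int[mun]_(x in D) (flux u phi1 x)%:E + \int[mun]_(x in D) (flux u phi2 x)%:E)%E.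
  rewrite -integralD; [|exact: mD|exact: flux_int|exact: flux_int].
  apply: eq_integral => x _; rewrite -EFinD /flux -big_split/=; congr EFin.
  apply: eq_bigr => alpha _; rewrite -mulrDr; congr (_ * _).
  by have [s _ E] := @partial_multiE R n m alpha; rewrite !E phiE pderivD.
have -> : (\int[mun]_(x in D) (h x * phi x)%:E =
    \int[mun]_(x in D) (h x * phi1 x)%:E + \int[mun]_(x in D) (h x * phi2 x)%:E)%E.
  rewrite -ge0_integralD.
  - by apply: eq_integral => x _; rewrite -EFinD -mulrDr phiE.
  - exact: mD.
  - by move=> x [Ox _]; rewrite lee_fin mulr_ge0// h_ge0.
  - exact: mhphi.
  - by move=> x [Ox _]; rewrite lee_fin mulr_ge0// h_ge0.
  - exact: mhphi.
apply: le_trans (leeD (weak_off weak tphi1S phi1_ge0) h2le) _.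
have F2abs : (`|\int[mun]_(x in D) (flux u phi2 x)%:E| <=
    (A * #|{: multi_index n m}|%:R * (2 ^+ m * (B * C) * 2 ^+ m) * eta)%:E)%E.
  apply: le_trans F2le; apply: le_abse_integral; first exact: mD.
  by have /integrableP[] := flux_int _ tphi2.
move: F1fin F2fin F2abs; rewrite -/D.
case: (\int[mun]_(x in D) (flux u phi1 x)%:E)%E => // f1 _.
case: (\int[mun]_(x in D) (flux u phi2 x)%:E)%E => // f2 _.
rewrite /= !lee_fin ler_norml => /andP[f2le _].
have Ke : K1 * eta <= e.
  by rewrite /eta mulrCA ler_piMr ?(ltW e0)// ler_pdivrMr ?mul1r ?lerDl// ltr_wpDl.
move: Ke; rewrite /K1 mulrDl.
by move: f2le; set X := _ * eta; set Y := B * eta => ? ?; lra.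
Qed.

End weak_solution_estimates.

(** * Behaviour near the singular set *)

(** Off [W] the patched value [+oo] imposes no constraint. *)
Lemma ess_inf_onP {R : realType} {n : nat} (W : set 'rV[R]_n) (h : 'rV[R]_n -> R) (y : \bar R) :
  (y <= ess_inf_on W h)%E <-> {ae mes R n, forall x, W x -> (y <= (h x)%:E)%E}.
Proof.
split=> [/ess_infP|] [N [mN N0 yN]]; last first.
  apply/ess_infP; exists N; split => // x /= nle; apply: yN => /= yx; apply: nle.
  by rewrite /patch; case: ifPn => [/set_mem/yx//|_]; exact: leey.
exists N; split => // x /= nle; apply: yN => /= yx; apply: nle => Wx.
by move: yx; rewrite /patch mem_set.
Qed.

(** * Finiteness of the source mass near the singular set *)

Section growth_near_singular_set.
Context {R : realType} {m n : nat}.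
Hypothesis m_gt0 : (0 < m)%N.
Variable S : set 'rV[R]_n.
Hypothesis cS : compact S.
Variables (f u : 'rV[R]_n -> R) (g : R -> R).
Hypothesis hg : C2_halfline g.
Hypothesis g0 : g 0 = 0.
Hypothesis g_pos : forall z : R, 0 < z ->
  [/\ 0 < g z, 0 < hderive g z & 0 < hderive (hderive g) z].
Hypothesis G1 : (G m g 1 < +oo)%E.
Variables R1 C0 C1 : R.

Local Notation T := (Rn R n).
Local Notation mun := (mes R n).
Local Notation Uint W := (\int[mun]_(x in W) (`|u x|)%:E)%E.
Local Notation Hint W := (\int[mun]_(x in W) (f x * g `|u x|)%:E)%E.

Hypothesis mu_ : measurable_fun (nbd S R1 `\` S : set T) (u : T -> R).
Hypothesis mf_ : measurable_fun (nbd S R1 `\` S : set T) (f : T -> R).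
Hypothesis f_ge0 : forall x, (nbd S R1 `\` S) x -> 0 <= f x.
Hypothesis u_fin : forall r, 0 < r -> (Uint (nbd S R1 `\` nbd S r) < +oo)%E.
Hypothesis C0_ge0 : 0 <= C0.
Hypothesis C1_gt0 : 0 < C1.
Hypothesis annulus : forall r1 r2, 0 < r1 -> r1 < r2 -> r2 <= R1 ->
  (Hint (nbd S R1 `\` nbd S r2) <=
   C0%:E + (C1 * (r2 - r1)^-1 ^+ m)%:E * Uint (nbd S r2 `\` nbd S r1))%E.

Lemma measurable_g_abs (W : set T) (v : T -> R) : measurable W ->
  measurable_fun W v -> measurable_fun W ((fun x => g `|v x|) : T -> R).
Proof.
move=> mW mv; have mv' : measurable_fun W ((fun x => `|v x|) : T -> R).
  by apply: (@measurableT_comp _ _ _ _ _ _ (fun y : R => `|y|)).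
have sub : [set `|v x| | x in W] `<=` `[0, +oo[%classic.
  by move=> _ [x _ <-] /=; rewrite in_itv/= andbT.
exact: (measurable_comp (measurable_itv _) sub (convex_measurable hg) mv').
Qed.

Let sub_off r r' : 0 < r' -> r <= R1 -> nbd S r `\` nbd S r' `<=` nbd S R1 `\` S.
Proof. by move=> r'0 rR x [xr nx]; split; [exact: nbd_le xr|move=> /(sub_nbd r'0)]. Qed.

Let mA r r' : measurable (nbd S r `\` nbd S r' : set T).
Proof. by apply: measurableD; exact: measurable_nbd. Qed.

Let mW1 : measurable (nbd S R1 `\` S : set T).
Proof. by apply: measurableD; [exact: measurable_nbd|exact: measurable_compact]. Qed.

Let g_ge0 y : 0 <= y -> 0 <= g y.
Proof. exact: convex_ge0. Qed.

Let mabs (W : set T) : W `<=` nbd S R1 `\` S ->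
  measurable_fun W (fun x => (`|u x|)%:E).
Proof.
move=> WD; apply/measurable_EFinP.
by apply: (@measurableT_comp _ _ _ _ _ _ (fun y : R => `|y|)) => //; exact: measurable_funS mu_.
Qed.

Let mg (W : set T) : measurable W -> W `<=` nbd S R1 `\` S ->
  measurable_fun W ((fun x => g `|u x|) : T -> R).
Proof. by move=> mW WD; apply: measurable_g_abs => //; exact: measurable_funS mu_. Qed.

Let mH (W : set T) : measurable W -> W `<=` nbd S R1 `\` S ->
  measurable_fun W (fun x => (f x * g `|u x|)%:E).
Proof.
move=> mW WD; apply/measurable_EFinP; apply: measurable_funM; last exact: mg.
exact: measurable_funS mf_.
Qed.

Let h_ge0 x : (nbd S R1 `\` S) x -> 0 <= f x * g `|u x|.
Proof. by move=> Wx; rewrite mulr_ge0 ?f_ge0 ?g_ge0. Qed.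

(** Vanishing mass in the layer is set apart because [blowup_bound] needs a positive starting value.
    In the last case [V] is determined by the layer and [M], not by [F]; this later excludes an
    infinite essential infimum. *)
Lemma annulus_dichotomy r F M : 0 < r -> r <= R1 -> 0 < M -> 0 < F ->
  (mun (nbd S r `\` S) <= M%:E)%E ->
  {ae mun, forall x, (nbd S r `\` S) x -> F ^+ m <= f x} ->
  [\/ (Hint (nbd S R1 `\` nbd S r) <= (2 * C0)%:E)%E,
      Uint (nbd S r `\` nbd S (r / 2)) = 0%E |
      exists V, [/\ 0 < V, Uint (nbd S r `\` nbd S (r / 2)) = (M * V)%:E &
        r * F <= 4 * (4 * C1) `^ (1 / m%:R) * G_real m g (V / 2)]].
Proof.
move=> r0 rR1 M0 F0 muM fF.
have mono W1 W2 : measurable (W1 : set T) -> measurable (W2 : set T) -> W1 `<=` W2 ->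
    W2 `<=` nbd S R1 `\` S -> (Uint W1 <= Uint W2)%E.
  move=> m1 m2 W12 WD; apply: ge0_subset_integral.
  - exact: m1.
  - exact: m2.
  - exact: mabs.
  - by move=> x _; rewrite lee_fin.
  - exact: W12.
have Ufin rho : 0 < rho -> Uint (nbd S r `\` nbd S rho) \is a fin_num.
  move=> rho0; rewrite ge0_fin_numE; last by apply: integral_ge0 => x _; rewrite lee_fin.
  apply: le_lt_trans (u_fin rho0); apply: mono => //.
    by move=> x [xr nx]; split => //; exact: nbd_le xr.
  exact: sub_off.
pose w s := fine (Uint (nbd S r `\` nbd S (r - s))) / M.
have UE s : s < r -> Uint (nbd S r `\` nbd S (r - s)) = (M * w s)%:E.
  move=> sr; rewrite /w mulrCA divff ?gt_eqF// mulr1 fineK// Ufin// subr_gt0//.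
have w_ge0 s : 0 <= w s.
  rewrite divr_ge0 ?(ltW M0)// fine_ge0//.
  by apply: integral_ge0 => x _; rewrite lee_fin.
have wmono a b : 0 <= a -> a <= b -> b < r -> w a <= w b.
  move=> a0 ab br; rewrite /w ler_pM2r ?invr_gt0//; apply: fine_le.
  - by rewrite Ufin// subr_gt0 (le_lt_trans ab).
  - by rewrite Ufin// subr_gt0.
  - apply: mono => //.
      by move=> x [xr nx]; split => // xb; apply: nx; apply: nbd_le xb; lra.
    by apply: sub_off => //; rewrite subr_gt0.
(* In the second case the source mass off the smaller neighbourhoods [nbd S (r - a)] also exceeds
   [2 * C0], so [C0] can be absorbed. *)
have [small|big] := leP (Hint (nbd S R1 `\` nbd S r)) (2 * C0)%:E; first exact: Or31.
have growth a h : 0 <= a -> 0 < h -> a + h < r ->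
    (F * h) ^+ m * g (w a) <= (2 * C1) * w (a + h).
  move=> a0 h0 ahr; have ar : a < r by lra.
  have ra0 : 0 < r - a by rewrite subr_gt0.
  have upper := @annulus (r - (a + h)) (r - a).
  rewrite (_ : r - a - (r - (a + h)) = h) in upper; last by lra.
  have {}upper : (Hint (nbd S R1 `\` nbd S (r - a)) <=
      (C0 + C1 * h^-1 ^+ m * (M * w (a + h)))%:E)%E.
    apply: le_trans (upper _ _ _) _; [lra|lra|lra|].
    rewrite EFinD leeD2l// [leRHS]EFinM -UE//; apply: lee_wpmul2l.
      by rewrite lee_fin mulr_ge0 ?(ltW C1_gt0)// exprn_ge0// invr_ge0 ltW.
    apply: mono => //.
      by move=> x [xr nx]; split => //; apply: nbd_le xr; lra.
    by apply: sub_off => //; lra.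
  have lower : ((F ^+ m * (M * g (w a)))%:E <= Hint (nbd S R1 `\` nbd S (r - a)))%E.
    apply: (@le_trans _ _ (Hint (nbd S r `\` nbd S (r - a)))); last first.
      apply: ge0_subset_integral.
      - exact: mA.
      - exact: mA.
      - by apply: mH => //; exact: sub_off.
      - by move=> x xW; rewrite lee_fin h_ge0//; apply: sub_off xW.
      - by move=> x [xr nx]; split => //; exact: nbd_le xr.
    apply: (@le_trans _ _ (\int[mun]_(x in nbd S r `\` nbd S (r - a)) ((F ^+ m)%:E * (g `|u x|)%:E)%E)%E).
      rewrite ge0_integralZl_EFin; last 1 first.
      - by rewrite exprn_ge0// ltW.
      - rewrite EFinM; apply: lee_wpmul2l; first by rewrite lee_fin exprn_ge0// ltW.
        (* At a positive value the slope [g' (w a)] is positive, as Jensen's inequality requires of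
           [p]; at 0 the claim is trivial. *)
        have [wa0|wa0] := eqVneq (w a) 0.
          rewrite wa0 g0 mulr0; apply: integral_ge0 => x _; by rewrite lee_fin g_ge0.
        have wap : 0 < w a by rewrite lt_neqAle eq_sym wa0 w_ge0.
        apply: (@jensen_support _ _ _ mun _ (fun x => `|u x|) g M (w a) (hderive g (w a))).
        + exact: mA.
        + apply: le_trans muM; apply: le_measure; rewrite ?inE//.
            by apply: measurableD; [exact: measurable_nbd|exact: measurable_compact].
          by move=> x [xr nx]; split => // /(sub_nbd ra0).
        + by apply/measurable_EFinP/mabs/sub_off.
        + by apply: mg; [exact: mA|exact: sub_off].
        + by move=> x _; exact: normr_ge0.
        + exact: g_ge0.
        + exact: g0.
        + by case: (g_pos wap) => _ /ltW.
        + exact: w_ge0.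
        + by move=> y y0; apply: convex_support => //; exact: w_ge0.
        + exact: UE.
      - exact: mA.
      - by move=> x _; rewrite lee_fin g_ge0.
      - by apply/measurable_EFinP; apply: mg => //; exact: sub_off.
    apply: ae_ge0_le_integral.
    - exact: mA.
    - by move=> x _; rewrite mule_ge0// lee_fin ?g_ge0// exprn_ge0// ltW.
    - apply/measurable_EFinP; apply: measurable_funM; first exact: measurable_cst.
      by apply: mg => //; exact: sub_off.
    - by move=> x xW; rewrite lee_fin h_ge0//; exact: sub_off xW.
    - by apply: mH => //; exact: sub_off.
    - case: fF => N [mN N0 FN]; exists N; split => // x /= nle; apply: FN => /= Fx; apply: nle.
      move=> [xr nx]; rewrite -EFinM lee_fin ler_wpM2r ?g_ge0// Fx//.
      by split => // /(sub_nbd ra0).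
  have lower2 : ((2 * C0)%:E < Hint (nbd S R1 `\` nbd S (r - a)))%E.
    apply: (lt_le_trans big); apply: ge0_subset_integral.
    - exact: mA.
    - exact: mA.
    - by apply: mH => //; exact: sub_off.
    - by move=> x xW; rewrite lee_fin h_ge0//; apply: sub_off xW.
    - by move=> x [xR nx]; split => // xra; apply: nx; apply: nbd_le xra; lra.
  have := le_trans lower upper; have := lt_le_trans lower2 upper.
  move: lower lower2 upper; case: (integral _ _ _) => [e|//|//].
  rewrite !lee_fin !lte_fin => le1 le2 le3 _ _.
  (* From [e <= C0 + X] and [2 C0 < e] follows [e <= 2 X]; this is the factor 2 in [2 * C1]. *)
  have : F ^+ m * (M * g (w a)) <= 2 * (C1 * h^-1 ^+ m * (M * w (a + h))) by lra.
  have hm0 : 0 < h ^+ m by rewrite exprn_gt0.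
  rewrite -(ler_pM2l hm0) -(ler_pM2l M0) => le4.
  rewrite -(ler_pM2l M0) exprMn -(ler_pM2l M0).
  move: le4; rewrite exprVn; have hK : h ^+ m * (h ^+ m)^-1 = 1 by rewrite divff// gt_eqF.
  set X := w (a + h); set Y := g (w a).
  have -> : M * (h ^+ m * (2 * (C1 * (h ^+ m)^-1 * (M * X)))) =
    M * (M * (2 * C1 * X)) * (h ^+ m * (h ^+ m)^-1) by ring.
  by rewrite hK mulr1; apply: le_trans; rewrite le_eqVlt; apply/orP; left; apply/eqP; ring.
have r2 : 0 <= r / 2 by rewrite divr_ge0// ltW.
have r2r : r / 2 < r by lra.
have rr2 : r - r / 2 = r / 2 by lra.
have := UE _ r2r; rewrite rr2 => U2.
have [w0|w0] := eqVneq (w (r / 2)) 0; first by apply: Or32; rewrite U2 w0 mulr0.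
have wp : 0 < w (r / 2) by rewrite lt_neqAle eq_sym w0 w_ge0.
apply: Or33; exists (w (r / 2)); split => //.
have K0 : 0 < 2 * C1 by rewrite mulr_gt0.
have := @blowup_bound R g hg g_pos m m_gt0 G1 w r F (2 * C1) (r / 2) F0 K0 wmono growth r2 r2r wp.
rewrite rr2 (_ : 2 * (2 * C1) = 4 * C1); last by ring.
by set X := _ `^ _; set Y := G_real _ _ _; set c := X * Y; rewrite -!mulrA -/c; lra.
Qed.

(** The source mass off [nbd S r] is bounded by [Beta] for all small [r], and exhaustion passes this
    to the limit. The essential infimum may be zero, positive or infinite, and each case is treated
    separately. *)
Lemma source_integrable_near k : 0 < R1 ->
  (limf_esup (fun r : R =>
     mes R n (nbd S r `\` S) * ((r `^ (n%:R - k))^-1)%:E) 0^'+ < +oo)%E ->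
  (forall C : R, 0 < C ->
   (limf_esup (fun r : R => (r `^ (n%:R - k - m%:R))%:E *
      G_inv m g ((C * r)%:E *
        ess_inf_on (nbd S r `\` S) (fun x => (f x `^ (1 / m%:R))%R))) 0^'+ < +oo)%E) ->
  (Hint (nbd S R1 `\` S) < +oo)%E.
Proof.
move=> R10 hmes hlimsup.
have [Cm [e1 [Cm0 e10 mesB]]] := limf_esup_lt_pinfty hmes.
(* The constant of [annulus_dichotomy]. The limsup hypothesis is used with [C = C2^-1], which turns
   the third alternative into [C r F <= G (V / 2)]. *)
pose C2 := 4 * (4 * C1) `^ (1 / m%:R).
have C20 : 0 < C2 by rewrite mulr_gt0// powR_gt0// mulr_gt0.
have C2V : 0 < C2^-1 by rewrite invr_gt0.
have [B [e2 [B0 e20 GB]]] := limf_esup_lt_pinfty (hlimsup _ C2V).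
(* The second entry is the annulus estimate with [r1 = r / 2], [r2 = r], once [r^(n-k-m) V <= 2 B]
   is known. *)
pose Beta := Num.max (2 * C0) (C0 + C1 * 2 ^+ m * (2 * B * Cm)).
apply: (@le_lt_trans _ _ Beta%:E); last exact: ltry.
have e0 : 0 < Num.min e1 (Num.min e2 R1) by rewrite !lt_min e10 e20 R10.
apply: (@integral_off_compact_le _ _ _ cS (nbd S R1) (fun x => (f x * g `|u x|)%:E) Beta%:E _ _ _ _ e0).
- exact: measurable_nbd.
- exact: mH.
- by move=> x xR nSx; rewrite lee_fin h_ge0.
move=> r r0; rewrite !lt_min => /and3P[re1 re2 rR1].
have rR1' := ltW rR1.
have rp (a : R) : 0 < r `^ a by rewrite powR_gt0.
have C0Beta : ((2 * C0)%:E <= Beta%:E)%E by rewrite lee_fin le_max lexx.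
pose M := Cm * r `^ (n%:R - k).
have M0 : 0 < M by rewrite mulr_gt0.
have muM : (mun (nbd S r `\` S) <= M%:E)%E.
  by have := mesB r r0 re1; rewrite lee_pdivrMr// -EFinM.
have aeF F : 0 < F -> (F%:E <= ess_inf_on (nbd S r `\` S) (fun x => f x `^ (1 / m%:R))%R)%E ->
    {ae mun, forall x, (nbd S r `\` S) x -> F ^+ m <= f x}.
  move=> F0 /ess_inf_onP[N [mN_ N0 FN]]; exists N; split => // x /= nle; apply: FN => /= Fx; apply: nle.
  move=> xr; move: (Fx xr); rewrite lee_fin => {}Fx.
  have fx0 : 0 <= f x by apply: f_ge0; case: xr => xr nSx; split => //; exact: nbd_le xr.
  have -> : f x = (f x `^ (1 / m%:R)) ^+ m.
    by rewrite -powR_mulrn ?powR_ge0// -powRrM mul1r mulVf ?powRr1// pnatr_eq0 -lt0n.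
  by rewrite lerXn2r// nnegrE ?powR_ge0// ltW.
have := GB r r0 re2; have : (0 <= ess_inf_on (nbd S r `\` S) (fun x => f x `^ (1 / m%:R))%R)%E.
  by apply/ess_inf_onP; apply: nearW => x _; rewrite lee_fin powR_ge0.
have U0 : Uint (nbd S r `\` nbd S (r / 2)) = 0%E -> (Hint (nbd S R1 `\` nbd S r) <= Beta%:E)%E.
  move=> U0; have := @annulus (r / 2) r.
  rewrite U0 mule0 adde0 => /(_ _ _ rR1')/le_trans; apply; [lra|lra|].
  by apply: le_trans C0Beta; rewrite lee_fin ler_peMl// ler1n.
move: aeF; case: (ess_inf_on _ _) => [i||//] aeF.
(* A zero essential infimum makes [G_inv] equal to [+oo], against the bound [B]. *)
- rewrite lee_fin le_eqVlt => /predU1P[<-|i0].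
    by rewrite mule0 /G_inv eqxx gt0_muley ?lte_fin// leye_eq.
  move=> GrB; have [/le_trans|/U0//|[V [V0 UV rV]]] := annulus_dichotomy r0 rR1' M0 i0 muM (aeF _ i0 (lexx _)).
    exact.
  (* Here [V / 2 <= tau], while the limsup hypothesis bounds [r^(n-k-m) tau] by [B]. *)
  have [|||tau Vtau tauE] := @G_inv_ge R g hg g_pos m m_gt0 G1 (C2^-1 * r * i) (V / 2).
  - by rewrite divr_gt0.
  - by rewrite !mulr_gt0.
  - by rewrite -mulrA ler_pdivrMl.
  move: GrB; rewrite -EFinM tauE -EFinM lee_fin => GrB.
  apply: (le_trans (@annulus (r / 2) r _ _ rR1')); [lra|lra|].
  rewrite UV -EFinM -EFinD lee_fin le_max; apply/orP; right; rewrite lerD2l.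
  rewrite (_ : r - r / 2 = r / 2); last by lra.
  rewrite -!mulrA ler_pM2l// invf_div expr_div_n -mulrA ler_pM2l ?exprn_gt0//.
  rewrite -ler_pdivlMl ?invr_gt0 ?exprn_gt0// invrK /M.
  have -> : r `^ (n%:R - k) = r ^+ m * r `^ (n%:R - k - m%:R).
    rewrite -powR_mulrn ?(ltW r0)// -powRD; last by rewrite (gt_eqF r0) implybT.
    by congr (_ `^ _); ring.
  have rm : 0 < r ^+ m by rewrite exprn_gt0.
  have : r `^ (n%:R - k - m%:R) * V <= 2 * B.
    by have := rp (n%:R - k - m%:R); set q := _ `^ _ in GrB * => q0; nra.
  set q := _ `^ _ => qV; have : 0 < r ^+ m * Cm by rewrite mulr_gt0.
  move=> /ler_pM2l/(_ (q * V) (2 * B)); rewrite qV; set z := r ^+ m => h1.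
  by have : z * Cm * (q * V) <= z * Cm * (2 * B) by []; nra.
(* An infinite essential infimum admits every [F]. A first application with [F = 1] yields [V]; the
   second takes [F] with [r F] larger than [C2 G (V / 2)] by 1, which is contradictory. *)
- move=> _ _; have [/le_trans|/U0//|[V [V0 UV _]]] := annulus_dichotomy r0 rR1' M0 ltr01 muM (aeF _ ltr01 (leey _)).
    exact.
  pose F := (C2 * G_real m g (V / 2) + 1) / r.
  have F0 : 0 < F by rewrite divr_gt0// ltr_wpDl// mulr_ge0 ?(ltW C20)// Gr_ge0.
  have [/le_trans|/U0//|[V' [V'0 UV' rV']]] := annulus_dichotomy r0 rR1' M0 F0 muM (aeF _ F0 (leey _)).
    exact.
  exfalso; move: UV'; rewrite UV => -[] /(mulfI (lt0r_neq0 M0)) VV'.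
  by move: rV'; rewrite -VV' /F mulrCA divff ?gt_eqF// mulr1 -/C2; lra.
Qed.

End growth_near_singular_set.

(** * Integrability of [u] by Young's inequality *)

Section integrability.
Context d (X : measurableType d) (R : realType) (mu_X : {measure set X -> \bar R}).
Variables (m : nat) (g : R -> R).
Hypothesis m_gt0 : (0 < m)%N.
Hypothesis hg : C2_halfline g.
Hypothesis g0 : g 0 = 0.
Hypothesis g_pos : forall z : R, 0 < z ->
  [/\ 0 < g z, 0 < hderive g z & 0 < hderive (hderive g) z].
Hypothesis G1 : (G m g 1 < +oo)%E.

(** Integrates the pointwise bound [|u| <= f g(|u|) + gamma (1 / f)], in which [gamma (1 / f)] is
    [+oo] where [f] vanishes. *)
Lemma young_integral_lt (W : set X) (f u : X -> R) : measurable W ->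
  measurable_fun W f -> measurable_fun W u -> (forall x, W x -> 0 <= f x) ->
  (\int[mu_X]_(x in W) (f x * g `|u x|)%:E < +oo)%E ->
  (\int[mu_X]_(x in W) gamma_recip g (f x) < +oo)%E ->
  (\int[mu_X]_(x in W) (`|u x|)%:E < +oo)%E.
Proof.
move=> mW mf mu_ f_ge0 hfin gfin.
have mabs : measurable_fun W (fun x => `|u x|).
  by apply: (@measurableT_comp _ _ _ _ _ _ (fun y : R => `|y|)).
have sub (v : X -> R) : (forall x, W x -> 0 <= v x) -> [set v x | x in W] `<=` `[0, +oo[%classic.
  by move=> v0 _ [x Wx <-] /=; rewrite in_itv/= andbT v0.
have mgu : measurable_fun W (fun x => g `|u x|).
  exact: (measurable_comp (measurable_itv _) (sub _ (fun x _ => normr_ge0 (u x)))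
    (convex_measurable hg) mabs).
have mgam : measurable_fun W (fun x => gamma_recip g (f x)).
  exact: (measurable_comp (measurable_itv _) (sub _ f_ge0)
    (measurable_gamma_recip hg g0 g_pos m_gt0 G1) mf).
have mh : measurable_fun W (fun x => (f x * g `|u x|)%:E).
  by apply/measurable_EFinP; exact: measurable_funM.
have h_ge0 x : W x -> (0 <= (f x * g `|u x|)%:E)%E.
  by move=> Wx; rewrite lee_fin mulr_ge0 ?f_ge0 ?(convex_ge0 g0 g_pos).
have gam_ge0 x : W x -> (0 <= gamma_recip g (f x))%E.
  by move=> Wx; apply: (gamma_recip_ge0 hg g0 g_pos m_gt0 G1); exact: f_ge0.
apply: (@le_lt_trans _ _ (\int[mu_X]_(x in W) ((f x * g `|u x|)%:E + gamma_recip g (f x)))%E).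
  apply: ge0_le_integral.
  - exact: mW.
  - by move=> x _; rewrite lee_fin.
  - exact/measurable_EFinP.
  - exact: emeasurable_funD.
  - by move=> x Wx; apply: (young_gamma hg g0 g_pos m_gt0 G1) => //; exact: f_ge0.
by rewrite ge0_integralD// lte_add_pinfty.
Qed.

End integrability.

(** * Decay of the masses of [|u|] and of the source along small radii *)

Section decay_near_singular_set.
Context {R : realType} {m n : nat}.
Variable S : set 'rV[R]_n.
Hypothesis cS : compact S.
Variables (f u : 'rV[R]_n -> R) (g : R -> R).
Hypothesis hg : C2_halfline g.
Hypothesis g_ge0 : forall z : R, 0 <= z -> 0 <= g z.
Variables R1 k : R.

Local Notation T := (Rn R n).
Local Notation mun := (mes R n).
Local Notation Uint W := (\int[mun]_(x in W) (`|u x|)%:E)%E.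
Local Notation Hint W := (\int[mun]_(x in W) (f x * g `|u x|)%:E)%E.

Hypothesis R1_gt0 : 0 < R1.
Hypothesis mu_ : measurable_fun (nbd S R1 `\` S : set T) (u : T -> R).
Hypothesis mf_ : measurable_fun (nbd S R1 `\` S : set T) (f : T -> R).
Hypothesis f_ge0 : forall x, (nbd S R1 `\` S) x -> 0 <= f x.
Hypothesis hfin : (Hint (nbd S R1 `\` S) < +oo)%E.
Hypothesis hmes : (limf_esup (fun r : R =>
  mes R n (nbd S r `\` S) * ((r `^ (n%:R - k))^-1)%:E) 0^'+ < +oo)%E.
Hypothesis hliminf : forall C : R, 0 < C ->
  (limf_einf (fun r : R => (r ^+ m)%:E * mu g (C * r `^ (m%:R - n%:R + k)) *
     ess_inf_on (nbd S r `\` S) f) 0^'+ > 0)%E.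

(** The infimum is at least 0 and at most [g t / t], hence real. *)
Lemma mu_fin (t : R) : 0 < t ->
  exists2 nu, mu g t = nu%:E & 0 <= nu /\ forall s, t <= s -> nu * s <= g s.
Proof.
move=> t0; have mu_ge0 : (0 <= mu g t)%E.
  apply: le_ereal_inf_tmp => _ /= [s + <-]; rewrite in_itv/= andbT => ts.
  by rewrite lee_fin divr_ge0 ?g_ge0// (le_trans (ltW t0)).
have mu_le s : t <= s -> (mu g t <= (g s / s)%:E)%E.
  by move=> ts; apply: ereal_inf_lbound; exists s => //=; rewrite in_itv/= andbT.
move: mu_ge0 mu_le; case: (mu g t) => [nu|_ /(_ _ (lexx t))|//]; last by rewrite leye_eq.
rewrite lee_fin => nu0 mu_le; exists nu => //; split => // s ts.
by rewrite -ler_pdivlMr ?(lt_le_trans t0)// -lee_fin mu_le.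
Qed.

Lemma decay_near eta e : 0 < eta -> 0 < e ->
  exists r, [/\ 0 < r, r < e, (Uint (nbd S r `\` S) <= (eta * r ^+ m)%:E)%E &
    (Hint (nbd S r `\` S) <= eta%:E)%E].
Proof.
move=> eta0 e0.
have [Cm [e1 [Cm0 e10 mesB]]] := limf_esup_lt_pinfty hmes.
(* Against the measure bound [Cm r^(n-k)], the threshold [T0] contributes [eta r^m / 2]. *)
pose eps := eta / (2 * Cm).
have eps0 : 0 < eps by rewrite divr_gt0// mulr_gt0.
have [c [e2 [c0 e20 infB]]] := limf_einf_gt0 (hliminf eps0).
(* The first entry bounds the source mass itself; the second leaves [eta r^m / 2] after
   multiplication by [r^m / c]. *)
pose delta := Num.min eta (eta * c / 2).
have delta0 : 0 < delta by rewrite lt_min eta0/= divr_gt0// mulr_gt0.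
have mW1 : measurable (nbd S R1 `\` S : set T).
  by apply: measurableD; [exact: measurable_nbd|exact: measurable_compact].
have mabs (W : set T) : W `<=` nbd S R1 `\` S -> measurable_fun W (fun x => `|u x|).
  move=> WD; apply: (@measurableT_comp _ _ _ _ _ _ (fun y : R => `|y|)) => //.
  exact: measurable_funS mu_.
have mh (W : set T) : W `<=` nbd S R1 `\` S -> measurable_fun W (fun x => (f x * g `|u x|)%:E).
  move=> WD; have mh1 : measurable_fun (nbd S R1 `\` S : set T) ((fun x => f x * g `|u x|) : T -> R).
    by apply: measurable_funM => //; exact: measurable_g_abs.
  by apply/measurable_EFinP; exact: measurable_funS mh1.
have h_ge0 x : (nbd S R1 `\` S) x -> (0 <= (f x * g `|u x|)%:E)%E.
  by move=> Wx; rewrite lee_fin mulr_ge0 ?f_ge0 ?g_ge0.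
have h_ge0' x : nbd S R1 x -> ~ S x -> (0 <= (f x * g `|u x|)%:E)%E.
  by move=> xR nSx; exact: h_ge0.
have [r0 [r00 r0R1 hsmall]] := @integral_nbd_small _ _ _ cS (nbd S R1)
    (fun x => (f x * g `|u x|)%:E) delta R1 (@measurable_nbd _ _ S R1)
    (mh _ (fun x => id)) h_ge0' hfin delta0 R1_gt0 (fun x => id).
pose r := Num.min (Num.min e e1) (Num.min e2 r0) / 2.
have rm0 : 0 < Num.min (Num.min e e1) (Num.min e2 r0) by rewrite !lt_min e0 e10 e20.
have r_gt0 : 0 < r by rewrite divr_gt0.
have : r < Num.min (Num.min e e1) (Num.min e2 r0) by rewrite /r; lra.
rewrite !lt_min => /andP[/andP[re re1] /andP[re2 rr0]].
have hr := hsmall r r_gt0 (ltW rr0).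
have subr : nbd S r `\` S `<=` nbd S R1 `\` S.
  by move=> x [xr nSx]; split => //; apply: nbd_le xr; rewrite (le_trans (ltW rr0)).
have mr : measurable (nbd S r `\` S : set T).
  by apply: measurableD; [exact: measurable_nbd|exact: measurable_compact].
exists r; split => //; last by apply: le_trans hr _; rewrite lee_fin ge_min lexx.
have rmp : 0 < r ^+ m by rewrite exprn_gt0.
pose T0 := eps * r `^ (m%:R - n%:R + k).
have T00 : 0 < T0 by rewrite mulr_gt0// powR_gt0.
have [nu muE [nu0 nuP]] := mu_fin T00.
have := infB r r_gt0 re2; rewrite -/T0 muE -EFinM => cle.
have bound : {ae mun, forall x, (nbd S r `\` S) x ->
    ((`|u x|)%:E <= T0%:E + (r ^+ m / c)%:E * (f x * g `|u x|)%:E)%E}.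
  have /ess_inf_onP[N [mN_ N0 FN]] := lexx (ess_inf_on (nbd S r `\` S) f).
  exists N; split => // x /= nle; apply: FN => /= Fx; apply: nle => xr.
  have fx : c <= r ^+ m * nu * f x.
    rewrite -lee_fin (le_trans cle)// [leRHS]EFinM lee_wpmul2l ?Fx//.
    by rewrite lee_fin mulr_ge0// ltW.
  have hx : 0 <= f x * g `|u x| by rewrite -lee_fin h_ge0//; exact: subr.
  (* Above the threshold [T0] the definition of [mu] gives [nu |u x| <= g |u x|], and
     [c <= r^m nu f x] converts this into the second term. *)
  rewrite -EFinM -EFinD lee_fin; have [le|lt] := leP `|u x| T0.
    by rewrite (le_trans le)// lerDl mulr_ge0// divr_ge0 ?ltW.
  have nux := nuP _ (ltW lt); have fx0 := f_ge0 (subr _ xr).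
  rewrite -[leLHS]add0r lerD ?(ltW T00)// mulrAC ler_pdivlMr// mulrC.
  apply: (@le_trans _ _ (r ^+ m * nu * f x * `|u x|)); first by rewrite ler_wpM2r.
  have -> : r ^+ m * nu * f x * `|u x| = r ^+ m * (f x * (nu * `|u x|)) by ring.
  by rewrite ler_pM2l// ler_wpM2l.
have rc0 : 0 <= r ^+ m / c by rewrite divr_ge0 ?ltW.
apply: (@le_trans _ _ (\int[mun]_(x in nbd S r `\` S)
    (T0%:E + (r ^+ m / c)%:E * (f x * g `|u x|)%:E))%E).
  apply: ae_ge0_le_integral.
  - exact: mr.
  - by move=> x _; rewrite lee_fin.
  - exact/measurable_EFinP/mabs.
  - by move=> x /subr/h_ge0 hx; apply: adde_ge0; [rewrite lee_fin ltW|exact: mule_ge0].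
  - apply: emeasurable_funD; first exact: measurable_cst.
    by apply: emeasurable_funM; [exact: measurable_cst|exact: mh].
  - exact: bound.
have -> : (\int[mun]_(x in nbd S r `\` S) (T0%:E + (r ^+ m / c)%:E * (f x * g `|u x|)%:E) =
    \int[mun]_(x in nbd S r `\` S) T0%:E +
    \int[mun]_(x in nbd S r `\` S) ((r ^+ m / c)%:E * (f x * g `|u x|)%:E))%E.
  apply: ge0_integralD.
  - exact: mr.
  - by move=> x _; rewrite lee_fin ltW.
  - exact: measurable_cst.
  - by move=> x /subr/h_ge0 hx; exact: mule_ge0.
  - by apply: emeasurable_funM; [exact: measurable_cst|exact: mh].
have -> : (\int[mun]_(x in nbd S r `\` S) ((r ^+ m / c)%:E * (f x * g `|u x|)%:E) =
    (r ^+ m / c)%:E * Hint (nbd S r `\` S))%E.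
  apply: ge0_integralZl_EFin; [exact: mr| |exact: mh|exact: rc0].
  by move=> x /subr/h_ge0.
rewrite integral_cst//=.
have -> : eta * r ^+ m = T0 * (Cm * r `^ (n%:R - k)) + r ^+ m / c * (eta * c / 2).
  rewrite /T0 mulrACA -powRD; last by rewrite (gt_eqF r_gt0) implybT.
  rewrite (_ : m%:R - n%:R + k + (n%:R - k) = m%:R); last by ring.
  by rewrite powR_mulrn ?(ltW r_gt0)// /eps; field; rewrite !gt_eqF.
rewrite EFinD [(T0 * _)%:E]EFinM [(_ / c * _)%:E]EFinM; apply: leeD; apply: lee_wpmul2l.
- by rewrite lee_fin ltW.
- by have := mesB r r_gt0 re1; rewrite lee_pdivrMr ?powR_gt0.
- by rewrite lee_fin.
- by apply: le_trans hr _; rewrite lee_fin ge_min lexx orbT.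
Qed.

End decay_near_singular_set.

(** * Removability from integrability and decay near the singular set *)

Theorem theorem2p4 (R : realType) (m n : nat) (hm : (1 <= m)%N) (hn : (1 <= n)%N)
  (Omega S : set 'rV[R]_n) (hOmega : bounded_domain Omega)
  (hS : compact S) (hSOmega : S `<=` Omega)
  (a : multi_index n m -> 'rV[R]_n -> R -> R)
  (ha : forall alpha, caratheodory_function Omega (a alpha))
  (A : R) (hA : 0 < A)
  (haA : forall alpha, {ae mes R n, forall x, Omega x ->
     forall z : R, `|a alpha x z| <= A * `|z|})
  (f : 'rV[R]_n -> R) (hf : measurable_fun (Omega : set (Rn R n)) f)
  (hf0 : forall x, Omega x -> 0 <= f x)
  (g : R -> R) (hg : C2_halfline g) (hg_ge0 : forall z : R, 0 <= z -> 0 <= g z)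
  (hg0 : g 0 = 0)
  (hg_pos : forall z : R, 0 < z ->
     [/\ 0 < g z, 0 < hderive g z & 0 < hderive (hderive g) z])
  (hG : (G m g 1 < +oo)%E)
  (hgamma : (\int[mes R n]_(x in Omega `\` S) gamma_recip g (f x) < +oo)%E)
  (k : R)
  (hmes : (limf_esup (fun r : R =>
       mes R n (nbd S r `\` S) * ((r `^ (n%:R - k))^-1)%:E) 0^'+ < +oo)%E)
  (hlimsup : forall C : R, 0 < C ->
     (limf_esup (fun r : R => (r `^ (n%:R - k - m%:R))%:E *
        G_inv m g ((C * r)%:E *
          ess_inf_on (nbd S r `\` S) (fun x => (f x `^ (1 / m%:R))%R))) 0^'+ < +oo)%E)
  (hliminf : forall C : R, 0 < C ->
     (limf_einf (fun r : R => (r ^+ m)%:E * mu g (C * r `^ (m%:R - n%:R + k)) *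
        ess_inf_on (nbd S r `\` S) f) 0^'+ > 0)%E) :
  forall u : 'rV[R]_n -> R,
    weak_solution Omega S a f g u -> removable Omega S a f g u.
Proof.
move=> u [uhL1 weak]; have [openO _ _ _] := hOmega.
have uL1 r (r0 : 0 < r) := (uhL1 r r0).1; have hL1 r (r0 : 0 < r) := (uhL1 r r0).2.
have mO : measurable (Omega : set (Rn R n)) by exact: open_measurable_Rn.
have mS := measurable_compact hS.
have mD : measurable (Omega `\` S : set (Rn R n)) by exact: measurableD.
have mu_ := measurable_off openO hS uL1; have mh_ := measurable_off openO hS hL1.
have mf_ : measurable_fun (Omega `\` S : set (Rn R n)) (f : Rn R n -> R).
  by apply: measurable_funS hf => // x [].
have [R1 [C0 [C1 [R1_gt0 C0_ge0 C1_gt0 R1O annulus]]]] :=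
  annulus_estimate hm openO hS hSOmega ha hA haA hf0 hg_ge0 uL1 hL1 weak.
have sub : nbd S R1 `\` S `<=` Omega `\` S by move=> x [/R1O].
have mu1 : measurable_fun (nbd S R1 `\` S : set (Rn R n)) (u : Rn R n -> R).
  exact: measurable_funS mu_.
have mf1 : measurable_fun (nbd S R1 `\` S : set (Rn R n)) (f : Rn R n -> R).
  exact: measurable_funS mf_.
have f1 x : (nbd S R1 `\` S) x -> 0 <= f x by move=> /sub[/hf0].
have mA r r' : measurable (nbd S r `\` nbd S r' : set (Rn R n)).
  by apply: measurableD; exact: measurable_nbd.
have u_fin r : 0 < r -> (\int[mes R n]_(x in nbd S R1 `\` nbd S r) (`|u x|)%:E < +oo)%E.
  move=> r0; apply: L1_abs_fin; apply: integrableS (uL1 _ r0).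
  - by apply: measurableD => //; exact: measurable_nbd.
  - exact: mA.
  - by move=> x [/R1O].
have near := source_integrable_near hm hS hg hg0 hg_pos hG mu1 mf1 f1 u_fin C0_ge0 C1_gt0
  annulus R1_gt0 hmes hlimsup.
have h_ge0 x : (Omega `\` S) x -> (0 <= (f x * g `|u x|)%:E)%E.
  by move=> [Ox _]; rewrite lee_fin mulr_ge0 ?hf0 ?hg_ge0.
(* Split at [R1]: the far part is finite by the definition of a weak solution, the near part by the
   blow-up argument. *)
have hfin : (\int[mes R n]_(x in Omega `\` S) (f x * g `|u x|)%:E < +oo)%E.
  have DE : (Omega `\` nbd S R1) `|` (nbd S R1 `\` S) = Omega `\` S.
    apply/seteqP; split => [x [[Ox nx]|/sub//]|x [Ox nSx]].
      by split => // /(sub_nbd R1_gt0).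
    by have [xr|nr] := pselect (nbd S R1 x); [right|left].
  have mO1 : measurable (Omega `\` nbd S R1 : set (Rn R n)).
    by apply: measurableD => //; exact: measurable_nbd.
  have mN1 : measurable (nbd S R1 `\` S : set (Rn R n)).
    by apply: measurableD => //; exact: measurable_nbd.
  rewrite -DE ge0_integral_setU.
  - apply: lte_add_pinfty near.
    have /integrableP[_] := hL1 _ R1_gt0; apply: le_lt_trans.
    apply: le_trans (lee_abs _) (le_abse_integral _ mO1 _).
    by apply/measurable_EFinP; apply: measurable_funS mh_ => // x xD; rewrite -DE; left.
  - exact: mO1.
  - exact: mN1.
  - by rewrite DE; exact/measurable_EFinP.
  - by rewrite DE.
  - by rewrite disj_set2E; apply/eqP/seteqP; split => // x [[_ nr] [xr _]].
have hint : L1 (Omega `\` S) (fun x => f x * g `|u x|).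
  apply/integrableP; split; first exact/measurable_EFinP.
  rewrite (@eq_integral _ _ _ (mes R n) _ (fun x => (f x * g `|u x|)%:E))// => x.
  by rewrite inE => /h_ge0 hx; rewrite gee0_abs.
(* The source has to come first: integrability of [u] up to [S] is deduced from it. *)
have ufin : (\int[mes R n]_(x in Omega `\` S) (`|u x|)%:E < +oo)%E.
  apply: (young_integral_lt hm hg hg0 hg_pos hG mD mf_ mu_ _ hfin hgamma).
  by move=> x [/hf0].
have uint : L1 (Omega `\` S) u by apply/integrableP; split; first exact/measurable_EFinP.
apply: (removable_of_decay openO hS hSOmega ha hA haA hf0 hg_ge0 uL1 hL1 weak hg0 uint hint).
exact: (decay_near hS hg hg_ge0 R1_gt0 mu1 mf1 f1 near hmes hliminf).
Qed.
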